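(* Let $L u = a_{ij}(x)u_{ij} + b_i(x)u_i$ be an operator on $\overline{B}_1\subset\mathbb{R}^n$ with smooth coefficients, with $A=(a_{ij})$ symmetric and $0<\lambda \le A(x)\le \Lambda$ in $B_1$. Let $u\in C^\infty(\overline{B}_1)$ be a stable solution of $-Lu=f(u)$ in $B_1$, for some nonnegative function $f\in C^1(\mathbb{R})$. Assume that $$\|DA\|_{C^0(\overline{B}_1)}+\|b\|_{C^0(\overline{B}_1)}\le\varepsilon$$ for some $\varepsilon>0$. Then there exists a universal $\varepsilon_0>0$ with the following property: if $\varepsilon\le\varepsilon_0$, then $$\|\nabla u\|_{L^2(B_{1/2})}\le C\|u\|_{L^1(B_1)},$$ where $C$ is a universal constant.
   Context: $B_r$ is the open ball of radius $r$ centered at $0$ in $\mathbb{R}^n$. Repeated indices are summed; $u_i=\partial_i u$, $u_{ij}=\partial_{ij}u$. The operator is $Lu=a_{ij}(x)u_{ij}+b_i(x)u_i$ with $a_{ij}=a_{ji}$, $A(x)=(a_{ij}(x))$, $b=(b_i)$, the coefficients being smooth on $\overline{B}_1$. Uniform ellipticity $\lambda\le A(x)\le\Lambda$ means $0<\lambda\le a_{ij}(x)p_ip_j\le\Lambda$ for all $x\in B_1$ and all $p\in\mathbb{R}^n$ with $|p|=1$. A constant is called universal if it depends only on $n$, $\lambda$, and $\Lambda$. Stability: a solution $u$ of $-Lu=f(u)$ in $B_1$ is stable if there exists $\varphi\in C^2(B_1)\cap C^0(\overline{B}_1)$ with $-L\varphi\ge f'(u)\varphi$ in $B_1$, $\varphi>0$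 in $B_1$, and $\varphi=0$ on $\partial B_1$. No boundary condition is imposed on $u$. *)

(* Defs.v *)
From HB Require Import structures.
From mathcomp Require Import all_boot all_order all_algebra.
From mathcomp Require Import all_classical all_reals all_analysis.

Set Implicit Arguments.
Unset Strict Implicit.
Unset Printing Implicit Defensive.

Import Order.TTheory GRing.Theory Num.Theory.
Import numFieldNormedType.Exports.

Local Open Scope classical_set_scope.
Local Open Scope ring_scope.

(* As for [n.-tuple T] in the library, the sigma-algebra is the one generated
   by the coordinates. *)
Section measurable_rV.
Context {R : realType} (n : nat).

Let coords (i : 'I_n) (x : 'rV[R]_n) : measurableTypeR R := x ord0 i.

Let rV_set0 : g_sigma_preimage coords set0.
Proof. exact: sigma_algebra0. Qed.

Let rV_setC A : g_sigma_preimage coords A -> g_sigma_preimage coords (~` A).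
Proof. exact: sigma_algebraC. Qed.

Let rV_bigcup (F : (set 'rV[R]_n)^nat) :
  (forall i, g_sigma_preimage coords (F i)) ->
  g_sigma_preimage coords (\bigcup_i F i).
Proof. exact: sigma_algebra_bigcup. Qed.

HB.instance Definition _ := @isMeasurable.Build default_measure_display
  'rV[R]_n (g_sigma_preimage coords) rV_set0 rV_setC rV_bigcup.

Lemma measurable_coord (i : 'I_n) :
  measurable_fun [set: 'rV[R]_n] (fun x => x ord0 i : measurableTypeR R).
Proof.
move=> _ Y mY; rewrite setTI; apply: sub_sigma_algebra => /=.
rewrite -bigcup_seq/=; exists i => /=; first by rewrite mem_index_enum.
by exists Y => //; rewrite setTI.
Qed.

Lemma measurable_fun_rVP d (T : measurableType d) (f : T -> 'rV[R]_n) :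
  (forall i, measurable_fun [set: T] (fun x => f x ord0 i : measurableTypeR R)) ->
  measurable_fun [set: T] f.
Proof.
move=> mf _ A; move: A.
have : g_sigma_preimage coords `<=` [set A | measurable (f @^-1` A)].
  apply: smallest_sub.
    split => /=; first by rewrite preimage_set0.
    - by move=> A mA; rewrite setTD preimage_setC; exact: measurableC.
    - by move=> F mF; rewrite preimage_bigcup; exact: bigcup_measurable.
  rewrite -bigcup_seq => A [i _ [B mB <-]] /=.
  by rewrite setTI -comp_preimage -[X in measurable X]setTI; exact: mf.
by move=> + A mA; rewrite setTI; apply.
Qed.

End measurable_rV.

Section lebesgue_rV.
Context {R : realType}.

Definition consV n (p : measurableTypeR R * 'rV[R]_n) : 'rV[R]_n.+1 :=
  row_mx (p.1)%:M p.2.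

Lemma consV0 n p : @consV n p ord0 ord0 = p.1.
Proof.
transitivity (row_mx (p.1)%:M p.2 (ord0 : 'I_1) (lshift n (ord0 : 'I_1))).
  by congr (row_mx _ _ _ _); exact: val_inj.
by rewrite row_mxEl mxE.
Qed.

Lemma consVS n p (i : 'I_n) : @consV n p ord0 (lift ord0 i) = p.2 ord0 i.
Proof.
transitivity (row_mx (p.1 : R)%:M p.2 (ord0 : 'I_1) (rshift 1 i)).
  by congr (row_mx _ _ _ _); exact: val_inj.
by rewrite row_mxEr.
Qed.

Definition splitV n (x : 'rV[R]_n.+1) : measurableTypeR R * 'rV[R]_n :=
  (x ord0 ord0, \row_i x ord0 (lift ord0 i)).

Lemma splitVK n : cancel (@splitV n) (@consV n).
Proof.
move=> x; apply/rowP => i; case: (unliftP ord0 i) => [j|] ->.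
  by rewrite consVS mxE.
by rewrite consV0.
Qed.

Lemma consVK n : cancel (@consV n) (@splitV n).
Proof.
move=> [a v]; congr pair; first by rewrite consV0.
by apply/rowP => i; rewrite mxE consVS.
Qed.

Lemma measurable_consV n : measurable_fun [set: _] (@consV n).
Proof.
apply: measurable_fun_rVP => i; case: (unliftP ord0 i) => [j|] ->.
  under eq_fun do rewrite consVS.
  exact: (measurableT_comp (measurable_coord j) measurable_snd).
by under eq_fun do rewrite consV0; exact: measurable_fst.
Qed.

HB.instance Definition _ n :=
  isMeasurableFun.Build _ _ _ _ (@consV n) (@measurable_consV n).

Lemma measurable_splitV n : measurable_fun [set: _] (@splitV n).
Proof.
apply: measurable_fun_pair; first exact: measurable_coord.
apply: measurable_fun_rVP => i; under eq_fun do rewrite mxE.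
exact: measurable_coord.
Qed.

Section step.
Variables (n : nat) (m : {sigma_finite_measure set 'rV[R]_n -> \bar R}).

Definition lebesgueS : set 'rV[R]_n.+1 -> \bar R :=
  pushforward (lebesgue_measure \x m)%E (@consV n).

Let lebesgueS0 : lebesgueS set0 = 0%E.
Proof. exact: measure0. Qed.

Let lebesgueS_ge0 A : (0 <= lebesgueS A)%E.
Proof. exact: measure_ge0. Qed.

Let lebesgueS_sigma_additive : semi_sigma_additive lebesgueS.
Proof. exact: measure_semi_sigma_additive. Qed.

HB.instance Definition _ := isMeasure.Build _ _ _ lebesgueS
  lebesgueS0 lebesgueS_ge0 lebesgueS_sigma_additive.

Let lebesgueS_sigma_finite : sigma_finite setT lebesgueS.
Proof.
have [F UF mF] : sigma_finite setT (lebesgue_measure \x m)%E.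
  have /sigma_finiteP[F [TF ndF Foo]] := sigma_finiteT (@lebesgue_measure R).
  have /sigma_finiteP[G [TG ndG Goo]] := sigma_finiteT m.
  exists (fun k => F k `*` G k).
    rewrite -setXTT TF TG; apply/seteqP; split => -[x y] /=.
      move=> [[i _ Fx] [j _ Gy]]; exists (maxn i j) => //; split.
      - by move: x Fx; exact/subsetPset/ndF/leq_maxl.
      - by move: y Gy; exact/subsetPset/ndG/leq_maxr.
    by move=> [k _ [? ?]]; split; exists k.
  move=> k; have [? ?] := Foo k; have [? ?] := Goo k.
  split; first exact: measurableX.
  by rewrite product_measure1E// lte_mul_pinfty// ge0_fin_numE.
exists (fun k => @splitV n @^-1` F k).
  by rewrite -preimage_bigcup -UF preimage_setT.
move=> k; have [mFk Fkoo] := mF k; split.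
  by rewrite -[X in measurable X]setTI; exact: measurable_splitV.
rewrite /lebesgueS /pushforward -comp_preimage.
suff -> : @splitV n \o @consV n = id by rewrite preimage_id.
by apply/funext => p /=; rewrite consVK.
Qed.

HB.instance Definition _ := Measure_isSigmaFinite.Build _ _ _ lebesgueS
  lebesgueS_sigma_finite.

End step.

(* The n-fold product of the Lebesgue measure of R, transported along
   R * R^n = R^(n+1). *)
Fixpoint lebesgue_rV (n : nat) : {sigma_finite_measure set 'rV[R]_n -> \bar R} :=
  if n is k.+1 then lebesgueS (lebesgue_rV k) else \d_(0 : 'rV[R]_0).

Lemma measurable_box n (a b : 'rV[R]_n) :
  measurable [set x : 'rV[R]_n | forall i, a ord0 i <= x ord0 i <= b ord0 i].
Proof.
have -> : [set x : 'rV[R]_n | forall i, a ord0 i <= x ord0 i <= b ord0 i] =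
    \bigcap_(i in [set: 'I_n])
      ((fun x : 'rV[R]_n => x ord0 i) @^-1` `[a ord0 i, b ord0 i]).
  apply/seteqP; split => x /= xab i; last by move: (xab i I); rewrite /= in_itv.
  by move=> _ /=; rewrite in_itv /=; exact: xab.
apply: fin_bigcap_measurable => // i _.
by rewrite -[X in measurable X]setTI; apply: measurable_coord.
Qed.

Lemma lebesgue_rV_box n (a b : 'rV[R]_n) : (forall i, a ord0 i <= b ord0 i) ->
  lebesgue_rV n [set x : 'rV[R]_n | forall i, a ord0 i <= x ord0 i <= b ord0 i] =
    (\prod_(i < n) (b ord0 i - a ord0 i))%:E.
Proof.
elim: n a b => [|n IH] a b ab.
  by rewrite big_ord0 /= diracE mem_set// => -[].
pose a' : 'rV[R]_n := \row_i a ord0 (lift ord0 i).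
pose b' : 'rV[R]_n := \row_i b ord0 (lift ord0 i).
have ab' i : a' ord0 i <= b' ord0 i by rewrite !mxE.
rewrite /= /lebesgueS /pushforward.
have -> : @consV n @^-1`
      [set x : 'rV[R]_n.+1 | forall i, a ord0 i <= x ord0 i <= b ord0 i] =
    `[a ord0 ord0, b ord0 ord0]%classic `*`
    [set x : 'rV[R]_n | forall i, a' ord0 i <= x ord0 i <= b' ord0 i].
  apply/seteqP; split => [[x v] /= xv|[x v] /= []].
    split; first by rewrite in_itv /=; have := xv ord0; rewrite consV0.
    by move=> i; rewrite !mxE; have := xv (lift ord0 i); rewrite consVS.
  rewrite in_itv /= => xab vab i; case: (unliftP ord0 i) => [j|] ->.
    by have := vab j; rewrite consVS !mxE.
  by rewrite consV0.
rewrite product_measure1E//; last exact: measurable_box.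
rewrite IH// big_ord_recl EFinM; congr (_ * _)%E.
  apply: (etrans (@lebesgue_measure_itv R `[a ord0 ord0, b ord0 ord0])).
  rewrite /= lte_fin EFinB; case: ltgtP (ab ord0) => // -> _.
  by rewrite -EFinB subrr.
by congr EFin; apply: eq_bigr => i _; rewrite !mxE.
Qed.

End lebesgue_rV.

Section defs.
Context {R : realType} {n : nat}.
Implicit Types (u g : 'rV[R]_n -> R) (x p : 'rV[R]_n) (i : 'I_n) (s : seq 'I_n).

(* The library norm on ['rV[R]_n] is the max norm. *)
Definition enorm x : R := Num.sqrt (\sum_i (x ord0 i) ^+ 2).

Definition Ball (r : R) : set 'rV[R]_n := [set x | enorm x < r].
Definition cBall (r : R) : set 'rV[R]_n := [set x | enorm x <= r].

Definition pderiv i u : 'rV[R]_n -> R := fun x => 'D_(delta_mx ord0 i) u x.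

Definition grad u x : 'rV[R]_n := \row_i pderiv i u x.

(* [pderivs [:: i1; ..; ik] u] is the iterated partial derivative
   d_i1 (d_i2 (.. (d_ik u))). *)
Definition pderivs s u : 'rV[R]_n -> R := foldr pderiv u s.

Definition Ck (k : nat) (U : set 'rV[R]_n) u : Prop :=
  (forall s, (size s < k)%N -> forall i x, U x ->
     derivable (pderivs s u) x (delta_mx ord0 i)) /\
  (forall s, (size s <= k)%N -> {within U, continuous (pderivs s u)}).

(* C^oo on the closed unit ball: smooth in the open ball, continuous up to the
   boundary, and every partial derivative has a continuous extension to the
   closed ball. *)
Definition smooth_cBall u : Prop :=
  [/\ forall k, Ck k (Ball 1) u,
      {within cBall 1, continuous u} &
      forall s, exists2 g, {within cBall 1, continuous g} &
        {in Ball 1, g =1 pderivs s u}].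

(* Extension by continuity to the closed ball. It gives the derivatives of a
   smooth function their values on the sphere, where [pderiv] would depend on
   the values of the function outside the closed ball. *)
Definition cext g : 'rV[R]_n -> R :=
  fun x => lim (g y @[y --> within (Ball 1) (nbhs x)]).

(* In [\bar R], since the real-valued [sup] of an unbounded set is 0. *)
Definition C0norm g : \bar R := ereal_sup [set `|g x|%:E | x in cBall 1].

Implicit Types (A : 'rV[R]_n -> 'M[R]_n) (b : 'rV[R]_n -> 'rV[R]_n).

(* The Euclidean norm of the tensor (d_k a_ij). *)
Definition norm_DA A x : R :=
  Num.sqrt (\sum_i \sum_j \sum_k cext (pderiv k (fun y => A y i j)) x ^+ 2).

Definition Lop A b u x : R :=
  \sum_i \sum_j A x i j * pderivs [:: i; j] u x + \sum_i b x ord0 i * pderiv i u x.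

Definition elliptic (lam Lam : R) A : Prop :=
  0 < lam /\ forall x p, Ball 1 x -> enorm p = 1 ->
    lam <= \sum_i \sum_j A x i j * p ord0 i * p ord0 j <= Lam.

Definition C1_real (f : R -> R) : Prop :=
  (forall t, derivable f t 1) /\ continuous (derive1 f).

Definition solution A b (f : R -> R) u : Prop :=
  forall x, Ball 1 x -> - Lop A b u x = f (u x).

Definition stable A b (f : R -> R) u : Prop :=
  exists phi : 'rV[R]_n -> R,
    [/\ Ck 2 (Ball 1) phi /\ {within cBall 1, continuous phi},
        forall x, Ball 1 x -> derive1 f (u x) * phi x <= - Lop A b phi x,
        forall x, Ball 1 x -> 0 < phi x &
        forall x, enorm x = 1 -> phi x = 0].

Definition Lp_norm (p : \bar R) (U : set 'rV[R]_n) g : \bar R :=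
  'N[lebesgue_rV n]_p [(EFin \o g) \_ U]%E.

End defs.

(* Main.v *)
From HB Require Import structures.
Require Import Defs.
From mathcomp Require Import all_boot all_order all_algebra.
From mathcomp Require Import all_classical all_reals all_analysis.
From mathcomp Require Import measurable_realfun ring lra zify.

Set Implicit Arguments.
Unset Strict Implicit.
Unset Printing Implicit Defensive.

Import Order.TTheory GRing.Theory Num.Theory.
Import numFieldNormedType.Exports.

Local Open Scope classical_set_scope.
Local Open Scope ring_scope.

(** Let E(r), K(r) and U(r) be the integrals over the ball of radius r of
|grad u|^2, of the sum of the |u_i u_ii|, and of u^2, and let L be the L^1 norm
of u on the unit ball. The bound E(1/2) <= C L^2 comes from three inequalities,
combined so that E is absorbed into itself. The value eps0 = 1 suffices: all
that the smallness condition has to give is |d_k a_ij| <= 1 and |b_i| <= 1.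

(1) Stability ([energy_estimate]): (s - r)^4 K(r) <= C E(s). With g = |grad u|,
nu = grad u / g, h = D^2 u and s = h nu = grad g, multiply the inequality for
the supersolution phi by eta^2 g^2 / phi, multiply the equation for u_k (the
derivative of the equation of u) by eta^2 u_k, and subtract. The terms in f'(u)
cancel, and completing a square leaves, up to a divergence and lower order
terms, the upper bound of Sternberg and Zumbrun for eta^2 D, where
  D = (sum over l of A(h_l, h_l)) - A(s, s) >= 0.
The defect D controls the rows of h minus their part nu_l s along nu, hence
everything in h except one number, and that number is controlled by tr(A h)
([hessian_entry_le]). The trace has almost a sign, since f >= 0 gives
- tr(A h) >= b . grad u; so |tr(A h)| <= - tr(A h) + C g, and - g tr(A h) is
half of - div(g A grad u) up to g D^(1/2) and lower order terms, because
tr(A h) and A(nu, s) differ by at most C D^(1/2) ([trace_sub_bform_le]).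
Altogether ([pointwise_energy]), at every point,
  eta^2 g |h| <= C g^2 (eta^2 + |grad eta|^2) + a divergence,
where the divergence is that of a field with the factor eta^2, so that its
integral vanishes. Since g is not differentiable where grad u = 0, it is
replaced by the square root of |grad u|^2 + d2; the new error is
d2 |f'(u)| eta^2, which disappears as d2 tends to 0.

(2) Interpolation on short segments parallel to the axes
([gradient_interpolation]): E(r) <= C d^-2 U(r + d) + 2 d K(r + d).

(3) A local Nash inequality ([mean_interpolation]):
U(r) <= 2 d^-n L^2 + n d^2 E(r + n d), from the comparison of u with its
translates by the vectors of a small cube.

For a step proportional to (s - r)^4 in (2), and a much smaller one in (3), the
three give E(r) <= gam E(s) + C (s - r)^-m L^2 for 1/2 <= r < s < 3/4 with
gam = 2^-(m+1) ([gradient_contraction]), and iteration along radii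
increasing to 3/4 yields the bound of E(1/2) ([absorb_half_power]).

Integration by parts is needed only in the form that the derivative of a
compactly supported C^1 function has integral 0 ([integral_derivative_eq0]),
which follows, as do the integrations along segments in (2) and (3), from the
invariance of the Lebesgue measure under translations. *)

(** * Borel sets and translations of R^n *)

Section borel_rV.
Context {R : realType} {n : nat}.
Implicit Types (O D : set 'rV[R]_n).

(** The measurable sets are generated by the coordinates, and the topology is that
of the max norm: an open set is a countable union of boxes with rational
centres. *)
Lemma open_measurable_rV O : open O -> measurable O.
Proof.
move=> oO.
pose box (ck : 'rV[rat]_n * nat) : set 'rV[R]_n :=
  let a := \row_i (ratr (ck.1 ord0 i) - ck.2.+1%:R^-1) : 'rV[R]_n in
  let b := \row_i (ratr (ck.1 ord0 i) + ck.2.+1%:R^-1) : 'rV[R]_n in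
  [set y : 'rV[R]_n | forall i, a ord0 i <= y ord0 i <= b ord0 i].
pose P ck := box ck `<=` O.
have -> : O = \bigcup_ck (if `[< P ck >] then box ck else set0).
  apply/seteqP; split; last first.
    by move=> x [ck _]; case: asboolP => // /[apply].
  move=> x Ox.
  have /nbhs_ballP[e /= e0 xeO] : nbhs x O by exact: open_nbhs_nbhs.
  have [k kltb] : exists k, k.+1%:R^-1 < e / 2 :> R.
    exists (Num.bound ((e / 2)^-1)).
    rewrite invf_plt ?posrE ?divr_gt0 ?ltr0n//.
    rewrite (lt_le_trans (archi_boundP _)) ?ler_nat//.
    by rewrite invr_ge0 divr_ge0// ltW.
  have /choice[c xc] : forall i, exists q : rat, `|x ord0 i - ratr q| < k.+1%:R^-1 :> R.
    move=> i; have : x ord0 i - k.+1%:R^-1 < x ord0 i + k.+1%:R^-1 :> R.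
      by rewrite ltrD2l gtrN// invr_gt0 ltr0n.
    move=> /rat_in_itvoo[q]; rewrite inE => /andP[/= q1 q2]; exists q.
    rewrite !bnd_simp in q1 q2.
    by rewrite ltr_distl ltrBlDr q2 -ltrBlDr.
  exists (\row_i c i, k) => //; case: asboolP => /=.
    move=> _ i; rewrite !mxE; move: (xc i).
    move: (ratr _) (_^-1) => q d.
    by rewrite ltr_norml => /andP[? ?]; apply/andP; split; lra.
  move=> /asboolP; rewrite asbool_neg => /asboolP []; move=> y /= yb; apply: xeO.
  split => // i j; rewrite (ord1 i) -ball_normE /=.
  move: (xc j) (yb j) kltb; rewrite !mxE; move: (ratr _) (_^-1) => q d; rewrite !ltr_norml => /andP[? ?] /andP[? ?] ?.
  by apply/andP; split; lra.
apply: countable_bigcupT_measurable => [|ck]; first exact: countableP.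
by case: asboolP => // _; exact: measurable_box.
Qed.

Lemma open_continuous_measurable_rV D (f : 'rV[R]_n -> R) : open D ->
  {in D, continuous f} -> measurable_fun D (f : _ -> measurableTypeR R).
Proof.
move=> oD cf.
apply: (measurability _ (RGenOpens.measurableE R)).
move=> _ [_ [a [b ->] <-]]; apply: open_measurable_rV.
exact/(continuous_inP _ oD).1/interval_open.
Qed.

Lemma measurable_add_rV d (T : measurableType d) (f g : T -> 'rV[R]_n) :
  measurable_fun setT f -> measurable_fun setT g ->
  measurable_fun setT (fun t => f t + g t).
Proof.
move=> mf mg; apply: measurable_fun_rVP => i.
under eq_fun do rewrite mxE.
by apply: measurable_funD; apply: (measurableT_comp (measurable_coord i)).
Qed.

Lemma measurable_scale_rV (v : 'rV[R]_n) :
  measurable_fun setT (fun t : measurableTypeR R => t *: v).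
Proof.
apply: measurable_fun_rVP => i; under eq_fun do rewrite mxE.
exact: measurable_funM.
Qed.

End borel_rV.

Section translation.
Context {R : realType}.
Local Open Scope ereal_scope.
Notation mu1 := (@lebesgue_measure R).

(** A measure on the line is determined by its values on the intervals ]a, b]. *)
Lemma lebesgue_measure_shift (z : R) (A : set R) : measurable A ->
  pushforward mu1 (fun x : measurableTypeR R => x + z : measurableTypeR R)%R A
  = mu1 A.
Proof.
have mz : measurable_fun setT
    (fun x : measurableTypeR R => x + z : measurableTypeR R)%R.
  exact: measurable_funD.
pose phi := HB.pack_for {mfun measurableTypeR R >-> measurableTypeR R}
   (fun x : measurableTypeR R => x + z : measurableTypeR R)%R
   (isMeasurableFun.Build _ _ _ _ _ mz).
move=> mA; apply/esym.
have := @lebesgue_measure_unique R (pushforward mu1 phi); apply => // _ [[a b]] _ <-.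
have E : (fun x : measurableTypeR R => x + z : measurableTypeR R)%R @^-1`
    `]a, b]%classic = `](a - z)%R, (b - z)%R]%classic.
  by apply/seteqP; split => x /=; rewrite !in_itv /= ltrBlDr lerBrDr.
rewrite /= /pushforward /= E.
rewrite !lebesgue_measure_itv /= !lte_fin ltrD2r.
by case: ifPn => // _; rewrite -!EFinB; congr (_%:E); ring.
Qed.

Lemma ge0_integral_shift1 (z : R) (f : measurableTypeR R -> \bar R) :
  measurable_fun setT f -> (forall x, 0 <= f x) ->
  \int[mu1]_x f (x + z)%R = \int[mu1]_x f x.
Proof.
move=> mf f0.
have mz : measurable_fun setT
    (fun x : measurableTypeR R => x + z : measurableTypeR R)%R.
  exact: measurable_funD.
pose phi := HB.pack_for {mfun measurableTypeR R >-> measurableTypeR R}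
   (fun x : measurableTypeR R => x + z : measurableTypeR R)%R
   (isMeasurableFun.Build _ _ _ _ _ mz).
transitivity (\int[pushforward mu1 phi]_x f x).
  by rewrite ge0_integral_pushforward.
by apply: eq_measure_integral => A mA _; exact: lebesgue_measure_shift.
Qed.

(** Tonelli for the first coordinate, which is how the measure of R^(n+1) is built
from that of R^n. *)
Lemma ge0_integral_lebesgueS n (f : 'rV[R]_n.+1 -> \bar R) :
  measurable_fun setT f -> (forall x, 0 <= f x) ->
  \int[lebesgue_rV n.+1]_x f x =
  \int[mu1]_t \int[lebesgue_rV n]_v f (consV (t, v)).
Proof.
move=> mf f0.
rewrite [LHS](_ : _ = \int[pushforward (mu1 \x lebesgue_rV n) (@consV R n)]_x f x) //.
rewrite ge0_integral_pushforward//= preimage_setT.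
by rewrite fubini_tonelli1//; apply: measurableT_comp.
Qed.

Lemma consVD n (p : measurableTypeR R * 'rV[R]_n) (z : 'rV[R]_n.+1) :
  (consV p + z = consV (p.1 + (Defs.splitV z).1, p.2 + (Defs.splitV z).2))%R.
Proof.
apply/rowP => i; rewrite mxE; case: (unliftP ord0 i) => [j|] ->.
  by rewrite !consVS /= !mxE.
by rewrite !consV0.
Qed.

(** By induction on the dimension, one coordinate at a time. *)
Lemma ge0_integral_shift n (z : 'rV[R]_n) (f : 'rV[R]_n -> \bar R) :
  measurable_fun setT f -> (forall x, 0 <= f x) ->
  \int[lebesgue_rV n]_x f (x + z)%R = \int[lebesgue_rV n]_x f x.
Proof.
elim: n z f => [|n IH] z f mf f0.
  by apply: eq_integral => x _; congr f; apply/rowP => -[].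
have mz : measurable_fun setT (fun x : 'rV[R]_n.+1 => x + z)%R.
  exact: measurable_add_rV.
rewrite [LHS]ge0_integral_lebesgueS//; last exact: measurableT_comp.
under eq_integral do under eq_integral do rewrite consVD /=.
have mfc : measurable_fun setT (f \o @consV R n) by exact: measurableT_comp.
rewrite [RHS]ge0_integral_lebesgueS//.
rewrite -[RHS](ge0_integral_shift1 (Defs.splitV z).1); last 2 first.
- by apply: (measurable_fun_fubini_tonelli_F (m2 := lebesgue_rV n) _ mfc) => x /=.
- by move=> t; apply: integral_ge0 => v _.
apply: eq_integral => t _; apply: (IH _ (fun v => f (consV (t + _, v)))%R) => //.
exact: (measurableT_comp mfc (measurable_pair1 _)).
Qed.

End translation.

(** * Continuity and derivatives of combinations of functions *)

Section continuity_rules.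
Context {R : realType} {T : topologicalType}.
Implicit Types (x : T) (f g : T -> R) (c : R).

Lemma cts_cst x c : continuous_at x (fun=> c).
Proof. exact: cvg_cst. Qed.

Lemma ctsD x f g : continuous_at x f -> continuous_at x g ->
  continuous_at x (fun y => f y + g y).
Proof. by move=> *; exact: cvgD. Qed.

Lemma ctsN x f : continuous_at x f -> continuous_at x (fun y => - f y).
Proof. by move=> *; exact: cvgN. Qed.

Lemma ctsB x f g : continuous_at x f -> continuous_at x g ->
  continuous_at x (fun y => f y - g y).
Proof. by move=> *; exact: cvgB. Qed.

Lemma ctsM x f g : continuous_at x f -> continuous_at x g ->
  continuous_at x (fun y => f y * g y).
Proof. by move=> *; exact: cvgM. Qed.

Lemma cts_sqr x f : continuous_at x f -> continuous_at x (fun y => f y ^+ 2).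
Proof. by move=> *; exact: cvgM. Qed.

Lemma cts_norm x f : continuous_at x f -> continuous_at x (fun y => `|f y|).
Proof. by move=> *; exact: cvg_norm. Qed.

Lemma ctsV x f : f x != 0 -> continuous_at x f ->
  continuous_at x (fun y => (f y)^-1).
Proof. by move=> *; exact: cvgV. Qed.

Lemma cts_comp x (h : R -> R) f : continuous_at (f x) h -> continuous_at x f ->
  continuous_at x (fun y => h (f y)).
Proof. by move=> ch cf; exact: (@continuous_comp _ _ _ f h). Qed.

End continuity_rules.

Lemma continuous_at_sum {R : realType} (T : topologicalType) (I : Type) (s : seq I)
    (f : I -> T -> R) (x : T) : (forall i, continuous_at x (f i)) ->
  continuous_at x (fun y => \sum_(i <- s) f i y).
Proof.
move=> cf; rewrite /continuous_at; elim: s => [|i s IH].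
  by under eq_fun do rewrite big_nil; rewrite big_nil; exact: cvg_cst.
by under eq_fun do rewrite big_cons; rewrite big_cons; apply: cvgD; [exact: cf|exact: IH].
Qed.

Section derivative_rules.
Context {R : realType} {V : normedModType R}.
Implicit Types (x v : V) (f g : V -> R) (a b : R).

Lemma is_derive_fcst x v a : is_derive x v (fun=> a) 0.
Proof. exact: is_derive_cst. Qed.

Lemma is_derive_fadd x v f g a b : is_derive x v f a -> is_derive x v g b ->
  is_derive x v (fun y => f y + g y) (a + b).
Proof. by move=> *; exact: is_deriveD. Qed.

Lemma is_derive_fopp x v f a : is_derive x v f a ->
  is_derive x v (fun y => - f y) (- a).
Proof. by move=> *; exact: is_deriveN. Qed.

Lemma is_derive_fsub x v f g a b : is_derive x v f a -> is_derive x v g b ->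
  is_derive x v (fun y => f y - g y) (a - b).
Proof. by move=> *; exact: is_deriveB. Qed.

Lemma is_derive_fmul x v f g a b : is_derive x v f a -> is_derive x v g b ->
  is_derive x v (fun y => f y * g y) (a * g x + f x * b).
Proof.
move=> df dg; have := is_deriveM df dg.
by rewrite /GRing.scale /= [X in is_derive _ _ _ X]addrC [g x * a]mulrC.
Qed.

Lemma is_derive_fsum x v (I : Type) (s : seq I) (f : I -> V -> R) (a : I -> R) :
  (forall i, is_derive x v (f i) (a i)) ->
  is_derive x v (fun y => \sum_(i <- s) f i y) (\sum_(i <- s) a i).
Proof.
move=> df; elim: s => [|i s IH].
  rewrite big_nil (_ : (fun y => _) = fun=> 0); first exact: is_derive_fcst.
  by apply/funext => y; rewrite big_nil.
rewrite big_cons (_ : (fun y => _) = (fun y => f i y + \sum_(j <- s) f j y)).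
  exact: is_derive_fadd.
by apply/funext => y; rewrite big_cons.
Qed.

Lemma is_derive_finv x v f a : f x != 0 -> is_derive x v f a ->
  is_derive x v (fun y => (f y)^-1) (- a / f x ^+ 2).
Proof.
move=> fx0 [df <-]; apply: DeriveDef; first exact: derivableV.
by rewrite deriveV// /GRing.scale /= mulNr mulrC mulNr.
Qed.

(** A directional derivative is the derivative of the restriction to a line, which
reduces this chain rule to that of functions of one variable. *)
Lemma is_derive_comp1 (h : R -> R) x v f a b :
  is_derive (f x) 1 h b -> is_derive x v f a ->
  is_derive x v (fun y => h (f y)) (b * a).
Proof.
move=> dh df.
pose k (t : R) := f (t *: v + x).
have dk : is_derive (0 : R) 1 k a.
  case: df => [df <-]; apply: DeriveDef; first exact: (derivable1P _ _ _).1 df.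
  rewrite /derive; congr (lim _); apply: f_equal2 => //.
  by apply/funext => t /=; rewrite /k addr0 scale0r add0r [t%:A]mulr1.
have dhk : is_derive (0 : R) 1 (h \o k) (b * a).
  apply: (@is_derive1_comp _ h k 0 b a _ dk).
  by rewrite /k scale0r add0r.
case: dhk => [dhk <-].
apply: DeriveDef; first exact: (derivable1P (h \o f) _ _).2 dhk.
rewrite /derive; congr (lim _); apply: f_equal2 => //.
by apply/funext => t /=; rewrite /k addr0 scale0r add0r [t%:A]mulr1.
Qed.

End derivative_rules.

(** * Euclidean balls *)

Section balls.
Context {R : realType} {n : nat}.
Implicit Types (x v : 'rV[R]_n) (r : R) (i : 'I_n).

Definition ei i : 'rV[R]_n := delta_mx ord0 i.

Lemma enorm_ge0 x : 0 <= enorm x.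
Proof. exact: sqrtr_ge0. Qed.

Lemma sqr_enorm x : enorm x ^+ 2 = \sum_i x ord0 i ^+ 2.
Proof. by rewrite sqr_sqrtr// sumr_ge0// => i _; rewrite sqr_ge0. Qed.

Lemma coord_le_enorm x i : `|x ord0 i| <= enorm x.
Proof.
rewrite -(ler_pXn2r (n := 2)) ?nnegrE ?enorm_ge0// sqr_enorm real_normK ?num_real//.
by rewrite (bigD1 i)//= lerDl sumr_ge0// => j _; rewrite sqr_ge0.
Qed.

Lemma enorm_axis_le x i (t : R) : enorm (x + t *: ei i) <= enorm x + `|t|.
Proof.
rewrite -(ler_pXn2r (n := 2)) ?nnegrE ?addr_ge0 ?enorm_ge0//.
rewrite sqrrD !sqr_enorm (bigD1 i)//= [X in _ <= X + _ + _](bigD1 i)//=.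
rewrite !mxE !eqxx mulr1 sqrrD real_normK ?num_real//.
rewrite (eq_bigr (fun j => x ord0 j ^+ 2)); last first.
  by move=> j ji; rewrite !mxE eqxx (negbTE ji) mulr0 addr0.
have : x ord0 i * t <= enorm x * `|t|.
  by rewrite (le_trans (ler_norm _))// normrM ler_wpM2r// coord_le_enorm.
move: (enorm x * _) (_ * t) (t ^+ 2) (x _ _ ^+ 2) (\sum_(_ | _) _) => a b c d e; lra.
Qed.

Lemma enorm_continuous : continuous (@enorm R n).
Proof.
move=> x; apply: continuous_comp; last exact: sqrt_continuous.
apply: continuous_at_sum => i.
apply: (@continuous_comp _ _ _ (fun y : 'rV[R]_n => y ord0 i) (fun t => t ^+ 2)).
  exact: coord_continuous.
exact: exprn_continuous.
Qed.

Lemma open_Ball r : open (@Ball R n r).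
Proof.
rewrite (_ : Ball r = enorm @^-1` [set t | t < r]) //.
by apply: ((continuousP _).1 enorm_continuous); exact: open_lt.
Qed.

Lemma Ball_nbhs r x : Ball r x -> \forall y \near x, Ball r y.
Proof. move=> xr; apply: open_nbhs_nbhs; split; [exact: open_Ball|exact: xr]. Qed.

Lemma measurable_Ball r : measurable (@Ball R n r).
Proof. by apply: open_measurable_rV; exact: open_Ball. Qed.

Lemma Ball_sub r s : r <= s -> @Ball R n r `<=` Ball s.
Proof. by move=> rs x /lt_le_trans; apply. Qed.

Lemma cBall_compact r : compact (@cBall R n r).
Proof.
apply: bounded_closed_compact; last first.
  rewrite (_ : cBall r = enorm @^-1` [set t | t <= r]) //.
  by apply: ((continuous_closedP _).1 enorm_continuous); exact: closed_le.
exists `|r|; split => // M rM x xr /=.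
rewrite [`|_|]/Num.Def.normr/= mx_normrE bigmax_le// => [|[i j] _ /=].
  by rewrite ltW// (le_lt_trans _ rM).
rewrite (ord1 i) (le_trans (coord_le_enorm x j))//.
by rewrite (le_trans xr)// (le_trans (ler_norm _))// ltW.
Qed.

Lemma lebesgue_Ball_lty r : (lebesgue_rV n (@Ball R n r) < +oo)%E.
Proof.
pose a : 'rV[R]_n := const_mx (- `|r|); pose b : 'rV[R]_n := const_mx `|r|.
apply: (@le_lt_trans _ _ (lebesgue_rV n
   [set x : 'rV[R]_n | forall i, a ord0 i <= x ord0 i <= b ord0 i])).
  apply: le_measure; rewrite ?inE; [exact: measurable_Ball|exact: measurable_box|].
  move=> x xr i; rewrite !mxE -ler_norml (le_trans (coord_le_enorm _ _))//.
  by rewrite (le_trans (ltW xr))// ler_norm.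
rewrite lebesgue_rV_box ?ltry// => i; rewrite !mxE.
by rewrite (@le_trans _ _ 0)// oppr_le0.
Qed.

Lemma continuous_Ball_bounded (f : 'rV[R]_n -> R) r s : r < s ->
  {in Ball s, continuous f} -> exists2 M, 0 <= M & forall x, Ball r x -> `|f x| <= M.
Proof.
move=> rs cf.
have sub : cBall r `<=` @Ball R n s by move=> x /le_lt_trans; apply.
have : bounded_set (f @` cBall r).
  apply/compact_bounded/continuous_compact; last exact: cBall_compact.
  apply: continuous_in_subspaceT => x; rewrite inE => /sub xs.
  by apply: cf; rewrite inE.
move=> [M [_ Mf]]; exists (`|M| + 1); first by rewrite addr_ge0.
move=> x xr; apply: (Mf (`|M| + 1)).
  by rewrite ltr_pwDr// ler_norm.
by exists x => //; exact: ltW.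
Qed.

Lemma Ball_integrable (f : 'rV[R]_n -> R) r s : r < s ->
  {in Ball s, continuous f} -> (lebesgue_rV n).-integrable (Ball r) (EFin \o f).
Proof.
move=> rs cf; apply: measurable_bounded_integrable.
- exact: measurable_Ball.
- exact: lebesgue_Ball_lty.
- apply: open_continuous_measurable_rV; first exact: open_Ball.
  by move=> x /set_mem /(Ball_sub (ltW rs)) xs; apply: cf; rewrite inE.
have [M M0 fM] := continuous_Ball_bounded rs cf.
exists M; split; first exact: num_real.
by move=> K MK x xr; apply: (le_trans (fM _ xr)); exact: ltW.
Qed.

Lemma EFin_measurable_Ball (f : 'rV[R]_n -> R) r :
  {in Ball r, continuous f} -> measurable_fun (Ball r) (EFin \o f).
Proof.
move=> cf; apply/measurable_EFinP.
by apply: open_continuous_measurable_rV => //; exact: open_Ball.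
Qed.

End balls.
Arguments ei {R n} i.

(** * The fundamental theorem of calculus along lines *)

Section segment.
Context {R : realType}.
Implicit Types (p q : R -> R) (d : R).
Notation mu1 := (@lebesgue_measure R).

Lemma FTC_segment p q d : 0 < d ->
  (forall t : R, 0 <= t <= d -> is_derive t 1 p (q t)) ->
  (forall t : R, 0 <= t <= d -> {for t, continuous q}) ->
  (\int[mu1]_(t in `[0%R, d]) (q t)%:E = (p d)%:E - (p 0)%:E)%E.
Proof.
move=> d0 dp cq.
have cp (t : R) : 0 <= t <= d -> {for t, continuous p}.
  by move=> /dp [+ _]; move=> /derivable1_diffP; exact: differentiable_continuous.
rewrite (continuous_FTC2 d0 (F := p))//.
- apply: continuous_in_subspaceT => t; rewrite inE /= in_itv /=; exact: cq.
- split.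
  + move=> t; rewrite in_itv /= => /andP[t0 td].
    by have [] := dp t; rewrite ?ltW.
  + by apply: cvg_at_right_filter; apply: cp; rewrite lexx ltW.
  + by apply: cvg_at_left_filter; apply: cp; rewrite lexx ltW.
- move=> t; rewrite in_itv /= => /andP[t0 td].
  by have [] := dp t; rewrite ?ltW// => _; rewrite derive1E.
Qed.

End segment.

Section lines.
Context {R : realType} {n : nat}.
Implicit Types (x v : 'rV[R]_n) (F D : 'rV[R]_n -> R).

Lemma is_derive_line x v F (t d : R) : is_derive (x + t *: v) v F d ->
  is_derive t 1 (fun t => F (x + t *: v)) d.
Proof.
move=> [dF <-].
have E : (fun h : R => h^-1 *: (((fun t => F (x + t *: v)) \o shift t) (h *: 1) -
      F (x + t *: v))) =
    (fun h : R => h^-1 *: ((F \o shift (x + t *: v)) (h *: v) - F (x + t *: v))).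
  apply/funext => h /=; congr (_ *: (F _ - _)).
  by rewrite [h%:A]mulr1 scalerDl addrCA.
by apply: DeriveDef; [rewrite /derivable E|rewrite /derive E].
Qed.

Lemma line_continuous x v (t : R) : {for t, continuous (fun t : R => x + t *: v)}.
Proof.
apply: cvgD; first exact: cvg_cst.
by apply: cvgZr_tmp; exact: cvg_id.
Qed.

Lemma translate_continuous (v x : 'rV[R]_n) : continuous_at x (fun y => y + v).
Proof.
by rewrite /continuous_at; apply: (@cvgD _ _ _ (nbhs x) _ id (cst v)); [exact: cvg_id|exact: cvg_cst].
Qed.

Lemma FTC_line x v F D (T : R) : 0 < T ->
  (forall t : R, 0 <= t <= T -> is_derive (x + t *: v) v F (D (x + t *: v))) ->
  (forall t : R, 0 <= t <= T -> {for (x + t *: v), continuous D}) ->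
  (\int[lebesgue_measure]_(t in `[0%R, T]) (D (x + t *: v)%R)%:E =
    (F (x + T *: v)%R)%:E - (F x)%:E)%E.
Proof.
move=> T0 dF cD.
have := @FTC_segment _ (fun t => F (x + t *: v)) (fun t => D (x + t *: v)) T T0.
rewrite scale0r addr0; apply => t tT; first exact/is_derive_line/dF.
apply: (@continuous_comp _ _ _ (fun t : R => x + t *: v) D); first exact: line_continuous.
exact: cD.
Qed.

End lines.

(** * Averages along lines and integrals of derivatives *)

Section line_averages.
Context {R : realType} {n : nat}.
Local Open Scope ereal_scope.
Implicit Types (x v z : 'rV[R]_n) (F D : 'rV[R]_n -> R) (A E : set 'rV[R]_n).
Notation mu := (lebesgue_rV n).
Notation mu1 := (@lebesgue_measure R).

Lemma integral_shift z (f : 'rV[R]_n -> \bar R) : measurable_fun setT f ->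
  \int[mu]_x f (x + z)%R = \int[mu]_x f x.
Proof.
move=> mf; rewrite integralE [RHS]integralE.
congr (_ - _).
  rewrite -(ge0_integral_shift z (measurable_funepos mf))//.
  by apply: eq_integral => x _; rewrite (funepos_comp f (fun x => x + z)%R).
rewrite -(ge0_integral_shift z (measurable_funeneg mf))//.
by apply: eq_integral => x _; rewrite (funeneg_comp f (fun x => x + z)%R).
Qed.

Lemma integrable_shift z (f : 'rV[R]_n -> \bar R) :
  mu.-integrable setT f -> mu.-integrable setT (fun x => f (x + z)%R).
Proof.
move=> /integrableP[mf foo]; apply/integrableP; split.
  by apply: (measurableT_comp mf); exact: measurable_add_rV.
by rewrite (ge0_integral_shift z (f := fun x => `|f x|))//; exact: measurableT_comp.
Qed.

Lemma ge0_integral_shift_le z A E (f : 'rV[R]_n -> \bar R) :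
  measurable A -> measurable E -> measurable_fun E f -> (forall x, 0 <= f x) ->
  (forall x, A x -> E (x + z)%R) ->
  \int[mu]_(x in A) f (x + z)%R <= \int[mu]_(x in E) f x.
Proof.
move=> mA mE mf f0 AE.
have mfE : measurable_fun setT (f \_ E) by exact/(measurable_restrictT _ _).1.
have fE0 x : 0 <= (f \_ E) x by apply: erestrict_ge0.
rewrite [leRHS]integral_mkcond -(ge0_integral_shift z)//.
have mz : measurable_fun setT (fun x => (f \_ E) (x + z)%R).
  by apply: (measurableT_comp mfE); exact: measurable_add_rV.
apply: (@le_trans _ _ (\int[mu]_(x in A) (f \_ E) (x + z)%R)).
  rewrite le_eqVlt; apply/orP; left; apply/eqP.
  by apply: eq_integral => x /set_mem /AE xE; rewrite patchE mem_set.
exact: ge0_subset_integral.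
Qed.

Lemma measurable_line v (G : 'rV[R]_n -> \bar R) : measurable_fun setT G ->
  measurable_fun setT (fun p : 'rV[R]_n * measurableTypeR R => G (p.1 + p.2 *: v)%R).
Proof.
move=> mG; apply: (measurableT_comp mG).
apply: measurable_add_rV; first exact: measurable_fst.
exact: (measurableT_comp (measurable_scale_rV v) measurable_snd).
Qed.

(** When [h x] is bounded by an integral of [g] over the segment from [x] to
[x + d *: v], the integral of [h] is bounded by [d] times that of [g]: by
Tonelli the segments may be traversed simultaneously, and at each time [t] the
translate by [t *: v] preserves the measure. This is how inequalities in one
variable pass to R^n. *)
Lemma ge0_integral_le_line v A E (h g : 'rV[R]_n -> \bar R) (d : R) :
  measurable A -> measurable E -> measurable_fun A h -> measurable_fun E g ->
  (forall x, A x -> 0 <= h x) -> (forall x, 0 <= g x) -> (0 <= d)%R ->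
  (forall x (t : R), A x -> (0 <= t <= d)%R -> E (x + t *: v)%R) ->
  (forall x, A x -> h x <= \int[mu1]_(t in `[0%R, d]) g (x + t *: v)%R) ->
  \int[mu]_(x in A) h x <= d%:E * \int[mu]_(x in E) g x.
Proof.
move=> mA mE mh mg h0 g0 d0 AE hg.
pose G := g \_ E.
have mG : measurable_fun setT G by exact/(measurable_restrictT _ _).1.
have G0 x : 0 <= G x by apply: erestrict_ge0.
pose f (p : 'rV[R]_n * measurableTypeR R) :=
  G (p.1 + p.2 *: v)%R * (\1_(`[0%R, d]%classic : set R) p.2)%:E.
have mf : measurable_fun setT f.
  apply: emeasurable_funM; first exact: measurable_line.
  apply/measurable_EFinP; apply: (measurableT_comp _ measurable_snd).
  exact: measurable_indic.
have f0 p : 0 <= f p by rewrite mule_ge0.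
apply: (@le_trans _ _ (\int[mu]_(x in A) \int[mu1]_t f (x, t))).
  have mF := measurable_fun_fubini_tonelli_F (m2 := mu1) f mf f0.
  apply: ge0_le_integral => //.
  - exact: measurable_funTS mF.
  - move=> x Ax; apply: (le_trans (hg _ Ax)).
    rewrite integral_mkcond epatch_indic le_eqVlt; apply/orP; left; apply/eqP.
    apply: eq_integral => t _; rewrite /f /= /G.
    have [tI|tI] := boolP (t \in (`[0%R, d]%classic : set R)).
      rewrite patchE mem_set//; apply: AE => //.
      by move: tI; rewrite inE /= in_itv.
    by rewrite indicE (negbTE tI) !mule0.
apply: (@le_trans _ _ (\int[mu]_x \int[mu1]_t f (x, t))).
  apply: ge0_subset_integral => //; last by move=> x _; exact: integral_ge0.
  exact: (measurable_fun_fubini_tonelli_F (m2 := mu1) f mf f0).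
rewrite (fubini_tonelli _ mf f0).
rewrite [leRHS](_ : _ = \int[mu1]_(t in `[0%R, d]) (cst (\int[mu]_x G x) t)); last first.
  rewrite integral_cst//= lebesgue_measure_itv /= lte_fin.
  rewrite muleC -integral_mkcond; case: ltP => [_|d0']; first by rewrite oppr0 adde0.
  by rewrite (_ : d = 0%R) ?mul0e//; apply/eqP; rewrite eq_le d0 d0'.
rewrite [leRHS]integral_mkcond epatch_indic.
rewrite le_eqVlt; apply/orP; left; apply/eqP; apply: eq_integral => t _.
rewrite /f /= ge0_integralZr//; last first.
  exact: (measurableT_comp (measurable_line v mG) (measurable_pair2 _)).
by rewrite ge0_integral_shift.
Qed.

End line_averages.

Section divergence.
Context {R : realType} {n : nat}.
Local Open Scope ereal_scope.
Implicit Types (x v z : 'rV[R]_n) (F D : 'rV[R]_n -> R).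
Notation mu := (lebesgue_rV n).
Notation mu1 := (@lebesgue_measure R).

Lemma continuous_support_integrable F (r : R) : continuous F ->
  (forall x, ~ Ball r x -> F x = 0%R) -> mu.-integrable setT (EFin \o F).
Proof.
move=> cF F0; rewrite (_ : EFin \o F = (EFin \o F) \_ (Ball r)); last first.
  apply/funext => x; rewrite patchE; case: ifPn => //= /negP xr.
  by rewrite F0// => /mem_set.
apply/integrable_restrict => //; first exact: measurable_Ball.
rewrite setTI.
by apply: (@Ball_integrable _ _ F r (r + 1)%R) => //; rewrite ltrDl.
Qed.

(** Consider the double integral of [D (x + t *: v)] for [t] in the unit interval.
Integrating first in [t] gives [F (x + v) - F x], whose integral is 0 by
translation invariance; integrating first in [x] gives the integral of [D]. *)
Lemma integral_derivative_eq0 v F D (r : R) : continuous F -> continuous D ->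
  (forall x, is_derive x v F (D x)) ->
  (forall x, ~ Ball r x -> F x = 0%R) -> (forall x, ~ Ball r x -> D x = 0%R) ->
  \int[mu]_x (D x)%:E = 0.
Proof.
move=> cF cD dF F0 D0.
have iF := continuous_support_integrable cF F0.
have iD := continuous_support_integrable cD D0.
have mF : measurable_fun setT (EFin \o F) by case/integrableP : iF.
have mD : measurable_fun setT (EFin \o D) by case/integrableP : iD.
pose f (p : 'rV[R]_n * measurableTypeR R) :=
  (D (p.1 + p.2 *: v)%R)%:E * (\1_(`[0%R, 1%R]%classic : set R) p.2)%:E.
have mf : measurable_fun setT f.
  apply: emeasurable_funM; first exact: (measurable_line v mD).
  apply/measurable_EFinP; apply: (measurableT_comp _ measurable_snd).
  exact: measurable_indic.
have abs_iD : mu.-integrable setT (abse \o (EFin \o D)) by exact: integrable_abse.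
have mD' : measurable_fun setT (abse \o (EFin \o D)) by case/integrableP : abs_iD.
have fE c : \int[mu1]_t (c * (\1_(`[0%R, 1%R]%classic : set R) t)%:E) = c.
  rewrite (_ : (fun t => _) = (cst c) \_ `[0%R, 1%R]); last by rewrite epatch_indic.
  rewrite -integral_mkcond integral_cst//= lebesgue_measure_itv /= lte_fin ltr01.
  by rewrite oppr0 adde0 mule1.
have if_ : (mu \x mu1).-integrable setT f.
  apply/(integrable21ltyP _ _ mf).
  have E t : \int[mu]_x `|f (x, t)| =
     (\int[mu]_x `|(D x)%:E|) * (\1_(`[0%R, 1%R]%classic : set R) t)%:E.
    under eq_integral do rewrite /f abseM /=.
    rewrite ge0_integralZr//; last first.
      exact: (measurableT_comp (measurable_line v mD') (measurable_pair2 _)).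
    rewrite (ge0_integral_shift (t *: v)%R mD'); last by move=> x /=.
    by rewrite /= ger0_norm// indicE.
  rewrite [ltLHS](_ : _ = \int[mu]_x `|(D x)%:E|); first by case/integrableP : iD.
  by rewrite -[RHS]fE; apply: eq_integral => t _; exact: E.
have H1 : \int[mu]_x \int[mu1]_t f (x, t) = 0.
  have E x : \int[mu1]_t f (x, t) = (F (x + v)%R)%:E - (F x)%:E.
    have := @FTC_line _ _ x v F D 1%R ltr01 (fun t _ => dF _) (fun t _ => cD _).
    by rewrite scale1r => <-; rewrite [RHS]integral_mkcond epatch_indic.
  under eq_integral do rewrite E.
  rewrite (integralB _ (integrable_shift v iF) iF)// (integral_shift v mF) subee//.
  exact: integrable_fin_num.
have H2 : \int[mu1]_t \int[mu]_x f (x, t) = \int[mu]_x (D x)%:E.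
  rewrite -[RHS]fE; apply: eq_integral => t _.
  rewrite /f /= integralZr//; last exact: (integrable_shift _ iD).
  by congr (_ * _); exact: (integral_shift (t *: v)%R mD).
by rewrite -H2 -(Fubini if_).
Qed.

End divergence.

(** * Inequalities in one variable *)

Section one_variable.
Context {R : realType}.
Implicit Types (p q s : R -> R) (d : R).
Notation mu1 := (@lebesgue_measure R).

Lemma segment_integrable q (a b : R) :
  (forall t : R, a <= t <= b -> {for t, continuous q}) ->
  mu1.-integrable `[a, b] (EFin \o q).
Proof.
move=> cq; apply: continuous_compact_integrable; first exact: segment_compact.
by apply: continuous_in_subspaceT => t; rewrite inE /= in_itv /=; exact: cq.
Qed.

Lemma integral_segment_cst (a b c : R) : a <= b ->
  (\int[mu1]_(t in `[a, b]) c%:E = (c * (b - a))%:E)%E.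
Proof.
move=> ab; rewrite (integral_cst mu1 (measurable_itv `[a, b]) c%:E)/=.
rewrite lebesgue_measure_itv /= lte_fin; case: ltP => // ba.
by rewrite (_ : b = a) ?subrr ?mule0 ?mulr0//; apply/eqP; rewrite eq_le ab ba.
Qed.

(** Integrate [0 <= (d * q t - D) ^+ 2 / d], where [D = p d - p 0] is the integral of
[q]. *)
Lemma sqr_increment_le p q d : 0 < d ->
  (forall t : R, 0 <= t <= d -> is_derive t 1 p (q t)) ->
  (forall t : R, 0 <= t <= d -> {for t, continuous q}) ->
  (((p d - p 0) ^+ 2)%:E <= \int[mu1]_(t in `[0%R, d]) (d * q t ^+ 2)%:E)%E.
Proof.
move=> d0 dp cq; pose D := p d - p 0.
have cl (t : R) : 0 <= t <= d -> {for t, continuous (fun t => 2 * D * q t - D ^+ 2 / d)}.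
  move=> td; apply: cvgB; last exact: cvg_cst.
  by apply: cvgM; [exact: cvg_cst|exact: cq].
have dl (t : R) : 0 <= t <= d ->
    is_derive t 1 (fun t => 2 * D * p t - D ^+ 2 / d * t) (2 * D * q t - D ^+ 2 / d).
  move=> td; have -> : 2 * D * q t - D ^+ 2 / d =
      (0 * p t + 2 * D * q t) - (0 * t + D ^+ 2 / d * 1) by ring.
  apply: is_derive_fsub; apply: is_derive_fmul; do ?exact: is_derive_fcst.
  exact: dp.
have E := FTC_segment d0 dl cl.
have -> : (p d - p 0) ^+ 2 = 2 * D * p d - D ^+ 2 / d * d - (2 * D * p 0 - D ^+ 2 / d * 0).
  by rewrite divfK ?gt_eqF// /D; ring.
rewrite EFinB -E.
apply: le_integral => //.
- exact: segment_integrable.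
- apply: (@segment_integrable (fun t => d * q t ^+ 2)) => t td.
  apply: continuousM; first exact: cst_continuous.
  by apply: continuousM; exact: cq.
move=> t _ /=; rewrite lee_fin -subr_ge0.
have -> : d * q t ^+ 2 - (2 * D * q t - D ^+ 2 / d) = (d * q t - D) ^+ 2 / d.
  by field; rewrite gt_eqF.
by rewrite divr_ge0 ?sqr_ge0// ltW.
Qed.

Lemma exists_sqr_le_mean p (a b : R) : a < b ->
  (forall t : R, a <= t <= b -> {for t, continuous p}) ->
  exists2 t : R, a <= t <= b &
    ((p t ^+ 2 * (b - a))%:E <= \int[mu1]_(t in `[a, b]) (p t ^+ 2)%:E)%E.
Proof.
move=> ab cp.
have cp2 (t : R) : a <= t <= b -> {for t, continuous (fun t => p t ^+ 2)}.
  by move=> tab; apply: continuousM; exact: cp.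
have [|c cab cmin] := @EVT_min _ (fun t => p t ^+ 2) a b (ltW ab).
  by apply: continuous_in_subspaceT => t; rewrite inE /= in_itv /=; exact: cp2.
exists c; first by move: cab; rewrite in_itv.
rewrite -(integral_segment_cst _ (ltW ab)); apply: le_integral => //.
- by apply: segment_integrable => t _; exact: cst_continuous.
- exact: segment_integrable.
- by move=> t /set_mem tab; rewrite lee_fin; exact: cmin.
Qed.

(** In each of the outer thirds of [0, d] some point has [p ^+ 2] at most its mean
value there. The mean value theorem between these two points, at distance at
least [d / 3], gives [c] with [q c ^+ 2] at most [108 / d ^+ 3] times the
integral of [p ^+ 2], and [q 0 ^+ 2 - q c ^+ 2] is the integral of
[- 2 q s] over [0, c]. *)
Lemma sqr_derivative_le p q s d : 0 < d ->
  (forall t : R, 0 <= t <= d -> is_derive t 1 p (q t)) ->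
  (forall t : R, 0 <= t <= d -> is_derive t 1 q (s t)) ->
  (forall t : R, 0 <= t <= d -> {for t, continuous s}) ->
  ((q 0 ^+ 2)%:E <= \int[mu1]_(t in `[0%R, d])
     (108 / d ^+ 3 * p t ^+ 2 + 2 * `|q t * s t|)%:E)%E.
Proof.
move=> d0 dp dq cs.
have cq (t : R) : 0 <= t <= d -> {for t, continuous q}.
  by move=> /dq [+ _]; move=> /derivable1_diffP; exact: differentiable_continuous.
have cp (t : R) : 0 <= t <= d -> {for t, continuous p}.
  by move=> /dp [+ _]; move=> /derivable1_diffP; exact: differentiable_continuous.
have cp2 (t : R) : 0 <= t <= d -> {for t, continuous (fun t => p t ^+ 2)}.
  by move=> td; apply: continuousM; exact: cp.
have cqs (t : R) : 0 <= t <= d -> {for t, continuous (fun t => q t * s t)}.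
  by move=> td; apply: continuousM; [exact: cq|exact: cs].
have cQ (t : R) : 0 <= t <= d -> {for t, continuous (fun t => 2 * (q t * s t))}.
  by move=> td; apply: continuousM; [exact: cst_continuous|exact: cqs].
have c2 (t : R) : 0 <= t <= d -> {for t, continuous (fun t => 2 * `|q t * s t|)}.
  move=> td; apply: continuousM; first exact: cst_continuous.
  apply: (@continuous_comp _ _ _ (fun t => q t * s t) Num.norm); first exact: cqs.
  exact: norm_continuous.
pose I := (\int[mu1]_(t in `[0%R, d]) (p t ^+ 2)%:E)%E.
have I0 : (0 <= I)%E by apply: integral_ge0 => t _; rewrite lee_fin sqr_ge0.
have Ifin : I \is a fin_num.
  by apply: integrable_fin_num => //; exact: segment_integrable.
have sub (a b t : R) : 0 <= a -> b <= d -> a <= t <= b -> 0 <= t <= d.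
  by move=> a0 bd /andP[at_ tb]; rewrite (le_trans a0 at_) (le_trans tb bd).
have small (a b : R) : 0 <= a -> a < b -> b <= d ->
    exists2 t : R, a <= t <= b & p t ^+ 2 * (b - a) <= fine I.
  move=> a0 ab bd.
  have [t tab ple] := exists_sqr_le_mean ab (fun t tab => cp t (sub _ _ _ a0 bd tab)).
  exists t => //; rewrite -lee_fin fineK//; apply: (le_trans ple).
  apply: ge0_subset_integral => //.
  - apply/measurable_EFinP; apply: subspace_continuous_measurable_fun => //.
    by apply: continuous_in_subspaceT => y; rewrite inE /= in_itv; exact: cp2.
  - by move=> y _; rewrite lee_fin sqr_ge0.
  - by move=> y /=; rewrite !in_itv /=; exact: sub.
have [t1 t1I p1] := small 0 (d / 3) (lexx _) ltac:(lra) ltac:(lra).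
have [t2 t2I p2] := small (2 * d / 3) d ltac:(lra) ltac:(lra) (lexx _).
have t12 : t1 < t2 by lra.
have sub12 (t : R) : t1 <= t <= t2 -> 0 <= t <= d by move=> ?; apply/andP; lra.
have [c cI pc] := @MVT _ p q t1 t2 t12 (fun t tI => dp t ltac:(move: tI; rewrite in_itv /= => ?; apply/andP; lra))
  ltac:(by apply: continuous_in_subspaceT => y; rewrite inE /= in_itv /= => /sub12; exact: cp).
have qc : q c ^+ 2 <= 108 / d ^+ 3 * fine I.
  rewrite mulrAC ler_pdivlMr ?exprn_gt0//.
  have H : (q c * (t2 - t1)) ^+ 2 <= 2 * (p t1 ^+ 2 + p t2 ^+ 2).
    by rewrite -pc -subr_ge0 (_ : _ - _ = (p t1 + p t2) ^+ 2) ?sqr_ge0//; ring.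
  have H2 : (d / 3) ^+ 2 <= (t2 - t1) ^+ 2.
    by rewrite ler_pXn2r ?nnegrE //; lra.
  have H3 : q c ^+ 2 * (d / 3) ^+ 2 <= 2 * (p t1 ^+ 2 + p t2 ^+ 2).
    by apply: (le_trans _ H); rewrite [leRHS]exprMn ler_wpM2l ?sqr_ge0.
  have H4 : q c ^+ 2 * (d / 3) ^+ 2 * (d / 3) <= 2 * (p t1 ^+ 2 + p t2 ^+ 2) * (d / 3).
    by rewrite ler_wpM2r//; lra.
  have E3 : q c ^+ 2 * d ^+ 3 = 27 * (q c ^+ 2 * (d / 3) ^+ 2 * (d / 3)) by field.
  rewrite E3; move: H4 p1 p2; move: (q c ^+ 2 * _ * _) (p t1 ^+ 2) (p t2 ^+ 2) (fine I) => ? ? ? ?.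
  nra.
have c0 : 0 < c by move: cI; rewrite in_itv /=; lra.
have cd : c <= d by move: cI; rewrite in_itv /=; lra.
have step : ((q 0 ^+ 2 - q c ^+ 2)%:E <=
    \int[mu1]_(t in `[0%R, d]) (2 * `|q t * s t|)%:E)%E.
  apply: (@le_trans _ _ (\int[mu1]_(t in `[0%R, c]) (2 * `|q t * s t|)%:E)%E).
    have dqq (t : R) : 0 <= t <= c ->
        is_derive t 1 (fun t => - (q t * q t)) (- (s t * q t + q t * s t)).
      move=> tI; apply: is_derive_fopp.
      have td : 0 <= t <= d by apply: (sub _ _ _ (lexx _) cd).
      by apply: is_derive_fmul; exact: dq.
    have csq (t : R) : 0 <= t <= c ->
        {for t, continuous (fun t => - (s t * q t + q t * s t))}.
      move=> tI; have td : 0 <= t <= d by apply: (sub _ _ _ (lexx _) cd).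
      apply: cvgN; apply: cvgD; last exact: cqs.
      by apply: cvgM; [exact: cs|exact: cq].
    have E := FTC_segment c0 dqq csq.
    rewrite (_ : _ - _ = - (q c * q c) - - (q 0 * q 0)); last by ring.
    rewrite EFinB -E.
    apply: le_integral => //.
    - exact: segment_integrable.
    - apply: segment_integrable => t tI; apply: c2; exact: (sub _ _ _ (lexx _) cd).
    - move=> t _; rewrite lee_fin [s t * _]mulrC.
      have := ler_norm (- (q t * s t)); rewrite normrN; move: (q t * s t) => z; lra.
  apply: ge0_subset_integral => //.
  - apply/measurable_EFinP; apply: subspace_continuous_measurable_fun => //.
    by apply: continuous_in_subspaceT => y; rewrite inE /= in_itv; exact: c2.
  - by move=> y /=; rewrite !in_itv /=; exact: sub.
rewrite (_ : (\int[mu1]_(t in _) _)%E =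
   ((108 / d ^+ 3)%:E * I + \int[mu1]_(t in `[0%R, d]) (2 * `|q t * s t|)%:E)%E); last first.
  under eq_integral do rewrite EFinD.
  rewrite integralD//; last 2 first.
  - apply: (@segment_integrable (fun t => 108 / d ^+ 3 * p t ^+ 2)) => t td.
    by apply: continuousM; [exact: cst_continuous|exact: cp2].
  - exact: segment_integrable.
  congr (_ + _)%E; under eq_integral do rewrite EFinM.
  by rewrite integralZl//; exact: segment_integrable.
rewrite (_ : q 0 ^+ 2 = q c ^+ 2 + (q 0 ^+ 2 - q c ^+ 2)); last by ring.
by rewrite EFinD; apply: leeD => //; rewrite -(fineK Ifin) -EFinM lee_fin.
Qed.

End one_variable.

(** * Partial derivatives and increments along an axis *)

Section interpolation.
Context {R : realType} {n : nat}.
Local Open Scope ereal_scope.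
Implicit Types (x z : 'rV[R]_n) (i : 'I_n) (r d h : R).
Notation mu := (lebesgue_rV n).
Notation mu1 := (@lebesgue_measure R).

Lemma axis_in_Ball r d x i (t : R) : Ball r x -> (0 <= t <= d)%R ->
  Ball (r + d) (x + t *: ei i)%R.
Proof.
move=> xr /andP[t0 td]; rewrite /Ball /=.
rewrite (le_lt_trans (enorm_axis_le _ _ _))// ger0_norm//.
by rewrite ltr_leD.
Qed.

(** [sqr_derivative_le] on the segments from [x] to [x + d *: ei i]. *)
Lemma integral_sqr_partial_le (w w1 w2 : 'rV[R]_n -> R) i r d :
  (0 < d)%R -> (r + d <= 1)%R ->
  {in Ball 1, continuous w} -> {in Ball 1, continuous w1} ->
  {in Ball 1, continuous w2} ->
  (forall x, Ball 1 x -> is_derive x (ei i) w (w1 x)) ->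
  (forall x, Ball 1 x -> is_derive x (ei i) w1 (w2 x)) ->
  \int[mu]_(x in Ball r) (w1 x ^+ 2)%:E <= d%:E *
    \int[mu]_(x in Ball (r + d)) (108 / d ^+ 3 * w x ^+ 2 + 2 * `|w1 x * w2 x|)%:E.
Proof.
move=> d0 rd cw cw1 cw2 dw dw1.
have sub x : Ball (r + d) x -> @Ball R n 1 x by exact: Ball_sub.
apply: (ge0_integral_le_line (v := ei i)); [exact: measurable_Ball
  |exact: measurable_Ball| | | | |exact: ltW| |].
- apply: EFin_measurable_Ball => x /set_mem xr; apply: continuousM; apply: cw1;
    by rewrite inE; apply: sub; apply: Ball_sub xr; rewrite lerDl ltW.
- apply: EFin_measurable_Ball => x /set_mem /sub /mem_set x1.
  apply: ctsD.
    by apply: ctsM; [exact: cts_cst|apply/cts_sqr/cw].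
  apply: ctsM; first exact: cts_cst.
  by apply: cts_norm; apply: ctsM; [exact: cw1|exact: cw2].
- by move=> x _; rewrite lee_fin sqr_ge0.
- move=> x; rewrite lee_fin addr_ge0// mulr_ge0 ?sqr_ge0//.
  by rewrite mulr_ge0// invr_ge0 exprn_ge0// ltW.
- by move=> x t xr td; exact: axis_in_Ball.
move=> x xr.
have ball1 (t : R) : (0 <= t <= d)%R -> Ball 1 (x + t *: ei i)%R.
  by move=> td; apply: sub; exact: axis_in_Ball.
have := @sqr_derivative_le R (fun t => w (x + t *: ei i))%R
  (fun t => w1 (x + t *: ei i))%R (fun t => w2 (x + t *: ei i))%R d d0.
rewrite scale0r addr0; apply => t td.
- exact/is_derive_line/dw/ball1.
- exact/is_derive_line/dw1/ball1.
- apply: (@continuous_comp _ _ _ (fun t : R => x + t *: ei i)%R w2).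
    exact: line_continuous.
  by apply: cw2; rewrite inE; exact: ball1.
Qed.

(** [sqr_increment_le] on the segments from [x] to [x + t *: ei i]. *)
Lemma integral_sqr_axis_increment_le (w w1 : 'rV[R]_n -> R) i r (t : R) :
  (0 <= t)%R -> (r + t <= 1)%R ->
  {in Ball 1, continuous w} -> {in Ball 1, continuous w1} ->
  (forall x, Ball 1 x -> is_derive x (ei i) w (w1 x)) ->
  \int[mu]_(x in Ball r) ((w (x + t *: ei i) - w x) ^+ 2)%R%:E <=
    (t ^+ 2)%:E * \int[mu]_(x in Ball (r + t)) (w1 x ^+ 2)%:E.
Proof.
move=> t0 rt cw cw1 dw.
have sub x : Ball (r + t) x -> @Ball R n 1 x by exact: Ball_sub.
have cw1' : {in Ball (r + t), continuous (fun x => w1 x ^+ 2)%R}.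
  by move=> x /set_mem /sub /mem_set x1; apply/cts_sqr/cw1.
have [->|tn0] := eqVneq t 0%R.
  rewrite expr0n mul0e le_eqVlt; apply/orP; left; apply/eqP.
  by apply: integral0_eq => x _; rewrite scale0r addr0 subrr expr0n.
have {}t0 : (0 < t)%R by rewrite lt_neqAle eq_sym tn0.
rewrite expr2 EFinM -muleA -ge0_integralZl//; last 4 first.
- exact: measurable_Ball.
- exact: EFin_measurable_Ball.
- by move=> x _; rewrite lee_fin sqr_ge0.
- by rewrite lee_fin ltW.
have sub0 x : Ball r x -> Ball 1 x.
  by move=> /(Ball_sub (s := r + t)%R) H; apply: sub; apply: H; rewrite lerDl ltW.
apply: (ge0_integral_le_line (v := ei i)); [exact: measurable_Ball
  |exact: measurable_Ball| | | | |exact: ltW| |].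
- apply: EFin_measurable_Ball => x /set_mem xr.
  have c1 : {for x, continuous (fun x => w (x + t *: ei i) - w x)%R}.
    apply: ctsB; last by apply: cw; rewrite inE; exact: sub0.
    apply: (@continuous_comp _ _ _ (fun x => x + t *: ei i)%R w).
      exact: translate_continuous.
    by apply: cw; rewrite inE; apply: sub; apply: axis_in_Ball => //; rewrite ltW//=.
  exact: cts_sqr.
- apply: EFin_measurable_Ball => x xr; apply: ctsM; first exact: cts_cst.
  exact: cw1'.
- by move=> x _; rewrite lee_fin sqr_ge0.
- by move=> x; rewrite -EFinM lee_fin mulr_ge0 ?sqr_ge0// ltW.
- by move=> x s xr st; exact: axis_in_Ball.
move=> x xr.
have ball1 (s : R) : (0 <= s <= t)%R -> Ball 1 (x + s *: ei i)%R.
  by move=> st; apply: sub; exact: axis_in_Ball.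
have := @sqr_increment_le R (fun t => w (x + t *: ei i))%R
  (fun t => w1 (x + t *: ei i))%R t t0.
rewrite scale0r addr0; apply => s st.
- exact/is_derive_line/dw/ball1.
- apply: (@continuous_comp _ _ _ (fun t : R => x + t *: ei i)%R w1).
    exact: line_continuous.
  by apply: cw1; rewrite inE; exact: ball1.
Qed.

End interpolation.

(** * A local Nash inequality *)

Lemma sqr_sum_le {R : realFieldType} (n : nat) (a : 'I_n -> R) :
  (\sum_i a i) ^+ 2 <= n%:R * \sum_i a i ^+ 2.
Proof.
case: n a => [|n] a; first by rewrite !big_ord0 expr0n mul0r.
set S := \sum_i a i.
have n0 : n.+1%:R != 0 :> R by rewrite pnatr_eq0.
have : 0 <= n.+1%:R * \sum_i (a i - S / n.+1%:R) ^+ 2.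
  by rewrite mulr_ge0// sumr_ge0// => i _; rewrite sqr_ge0.
rewrite (eq_bigr (fun i => a i ^+ 2 + (- (2 * (S / n.+1%:R)) * a i + (S / n.+1%:R) ^+ 2))); last first.
  by move=> i _; ring.
rewrite !big_split/= -mulr_sumr -/S sumr_const card_ord -(mulr_natl ((S / _) ^+ 2)).
move: n0; move: (n.+1%:R) (\sum_i a i ^+ 2) => N Q N0.
have -> : N * (Q + (- (2 * (S / N)) * S + N * (S / N) ^+ 2)) = N * Q - S ^+ 2.
  by field.
by rewrite subr_ge0.
Qed.

Section tonelli_domains.
Local Open Scope ereal_scope.
Context d1 d2 (T1 : measurableType d1) (T2 : measurableType d2) (R : realType).
Variable m1 : {sigma_finite_measure set T1 -> \bar R}.
Variable m2 : {sigma_finite_measure set T2 -> \bar R}.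

(** Domains of integration are turned into indicator functions, so that the Tonelli
theorem for the whole spaces applies; similarly for the next two lemmas. *)
Lemma measurable_integral_domain1 (f : T1 * T2 -> \bar R) (B : set T2) :
  measurable B -> measurable_fun setT f -> (forall p, 0 <= f p) ->
  measurable_fun setT (fun x => \int[m2]_(y in B) f (x, y)).
Proof.
move=> mB mf f0; pose g (p : T1 * T2) := f p * (\1_B p.2)%:E.
have mg : measurable_fun setT g.
  apply: emeasurable_funM => //; apply/measurable_EFinP.
  by apply: (measurableT_comp _ measurable_snd); exact: measurable_indic.
have g0 p : 0 <= g p by rewrite mule_ge0.
under eq_fun do rewrite integral_mkcond epatch_indic.
exact: (measurable_fun_fubini_tonelli_F g mg g0).
Qed.

Lemma measurable_integral_domain2 (f : T1 * T2 -> \bar R) (A : set T1) :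
  measurable A -> measurable_fun setT f -> (forall p, 0 <= f p) ->
  measurable_fun setT (fun y => \int[m1]_(x in A) f (x, y)).
Proof.
move=> mA mf f0; pose g (p : T1 * T2) := f p * (\1_A p.1)%:E.
have mg : measurable_fun setT g.
  apply: emeasurable_funM => //; apply/measurable_EFinP.
  by apply: (measurableT_comp _ measurable_fst); exact: measurable_indic.
have g0 p : 0 <= g p by rewrite mule_ge0.
under eq_fun do rewrite integral_mkcond epatch_indic.
exact: (measurable_fun_fubini_tonelli_G g mg g0).
Qed.

Lemma tonelli_domains (f : T1 * T2 -> \bar R) (A : set T1) (B : set T2) :
  measurable A -> measurable B -> measurable_fun setT f -> (forall p, 0 <= f p) ->
  \int[m1]_(x in A) \int[m2]_(y in B) f (x, y) =
  \int[m2]_(y in B) \int[m1]_(x in A) f (x, y).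
Proof.
move=> mA mB mf f0.
pose g p := f p * ((\1_A p.1)%:E * (\1_B p.2)%:E).
have mg : measurable_fun setT g.
  apply: emeasurable_funM => //; apply: emeasurable_funM; apply/measurable_EFinP.
    by apply: (measurableT_comp _ measurable_fst); exact: measurable_indic.
  by apply: (measurableT_comp _ measurable_snd); exact: measurable_indic.
have mx x : measurable_fun setT (fun y => f (x, y)).
  exact: (measurableT_comp mf (measurable_pair1 x)).
have my y : measurable_fun setT (fun x => f (x, y)).
  exact: (measurableT_comp mf (measurable_pair2 y)).
have g0 p : 0 <= g p by rewrite !mule_ge0.
transitivity (\int[m1]_x \int[m2]_y g (x, y)).
  rewrite integral_mkcond epatch_indic; apply: eq_integral => x _ /=.
  rewrite integral_mkcond epatch_indic -ge0_integralZr//.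
  - by apply: eq_integral => y _; rewrite /g /= -muleA [X in _ * X]muleC.
  - apply: emeasurable_funM; last exact/measurable_EFinP/measurable_indic.
    exact: mx.
  - by move=> y _ /=; rewrite mule_ge0.
rewrite (fubini_tonelli _ mg g0) [RHS]integral_mkcond epatch_indic.
apply: eq_integral => y _ /=.
rewrite [in RHS]integral_mkcond epatch_indic -ge0_integralZr//.
- by apply: eq_integral => x _; rewrite /g /= -muleA.
- apply: emeasurable_funM; last exact/measurable_EFinP/measurable_indic.
  exact: my.
- by move=> x _ /=; rewrite mule_ge0.
Qed.

End tonelli_domains.

Section local_nash.
Context {R : realType} {n : nat}.
Local Open Scope ereal_scope.
Implicit Types (x z : 'rV[R]_n) (i : 'I_n) (r d h : R).
Notation mu := (lebesgue_rV n).
Variables (w : 'rV[R]_n -> R) (wd : 'I_n -> 'rV[R]_n -> R).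
Hypothesis cw : {in Ball 1, continuous w}.
Hypothesis cwd : forall i, {in Ball 1, continuous (wd i)}.
Hypothesis dw : forall i x, Ball 1 x -> is_derive x (ei i) w (wd i x).

(** The translation by [z] is decomposed into translations along the axes, through
the points [x + head_coords k z]. *)
Definition head_coords (k : nat) z : 'rV[R]_n :=
  \row_i (if (i < k)%N then z ord0 i else 0%R).

Lemma head_coords0 z : head_coords 0 z = 0%R.
Proof. by apply/rowP => i; rewrite !mxE. Qed.

Lemma head_coords_full z : head_coords n z = z.
Proof. by apply/rowP => i; rewrite !mxE ltn_ord. Qed.

Lemma head_coordsS z i :
  head_coords i.+1 z = (head_coords i z + z ord0 i *: ei i)%R.
Proof.
apply/rowP => j; rewrite !mxE eqxx ltnS leq_eqVlt /=.
have [<-|ij] := eqVneq j i; first by rewrite eqxx ltnn mulr1 add0r.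
by rewrite (negbTE (_ : nat_of_ord j != i)) //= mulr0 addr0.
Qed.

Lemma head_coords_in_Ball r h x z (k : nat) : (k <= n)%N ->
  (forall i, 0 <= z ord0 i <= h)%R -> Ball r x ->
  Ball (r + k%:R * h) (x + head_coords k z)%R.
Proof.
move=> + zh xr; elim: k => [_|k IH kn].
  by rewrite head_coords0 mul0r !addr0.
rewrite (head_coordsS z (Ordinal kn)) addrA -natr1 mulrDl mul1r addrA.
by apply: axis_in_Ball => //; exact: IH (ltnW kn).
Qed.

(** The increment is a sum of [n] increments along the axes, each of length at most
[h], and the intermediate points leave the ball of radius [r] by at most
[n%:R * h]. *)
Lemma integral_sqr_increment_le z h r : (forall i, 0 <= z ord0 i <= h)%R ->
  (r + n%:R * h <= 1)%R ->
  \int[mu]_(x in Ball r) ((w (x + z) - w x) ^+ 2)%R%:E <=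
  (n%:R * h ^+ 2)%:E *
    \sum_(i < n) \int[mu]_(x in Ball (r + n%:R * h)) (wd i x ^+ 2)%:E.
Proof.
move=> zh rh.
pose D i x := (w (x + head_coords i.+1 z) - w (x + head_coords i z))%R.
have h0 i : (0 <= h)%R by have /andP[+ ?] := zh i; move=> /le_trans; apply.
have sub k x : (k <= n)%N -> Ball r x -> Ball 1 (x + head_coords k z)%R.
  move=> kn xr; apply: (@Ball_sub _ _ (r + k%:R * h)%R); last exact: head_coords_in_Ball.
  apply: le_trans rh; rewrite lerD2l.
  case: (posnP n) => [n0|n0]; last by rewrite ler_wpM2r ?(h0 (Ordinal n0))// ler_nat.
  by move: kn; rewrite n0 leqn0 => /eqP ->.
have cD k : (k <= n)%N -> {in Ball r, continuous (fun x => w (x + head_coords k z)%R)}.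
  move=> kn x /set_mem xr.
  apply: (@continuous_comp _ _ _ (fun x => x + head_coords k z)%R w).
    exact: translate_continuous.
  by apply: cw; rewrite inE; exact: sub.
have mD i : measurable_fun (Ball r) (fun x => (D i x ^+ 2)%:E).
  apply: EFin_measurable_Ball => x xr; apply/cts_sqr/ctsB; apply: cD xr => //.
  exact: ltnW.
have DE x : (w (x + z) - w x)%R = (\sum_(i < n) D i x)%R.
  rewrite /D -(big_mkord xpredT (fun k => w (x + head_coords k.+1 z) - w (x + head_coords k z)))%R.
  by rewrite telescope_sumr// head_coords_full head_coords0 addr0.
apply: (@le_trans _ _ (\int[mu]_(x in Ball r) (n%:R%:E * \sum_(i < n) (D i x ^+ 2)%:E))).
  apply: ge0_le_integral => //.
  - exact: measurable_Ball.
  - by move=> x _; rewrite lee_fin sqr_ge0.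
  - apply: EFin_measurable_Ball => x xr; apply/cts_sqr/ctsB.
      by have := cD n (leqnn n) x xr; rewrite head_coords_full.
    by have := cD 0%N isT x xr; under eq_fun do rewrite head_coords0 addr0.
  - by apply: measurable_funeM; exact: emeasurable_sum.
  - by move=> x xr; rewrite sumEFin -EFinM lee_fin DE sqr_sum_le.
rewrite ge0_integralZl//; last 3 first.
- exact: measurable_Ball.
- exact: emeasurable_sum.
- by move=> x _; rewrite sume_ge0// => i _; rewrite lee_fin sqr_ge0.
rewrite EFinM -muleA lee_wpmul2l ?lee_fin//.
rewrite ge0_integral_sum//; last 2 first.
- exact: measurable_Ball.
- by move=> i x _; rewrite lee_fin sqr_ge0.
rewrite ge0_sume_distrr; last by move=> i _; apply: integral_ge0 => x _; rewrite lee_fin sqr_ge0.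
apply: lee_sum => i _.
have /andP[zi0 zih] := zh i.
have rk : (r + i%:R * h + z ord0 i <= r + n%:R * h)%R.
  rewrite -addrA lerD2l (le_trans (_ : _ <= i%:R * h + h)%R) ?lerD2l//.
  by rewrite -{2}(mul1r h) -mulrDl natr1 ler_wpM2r ?(h0 i)// ler_nat.
apply: (@le_trans _ _ (\int[mu]_(x in Ball (r + i%:R * h)%R)
    ((w (x + z ord0 i *: ei i) - w x) ^+ 2)%R%:E)).
  rewrite /D; under eq_integral do rewrite head_coordsS addrA.
  apply: (ge0_integral_shift_le (z := head_coords i z)
     (f := fun x => ((w (x + z ord0 i *: ei i) - w x) ^+ 2)%R%:E)).
  - exact: measurable_Ball.
  - exact: measurable_Ball.
  - apply: EFin_measurable_Ball => x /set_mem xr; apply/cts_sqr/ctsB.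
      apply: (@continuous_comp _ _ _ (fun x => x + z ord0 i *: ei i)%R w).
        exact: translate_continuous.
      apply: cw; rewrite inE; apply: (Ball_sub (le_trans rk rh)).
      by apply: axis_in_Ball => //; rewrite zi0 lexx.
    apply: cw; rewrite inE; apply: Ball_sub xr.
    by rewrite (le_trans _ (le_trans rk rh))// lerDl.
  - by move=> x; rewrite lee_fin sqr_ge0.
  - by move=> x xr; apply: head_coords_in_Ball => //; exact: ltnW.
have H := integral_sqr_axis_increment_le zi0 (le_trans rk rh) cw (@cwd i) (@dw i).
apply: (le_trans H).
apply: lee_pmul.
- by rewrite lee_fin sqr_ge0.
- by apply: integral_ge0 => x _; rewrite lee_fin sqr_ge0.
- by rewrite lee_fin ler_pXn2r ?nnegrE// (h0 i).
apply: ge0_subset_integral; [exact: measurable_Ball|exact: measurable_Ball| | |exact: Ball_sub].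
- apply: EFin_measurable_Ball => x /set_mem xr; apply/cts_sqr/cwd.
  by rewrite inE; exact: Ball_sub xr.
- by move=> x _; rewrite lee_fin sqr_ge0.
Qed.

(** For every [z],
[w x ^+ 2 <= 2 * `|w x * w (x + z)| + (w (x + z) - w x) ^+ 2]. Integrate over [x]
in the ball and [z] in the cube of side [h]: the first term factors into two L^1
norms, and [integral_sqr_increment_le] bounds the second. *)
Lemma integral_sqr_le_mean h r : (0 < h)%R -> (r + n%:R * h <= 1)%R ->
  (h ^+ n)%:E * \int[mu]_(x in Ball r) (w x ^+ 2)%:E <=
  2%:E * ((\int[mu]_(x in Ball 1) `|w x|%:E) * (\int[mu]_(x in Ball 1) `|w x|%:E)) +
  (n%:R * h ^+ 2 * h ^+ n)%:E *
    \sum_(i < n) \int[mu]_(x in Ball (r + n%:R * h)) (wd i x ^+ 2)%:E.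
Proof.
move=> h0 rh.
set L := \int[mu]_(x in Ball 1) `|w x|%:E.
set S := \sum_(i < n) _.
have L0 : 0 <= L by apply: integral_ge0 => x _; rewrite lee_fin.
have S0 : 0 <= S.
  by apply: sume_ge0 => i _; apply: integral_ge0 => x _; rewrite lee_fin sqr_ge0.
pose B := [set z : 'rV[R]_n | forall i,
  ((0 : 'rV[R]_n) ord0 i <= z ord0 i <= (const_mx h : 'rV[R]_n) ord0 i)%R].
have mB : measurable B by exact: measurable_box.
have BE z : B z -> forall i, (0 <= z ord0 i <= h)%R.
  by move=> Bz i; have := Bz i; rewrite !mxE.
have muB : mu B = (h ^+ n)%:E.
  rewrite lebesgue_rV_box; last by move=> i; rewrite !mxE ltW.
  congr (_%:E); rewrite (eq_bigr (fun=> h)); last by move=> i _; rewrite !mxE subr0.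
  by rewrite prodr_const card_ord.
have sub x z : B z -> Ball r x -> Ball 1 (x + z)%R.
  move=> /BE Bz xr; have := head_coords_in_Ball (leqnn n) Bz xr.
  by rewrite head_coords_full; exact: Ball_sub.
have sub0 x : Ball r x -> Ball 1 x.
  by apply: Ball_sub; rewrite (le_trans _ rh)// lerDl mulr_ge0// ltW.
pose W := w \_ (@Ball R n 1).
have mW : measurable_fun setT (W : _ -> measurableTypeR R).
  apply/(measurable_restrictT _ _).1; first exact: measurable_Ball.
  by apply: open_continuous_measurable_rV; first exact: open_Ball.
have WE x : Ball 1 x -> W x = w x by move=> x1; rewrite /W patchE mem_set.
have mWadd : measurable_fun setT
    (fun p : 'rV[R]_n * 'rV[R]_n => W (p.1 + p.2)%R : measurableTypeR R).
  apply: (measurableT_comp mW).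
  by apply: measurable_add_rV; [exact: measurable_fst|exact: measurable_snd].
pose f (p : 'rV[R]_n * 'rV[R]_n) := ((W (p.1 + p.2)%R - W p.1) ^+ 2)%R%:E.
have mf : measurable_fun setT f.
  apply/measurable_EFinP; apply: (measurable_funX 2%N); apply: measurable_funB => //.
  exact: (measurableT_comp mW measurable_fst).
have f0 p : 0 <= f p by rewrite lee_fin sqr_ge0.
have mfx x : measurable_fun setT (fun z => f (x, z)).
  exact: (measurableT_comp mf (measurable_pair1 x)).
have mabs : measurable_fun (Ball r) (fun x => `|w x|%:E).
  apply: EFin_measurable_Ball => x /set_mem /sub0 x1; apply: cts_norm.
  by apply: cw; rewrite inE.
have mw2 : measurable_fun (Ball r) (fun x => (w x ^+ 2)%:E).
  apply: EFin_measurable_Ball => x /set_mem /sub0 x1; apply: cts_sqr.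
  by apply: cw; rewrite inE.
have mK : measurable_fun (Ball r) (fun x => \int[mu]_(z in B) f (x, z)).
  by apply: measurable_funTS; exact: measurable_integral_domain1.
apply: (@le_trans _ _ (\int[mu]_(x in Ball r)
    (2%:E * L * `|w x|%:E + \int[mu]_(z in B) f (x, z)))).
  rewrite -ge0_integralZl//; last 3 first.
  - exact: measurable_Ball.
  - by move=> x _; rewrite lee_fin sqr_ge0.
  - by rewrite lee_fin exprn_ge0// ltW.
  apply: ge0_le_integral.
  - exact: measurable_Ball.
  - by move=> x _; rewrite -EFinM lee_fin mulr_ge0 ?sqr_ge0// exprn_ge0// ltW.
  - exact: measurable_funeM.
  - by apply: emeasurable_funD => //; exact: measurable_funeM.
  move=> x xr; rewrite -muB muleC -(integral_cst mu mB) /=.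
  apply: (@le_trans _ _ (\int[mu]_(z in B) ((2 * `|w x|)%:E * `|W (x + z)%R|%:E + f (x, z)))).
    apply: ge0_le_integral => //.
    - by move=> z _; rewrite lee_fin sqr_ge0.
    - apply: measurable_funTS; apply: emeasurable_funD => //; apply: measurable_funeM.
      apply/measurable_EFinP; apply: (measurableT_comp (@normr_measurable _ setT)).
      exact: (measurableT_comp mWadd (measurable_pair1 x)).
    move=> z Bz; rewrite /f /= -EFinM -EFinD lee_fin (WE x); last exact: sub0.
    rewrite (WE (x + z)%R); last exact: sub.
    have := ler_norm (w x * w (x + z)%R); rewrite normrM.
    move: (w x) (w (x + z)%R) => a b H; rewrite -subr_ge0.
    rewrite (_ : _ - _ = 2 * (`|a| * `|b| - a * b) + b ^+ 2)%R; last by ring.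
    by apply: addr_ge0; [rewrite mulr_ge0 ?subr_ge0|exact: sqr_ge0].
  have mWx : measurable_fun B (fun z => `|W (x + z)%R|%:E).
    apply: measurable_funTS.
    apply/measurable_EFinP; apply: (measurableT_comp (@normr_measurable _ setT)).
    exact: (measurableT_comp mWadd (measurable_pair1 x)).
  rewrite ge0_integralD//; last 2 first.
  - exact: measurable_funeM.
  - exact: measurable_funTS.
  rewrite leeD2r// ge0_integralZl//.
  have HL : \int[mu]_(z in B) `|W (x + z)%R|%:E <= L.
    rewrite (eq_integral (fun z => `|w (z + x)%R|%:E)); last first.
      by move=> z /set_mem Bz; rewrite (addrC z x) WE//; exact: sub.
    apply: (ge0_integral_shift_le (f := fun x => `|w x|%:E)) => //.
    - exact: measurable_Ball.
    - by apply: EFin_measurable_Ball => y y1; apply: cts_norm; exact: cw.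
    - by move=> z Bz; rewrite addrC; exact: sub.
  by rewrite EFinM -!muleA lee_wpmul2l// muleC lee_wpmul2r// lee_fin.
rewrite ge0_integralD//; last 4 first.
- exact: measurable_Ball.
- by move=> x _; rewrite !mule_ge0.
- exact: measurable_funeM.
- by move=> x _; exact: integral_ge0.
apply: leeD.
  rewrite ge0_integralZl//; last 2 first.
  - exact: measurable_Ball.
  - by rewrite mule_ge0.
  rewrite -muleA lee_wpmul2l// lee_wpmul2l//.
  apply: ge0_subset_integral => //; [exact: measurable_Ball|exact: measurable_Ball|].
  by apply: EFin_measurable_Ball => x x1; apply: cts_norm; exact: cw.
rewrite (tonelli_domains _ _ (measurable_Ball r) mB mf f0).
rewrite mulrC EFinM -muleA -muB muleC -(integral_cst mu mB) /=.
apply: ge0_le_integral => //.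
- by move=> z _; exact: integral_ge0.
- apply: measurable_funTS; apply: measurable_integral_domain2 => //.
  exact: measurable_Ball.
move=> z Bz; apply: le_trans (integral_sqr_increment_le (BE _ Bz) rh).
rewrite le_eqVlt; apply/orP; left; apply/eqP; apply: eq_integral => x /set_mem xr.
rewrite /f /= (WE x); last exact: sub0.
by rewrite WE//; exact: sub.
Qed.

End local_nash.

(** * Linear algebra of the Hessian *)

Section arrays.
Context {R : realFieldType} {n : nat}.
Implicit Types (x y z : 'I_n -> R) (a h : 'I_n -> 'I_n -> R).

Definition l1 x := \sum_i `|x i|.
Definition l1mx h := \sum_i \sum_j `|h i j|.
Definition bform a x y := \sum_i \sum_j a i j * x i * y j.

Lemma l1_ge0 x : 0 <= l1 x.
Proof. by apply: sumr_ge0. Qed.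

Lemma l1mx_ge0 h : 0 <= l1mx h.
Proof. by apply: sumr_ge0 => i _; exact: sumr_ge0. Qed.

Lemma le_l1 x i : `|x i| <= l1 x.
Proof. by rewrite /l1 (bigD1 i)//= lerDl sumr_ge0. Qed.

Lemma norm_sum_le x (c : R) : (forall i, `|x i| <= c) -> `|\sum_i x i| <= n%:R * c.
Proof.
move=> xc; rewrite (le_trans (ler_norm_sum _ _ _))//.
by rewrite (le_trans (ler_sum _ (fun i _ => xc i)))// sumr_const card_ord mulr_natl.
Qed.

Lemma norm_dot_le x y (c : R) : (forall i, `|x i| <= c) ->
  `|\sum_i x i * y i| <= c * l1 y.
Proof.
move=> xc; rewrite (le_trans (ler_norm_sum _ _ _))// mulr_sumr ler_sum// => i _.
by rewrite normrM ler_wpM2r.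
Qed.

Lemma norm_bform_le a x y (c : R) : (forall i j, `|a i j| <= c) ->
  `|bform a x y| <= c * l1 x * l1 y.
Proof.
move=> ac; rewrite (le_trans (ler_norm_sum _ _ _))// -mulrA mulr_suml mulr_sumr.
apply: ler_sum => i _; rewrite (le_trans (ler_norm_sum _ _ _))// !mulr_sumr.
by apply: ler_sum => j _; rewrite !normrM -mulrA ler_wpM2r// mulr_ge0.
Qed.

Lemma bformDl a x y z (c d : R) :
  bform a (fun i => c * x i + d * y i) z = c * bform a x z + d * bform a y z.
Proof.
rewrite /bform !mulr_sumr -big_split; apply: eq_bigr => i _ /=.
by rewrite !mulr_sumr -big_split; apply: eq_bigr => j _ /=; ring.
Qed.

Lemma bform_sym a x y : (forall i j, a i j = a j i) -> bform a x y = bform a y x.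
Proof.
move=> sa; rewrite /bform exchange_big; apply: eq_bigr => i _; apply: eq_bigr => j _ /=.
by rewrite (sa j i); ring.
Qed.

Lemma bform_combination a x y (c d : R) : (forall i j, a i j = a j i) ->
  bform a (fun i => c * x i + d * y i) (fun i => c * x i + d * y i) =
  c ^+ 2 * bform a x x + 2 * (c * d) * bform a x y + d ^+ 2 * bform a y y.
Proof.
move=> sa; rewrite bformDl.
rewrite [bform a x _](bform_sym _ _ sa) [bform a y _](bform_sym _ _ sa) !bformDl.
by rewrite (bform_sym y x sa); ring.
Qed.

Lemma bform_suml a (I : finType) (c : I -> R) (x : I -> 'I_n -> R) y :
  bform a (fun j => \sum_l c l * x l j) y = \sum_l c l * bform a (x l) y.
Proof.
rewrite /bform; transitivity (\sum_i \sum_j \sum_l c l * (a i j * x l i * y j)).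
  apply: eq_bigr => i _; apply: eq_bigr => j _; rewrite mulr_sumr mulr_suml.
  by apply: eq_bigr => l _; ring.
under eq_bigr do rewrite exchange_big /=.
rewrite exchange_big /=; apply: eq_bigr => l _; rewrite mulr_sumr.
by apply: eq_bigr => i _; rewrite mulr_sumr.
Qed.

End arrays.

Section hessian_algebra.
Context {R : realFieldType} {n : nat}.
Variables (a : 'I_n -> 'I_n -> R) (lam M : R).
Hypothesis sa : forall i j, a i j = a j i.
Hypothesis lam0 : 0 < lam.
Hypothesis ell : forall x : 'I_n -> R, lam * (\sum_i x i ^+ 2) <= bform a x x.
Hypothesis aM : forall i j, `|a i j| <= M.
Variables (h : 'I_n -> 'I_n -> R) (nu : 'I_n -> R).
Hypothesis sh : forall i j, h i j = h j i.
Hypothesis nu1 : \sum_i nu i ^+ 2 <= 1.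

Let s j := \sum_l nu l * h l j.
Let r l j := h l j - nu l * s j.
Let tr := \sum_i \sum_j a i j * h i j.

(** The gap in the Cauchy-Schwarz inequality A(s, s) <= sum of the A(h_l, h_l), for
[s] the combination of the rows of [h] with the coefficients [nu] of norm at
most 1. *)
Definition hessian_defect := \sum_l bform a (h l) (h l) - bform a s s.

Lemma bform_ge0 (x : 'I_n -> R) : 0 <= bform a x x.
Proof.
apply: le_trans (ell x); rewrite mulr_ge0 ?(ltW lam0)// sumr_ge0// => i _.
exact: sqr_ge0.
Qed.

(** The rows of [h] split as [h l = r l + nu l * s]. Both terms of the right-hand
side are nonnegative, so that the defect controls [r], and controls [s] when
[nu] is not close to a unit vector. *)
Lemma hessian_defectE : hessian_defect =
  \sum_l bform a (r l) (r l) + (1 - \sum_i nu i ^+ 2) * bform a s s.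
Proof.
have E l : bform a (r l) (r l) =
    bform a (h l) (h l) + (- 2 * (nu l * bform a (h l) s) + nu l ^+ 2 * bform a s s).
  have := bform_combination (h l) s 1 (- nu l) sa.
  have -> : (fun i => 1 * h l i + - nu l * s i) = r l.
    by apply/funext => j; rewrite mul1r mulNr.
  by move=> ->; ring.
under eq_bigr do rewrite E.
rewrite !big_split /= -mulr_sumr -mulr_suml.
have -> : \sum_l nu l * bform a (h l) s = bform a s s by rewrite -bform_suml.
by rewrite /hessian_defect; ring.
Qed.

Lemma nu_le1 i : `|nu i| <= 1.
Proof.
rewrite -(ler_pXn2r (n := 2)) ?nnegrE// expr1n real_normK ?num_real//.
apply: le_trans nu1; rewrite (bigD1 i)//= lerDl sumr_ge0// => j _; exact: sqr_ge0.
Qed.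

Lemma hessian_defect_ge0 : 0 <= hessian_defect.
Proof.
rewrite hessian_defectE addr_ge0 ?mulr_ge0 ?bform_ge0 ?subr_ge0//.
by rewrite sumr_ge0// => l _; exact: bform_ge0.
Qed.

Variable N : R.
Hypothesis N0 : 0 <= N.
Hypothesis defect_le : hessian_defect <= lam * N ^+ 2.

Let r_le l j : `|r l j| <= N.
Proof.
rewrite -(ler_pXn2r (n := 2)) ?nnegrE// real_normK ?num_real//.
rewrite -(ler_pM2l lam0); apply: le_trans defect_le.
rewrite hessian_defectE ler_wpDr ?mulr_ge0 ?bform_ge0 ?subr_ge0//.
rewrite (bigD1 l)//= ler_wpDr ?sumr_ge0//; first by move=> k _; exact: bform_ge0.
apply: le_trans (ell _); rewrite ler_pM2l// (bigD1 j)//= lerDl sumr_ge0// => k _.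
exact: sqr_ge0.
Qed.

Let s_le j : (1 - \sum_i nu i ^+ 2) * s j ^+ 2 <= N ^+ 2.
Proof.
rewrite -(ler_pM2l lam0); apply: le_trans defect_le.
rewrite hessian_defectE ler_wpDl ?sumr_ge0//; first by move=> l _; exact: bform_ge0.
rewrite mulrCA ler_wpM2l ?subr_ge0//; apply: le_trans (ell _).
rewrite ler_pM2l// (bigD1 j)//= lerDl sumr_ge0// => k _; exact: sqr_ge0.
Qed.

Let M0 (i : 'I_n) : 0 <= M.
Proof. exact: le_trans (aM i i). Qed.

(** The difference is the trace of the product of [a] and [r]. *)
Lemma trace_sub_bform_le :
  `|tr - bform a nu s| <= n%:R * (n%:R * (M * N)).
Proof.
rewrite (_ : tr - _ = \sum_i \sum_j a i j * r i j); last first.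
  rewrite /tr /bform -sumrB; apply: eq_bigr => i _; rewrite -sumrB.
  by apply: eq_bigr => j _; rewrite /r; ring.
apply: norm_sum_le => i; apply: norm_sum_le => j.
by rewrite normrM ler_pM.
Qed.

Definition hessian_const := n%:R + 3 + 2 / lam * (1 + n%:R * (n%:R * M) * (1 + n%:R)).

(** As [h = r + nu s] with [r] controlled by the defect, only [s] is in question.
If [nu] has norm far from 1, the defect controls [s] directly. Otherwise the
symmetry of [h] gives [s = w + sg nu] with [w] controlled by [r], and the number
[sg] is recovered from the trace, which is close to
[bform a nu s = bform a nu w + sg * bform a nu nu], since the last factor is at
least [lam / 2]. *)
Lemma hessian_entry_le k j : `|h k j| <= hessian_const * (N + `|tr|).
Proof.
have hM := M0 k.
have n0 : 0 <= n%:R :> R by exact: ler0n.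
have nM : 0 <= n%:R * (n%:R * M) * (1 + n%:R) by rewrite !mulr_ge0 ?addr_ge0.
have il : 0 <= 2 / lam by rewrite divr_ge0// ltW.
have hk : `|h k j| <= N + `|s j|.
  rewrite (_ : h k j = r k j + nu k * s j); last by rewrite /r; ring.
  rewrite (le_trans (ler_normD _ _))// lerD// normrM ler_piMl//; exact: nu_le1.
have [small|big] := ltrP (\sum_i nu i ^+ 2) 2^-1.
  have : `|s j| <= 2 * N.
    rewrite -(ler_pXn2r (n := 2)) ?nnegrE ?mulr_ge0// real_normK ?num_real//.
    rewrite -subr_ge0 exprMn; have := s_le j; have := sqr_ge0 (s j).
    move: (s j ^+ 2) (N ^+ 2) small => S Q H S0 SQ; nra.
  move=> sN; apply: (le_trans hk); rewrite /hessian_const.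
  have := normr_ge0 tr; move: (`|tr|) => T T0.
  apply: (@le_trans _ _ (3 * N)); first lra.
  rewrite -subr_ge0 (_ : _ - _ = 3 * T + n%:R * (N + T) +
      2 / lam * (1 + n%:R * (n%:R * M) * (1 + n%:R)) * (N + T)); last by ring.
  have NT : 0 <= N + T by exact: addr_ge0.
  have c0 : 0 <= 2 / lam * (1 + n%:R * (n%:R * M) * (1 + n%:R)).
    by apply: mulr_ge0 => //; apply: addr_ge0.
  by apply: addr_ge0; [apply: addr_ge0|]; apply: mulr_ge0.
pose sg := \sum_i nu i * s i.
pose w i := \sum_l nu l * r i l.
have sE i : s i = w i + sg * nu i.
  rewrite {1}/s /sg mulr_suml -big_split /=; apply: eq_bigr => l _.
  by rewrite (sh l i) /r; move: (s l) => S; ring.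
have wN i : `|w i| <= n%:R * N.
  apply: norm_sum_le => l; rewrite normrM -[leRHS]mul1r ler_pM//; exact: nu_le1.
have l1nu : l1 nu <= n%:R.
  rewrite /l1 (le_trans (ler_sum _ (fun i _ => nu_le1 i)))//.
  by rewrite sumr_const card_ord.
have l1w : l1 w <= n%:R * (n%:R * N).
  rewrite /l1 (le_trans (ler_sum _ (fun i _ => wN i)))//.
  by rewrite sumr_const card_ord [leRHS]mulr_natl.
have fw : `|bform a nu w| <= n%:R * (n%:R * (n%:R * (M * N))).
  rewrite (le_trans (norm_bform_le nu w aM))//.
  apply: (@le_trans _ _ (M * n%:R * (n%:R * (n%:R * N)))).
    by rewrite ler_pM ?mulr_ge0 ?l1_ge0// ler_wpM2l.
  by rewrite le_eqVlt; apply/orP; left; apply/eqP; ring.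
have fs : bform a nu s = bform a nu w + sg * bform a nu nu.
  rewrite (bform_sym nu s sa) (bform_sym nu w sa).
  have := bformDl a w nu nu 1 sg; rewrite mul1r => <-; congr bform.
  by apply/funext => i; rewrite sE mul1r.
have sgb : `|sg| * (lam / 2) <= `|tr| + n%:R * (n%:R * (M * N)) * (1 + n%:R).
  apply: (@le_trans _ _ `|sg * bform a nu nu|).
    rewrite normrM ler_wpM2l// ger0_norm ?bform_ge0//; apply: le_trans (ell _).
    by rewrite ler_pM2l.
  rewrite (_ : sg * _ = tr - (tr - bform a nu s) - bform a nu w); last by rewrite fs; ring.
  rewrite (le_trans (ler_normB _ _))// mulrDr mulr1 addrA.
  rewrite lerD//; last by rewrite mulrC.
  by rewrite (le_trans (ler_normB _ _))// lerD2l trace_sub_bform_le.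
have sgl : `|sg| <= 2 / lam * (`|tr| + n%:R * (n%:R * (M * N)) * (1 + n%:R)).
  rewrite -(ler_pM2r (_ : 0 < lam / 2)) ?divr_gt0//; apply: (le_trans sgb).
  by rewrite le_eqVlt; apply/orP; left; apply/eqP; field; rewrite gt_eqF.
have sl : `|s j| <= n%:R * N + `|sg|.
  rewrite sE (le_trans (ler_normD _ _))// lerD// normrM ler_piMr//; exact: nu_le1.
apply: (le_trans hk); apply: (@le_trans _ _ (N + (n%:R * N +
    2 / lam * (`|tr| + n%:R * (n%:R * (M * N)) * (1 + n%:R))))).
  by rewrite lerD2l (le_trans sl)// lerD2l.
rewrite /hessian_const; have := normr_ge0 tr; move: (`|tr|) => T T0.
rewrite -subr_ge0 (_ : _ - _ = 2 * N + (n%:R + 3) * T + 2 / lam * N +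
   2 / lam * (n%:R * (n%:R * M) * (1 + n%:R) * T)); last by ring.
have nMT : 0 <= n%:R * (n%:R * M) * (1 + n%:R) * T by exact: mulr_ge0.
have n3 : 0 <= n%:R + 3 :> R by exact: addr_ge0.
by do 3?[apply: addr_ge0]; apply: mulr_ge0.
Qed.

End hessian_algebra.

(** * The pointwise energy inequality *)

Section complete_square.
Context {R : realFieldType} {n : nat}.
Variables (a : 'I_n -> 'I_n -> R) (lam : R).
Hypothesis sa : forall i j, a i j = a j i.
Hypothesis lam0 : 0 < lam.
Hypothesis ell : forall x : 'I_n -> R, lam * (\sum_i x i ^+ 2) <= bform a x x.

(** With [P = S + T], the left-hand side is the right-hand side without its last
term, plus [c * (beta . T) - bform a T T], and ellipticity bounds the maximum of
this over [T]. In the application [P] contains the logarithmic gradient of the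
supersolution, about which nothing is known. *)
Lemma complete_square_le (S P beta : 'I_n -> R) (c : R) :
  2 * bform a S P - bform a P P + c * (\sum_j beta j * P j) <=
  bform a S S + c * (\sum_j beta j * S j) + c ^+ 2 * (\sum_j beta j ^+ 2) / (4 * lam).
Proof.
pose T j := P j - S j.
have PE : P = (fun j => 1 * S j + 1 * T j) by apply/funext => j; rewrite /T; ring.
have E1 : bform a P P = bform a S S + 2 * bform a S T + bform a T T.
  by rewrite PE bform_combination//; ring.
have E2 : bform a S P = bform a S S + bform a S T.
  by rewrite (bform_sym _ _ sa) PE bformDl (bform_sym T _ sa); ring.
have E3 : \sum_j beta j * P j = \sum_j beta j * S j + \sum_j beta j * T j.
  by rewrite -big_split; apply: eq_bigr => j _; rewrite /T /=; ring.
have : 0 <= lam * (\sum_j (T j - c / (2 * lam) * beta j) ^+ 2).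
  by rewrite mulr_ge0 ?(ltW lam0)// sumr_ge0// => j _; exact: sqr_ge0.
rewrite (eq_bigr (fun j => T j ^+ 2 + (- (c / lam) * (beta j * T j) +
   (c / (2 * lam)) ^+ 2 * beta j ^+ 2))); last first.
  by move=> j _; field; rewrite gt_eqF.
rewrite !big_split /= -!mulr_sumr => H.
have := ell T; rewrite E1 E2 E3; move: H.
move: (\sum_i T i ^+ 2) (\sum_i beta i * T i) (\sum_i beta i ^+ 2) => x y z.
rewrite (_ : lam * _ = lam * x - c * y + c ^+ 2 * z / (4 * lam)); last by field; rewrite gt_eqF.
move: (bform a _ _) (bform a _ _) (bform a _ _) (\sum_j _) => u v w r.
move: (_ / _) => d; lra.
Qed.

End complete_square.

(** All quantities are the values at one point: [p], [h] and [at_] are the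
gradient and the Hessian of u and the vector with entries
sum_ij a_ij d_k d_i d_j u, [g] is the regularized norm of [p], [F1] is f'(u),
[aphi] is the trace of [A *m D ^ 2 phi], and [e] is the gradient of the cutoff
[eta]. Being inequalities between such values, the estimates below are pure
algebra; the divergences occur in them in expanded form. *)
Section pointwise.
Context {R : rcfType} {n : nat}.
Variables (a : 'I_n -> 'I_n -> R) (lam M : R).
Hypothesis sa : forall i j, a i j = a j i.
Hypothesis lam0 : 0 < lam.
Hypothesis M0 : 0 <= M.
Hypothesis ell : forall x : 'I_n -> R, lam * (\sum_i x i ^+ 2) <= bform a x x.
Hypothesis aM : forall i j, `|a i j| <= M.
Variables (da : 'I_n -> 'I_n -> 'I_n -> R) (b : 'I_n -> R) (db : 'I_n -> 'I_n -> R).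
Hypothesis da1 : forall k i j, `|da k i j| <= 1.
Hypothesis b1 : forall i, `|b i| <= 1.
Variables (p : 'I_n -> R) (h : 'I_n -> 'I_n -> R) (at_ : 'I_n -> R).
Hypothesis sh : forall i j, h i j = h j i.
Variables (g d2 : R).
Hypothesis g0 : 0 < g.
Hypothesis d20 : 0 <= d2.
Hypothesis gE : g ^+ 2 = \sum_i p i ^+ 2 + d2.
Variables (phi : R) (dphi : 'I_n -> R) (aphi F1 : R).
Hypothesis phi0 : 0 < phi.
Variables (eta : R) (e : 'I_n -> R).

Let ba j := \sum_i da i i j.
Let bp := \sum_i b i * p i.
Let tr := \sum_i \sum_j a i j * h i j.
Let nu i := p i / g.
Let s j := \sum_l nu l * h l j.

(* f(u) >= 0 *)
Hypothesis source_ge0 : 0 <= - tr - bp.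
Hypothesis linearized : forall k, F1 * p k =
  - (\sum_i \sum_j da k i j * h i j + at_ k) - \sum_i (db k i * p i + b i * h k i).
Hypothesis supersolution : F1 * phi <= - (aphi + \sum_i b i * dphi i).

(** The divergence of [eta ^+ 2 *: (m *: (A *m w))] in terms of the values at one
point of [m], [w], [eta] and their derivatives; [aDw] stands for the trace of
[A *m D w]. *)
Definition flux_div (m : R) (dm w : 'I_n -> R) (aDw : R) :=
  eta ^+ 2 * (bform a dm w + m * (\sum_j ba j * w j + aDw)) +
  2 * eta * (m * bform a e w).

(** The divergence of eta^2 (g^2 / phi) A grad phi. *)
Definition div_log := flux_div (g ^+ 2 / phi)
  (fun i => 2 * g / phi * s i + (- (g ^+ 2 / phi ^+ 2)) * dphi i) dphi aphi.

(** The divergence of eta^2 A w for [w j = g * s j], that is, for the sum over l of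
u_l grad u_l. *)
Definition div_energy := flux_div 1 (fun=> 0) (fun j => g * s j)
  (\sum_l bform a (h l) (h l) + \sum_l p l * at_ l).

(** The divergence of eta^2 (b . grad u) grad u. *)
Definition div_drift := \sum_k (eta ^+ 2 *
    (h k k * bp + p k * (\sum_i (db k i * p i + b i * h k i))) +
  2 * eta * (p k * bp * e k)).

(** The divergence of eta^2 g A grad u. *)
Definition div_gradient := flux_div g s p tr.

Let defect := \sum_l bform a (h l) (h l) - bform a s s.
Let hh := l1mx h.
Let ee := l1 e.
Let N_ : R := n%:R.

(** What the drift and the derivatives of A contribute: it is at most linear in the
Hessian, whereas the defect is quadratic. *)
Let error := eta ^+ 2 * (- (\sum_k p k * (\sum_i \sum_j da k i j * h i j)) +
   g * (\sum_j ba j * s j) + bp * (\sum_k h k k)) + 2 * eta * bp * (\sum_k p k * e k).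

(** The equations for the derivatives u_k, multiplied by [p k] and summed. The terms
with db_k or with third derivatives of u are absorbed into divergences, since no
bound for them is available. *)
Let linearized_energy : eta ^+ 2 * (F1 * (g ^+ 2 - d2)) + div_energy + div_drift =
  eta ^+ 2 * (\sum_l bform a (h l) (h l)) + 2 * eta * g * bform a e s + error.
Proof.
have -> : F1 * (g ^+ 2 - d2) = \sum_k p k * (F1 * p k).
  by rewrite gE addrK mulr_sumr; apply: eq_bigr => k _; ring.
under eq_bigr do rewrite linearized.
have -> : \sum_k p k * (- (\sum_i \sum_j da k i j * h i j + at_ k) -
      \sum_i (db k i * p i + b i * h k i)) =
    - (\sum_k p k * (\sum_i \sum_j da k i j * h i j)) - \sum_k p k * at_ k -
    \sum_k p k * (\sum_i (db k i * p i + b i * h k i)).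
  by rewrite -sumrN -!sumrB; apply: eq_bigr => k _; ring.
have bf0 : bform a (fun=> 0) (fun j => g * s j) = 0.
  by rewrite /bform big1// => i _; rewrite big1// => j _; rewrite mulr0 mul0r.
have bfe : bform a e (fun j => g * s j) = g * bform a e s.
  rewrite !(bform_sym e _ sa) -[RHS]addr0 -[in RHS](mul0r (bform a s e)) -bformDl.
  by congr bform; apply/funext => j; rewrite mul0r addr0.
have bas : \sum_j ba j * (g * s j) = g * \sum_j ba j * s j.
  by rewrite mulr_sumr; apply: eq_bigr => j _; ring.
have driftE : div_drift = eta ^+ 2 * (bp * \sum_k h k k +
      \sum_k p k * (\sum_i (db k i * p i + b i * h k i))) +
    2 * eta * bp * (\sum_k p k * e k).
  rewrite /div_drift big_split /= -!mulr_sumr big_split /= -mulr_suml.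
  have -> : \sum_k p k * bp * e k = bp * \sum_k p k * e k.
    by rewrite mulr_sumr; apply: eq_bigr => k _; ring.
  by ring.
rewrite driftE /div_energy /flux_div /error bf0 bfe bas.
by ring.
Qed.

Let S j := eta * s j + g * e j.
Let P j := g * eta / phi * dphi j.

(** The supersolution inequality multiplied by eta^2 g^2 / phi; the gradient of phi
enters through [P] only. *)
Let log_bound : eta ^+ 2 * (F1 * g ^+ 2) <= - div_log +
  (2 * bform a S P - bform a P P + g * eta * (\sum_j (ba j - b j) * P j)).
Proof.
have bfP x : bform a x P = g * eta / phi * bform a x dphi.
  rewrite !(bform_sym x _ sa) -[RHS]addr0 -[in RHS](mul0r (bform a dphi x)) -bformDl.
  by congr bform; apply/funext => j; rewrite mul0r addr0.
have bfPP : bform a P P = (g * eta / phi) ^+ 2 * bform a dphi dphi.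
  by rewrite bfP (bform_sym P _ sa) bfP; ring.
have bPE : \sum_j (ba j - b j) * P j =
    g * eta / phi * (\sum_j ba j * dphi j - \sum_j b j * dphi j).
  by rewrite -sumrB mulr_sumr; apply: eq_bigr => j _; rewrite /P; ring.
have H := ler_wpM2l (_ : 0 <= eta ^+ 2 * (g ^+ 2 / phi)) supersolution.
have {H} := H (mulr_ge0 (sqr_ge0 _) (divr_ge0 (sqr_ge0 _) (ltW phi0))).
rewrite /div_log /flux_div bformDl bPE bfP bfPP (bformDl a s e dphi eta g).
move: (bform a _ _) (bform a _ _) (bform a _ _) (\sum_j _) (\sum_j _) => x y z u v.
rewrite (_ : eta ^+ 2 * (g ^+ 2 / phi) * (F1 * phi) = eta ^+ 2 * (F1 * g ^+ 2)); last first.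
  by field; rewrite gt_eqF.
move=> H; apply: (le_trans H); rewrite le_eqVlt; apply/orP; left; apply/eqP.
by field; rewrite gt_eqF.
Qed.

Let N0 : 0 <= N_. Proof. exact: ler0n. Qed.
Let hh0 : 0 <= hh. Proof. exact: l1mx_ge0. Qed.
Let ee0 : 0 <= ee. Proof. exact: l1_ge0. Qed.

Let nu_sqr : \sum_i nu i ^+ 2 <= 1.
Proof.
rewrite (eq_bigr (fun i => (g ^+ 2)^-1 * p i ^+ 2)); last first.
  by move=> i _; rewrite /nu expr_div_n mulrC.
rewrite -mulr_sumr mulrC ler_pdivrMr ?exprn_gt0// mul1r gE lerDl //.
Qed.

Let pE i : p i = g * nu i.
Proof. by rewrite /nu; field; rewrite gt_eqF. Qed.

Let p_le i : `|p i| <= g.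
Proof.
rewrite pE normrM (gtr0_norm g0) -[leRHS]mulr1 ler_wpM2l ?(ltW g0)//.
exact: nu_le1 nu_sqr i.
Qed.

Let l1p : l1 p <= N_ * g.
Proof.
rewrite /l1 (le_trans (ler_sum _ (fun i _ => p_le i)))//.
by rewrite sumr_const card_ord [leRHS]mulr_natl.
Qed.

Let l1s : l1 s <= hh.
Proof.
rewrite /hh /l1mx exchange_big; apply: ler_sum => j _.
rewrite (le_trans (ler_norm_sum _ _ _))//; apply: ler_sum => l _.
by rewrite normrM ler_piMl//; exact: nu_le1 nu_sqr l.
Qed.

Let ba_le j : `|ba j| <= N_.
Proof. by rewrite -[leRHS]mulr1; apply: norm_sum_le => i; exact: da1. Qed.

Let bp_le : `|bp| <= N_ * g.
Proof.
by apply: norm_sum_le => i; rewrite normrM -[leRHS]mul1r ler_pM.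
Qed.

Let da_h_le k : `|\sum_i \sum_j da k i j * h i j| <= hh.
Proof.
rewrite (le_trans (ler_norm_sum _ _ _))//; apply: ler_sum => i _.
rewrite (le_trans (ler_norm_sum _ _ _))//; apply: ler_sum => j _.
by rewrite normrM ler_piMl.
Qed.

Let trh_le : `|\sum_k h k k| <= hh.
Proof.
rewrite (le_trans (ler_norm_sum _ _ _))//; apply: ler_sum => k _.
exact: (le_l1 (h k) k).
Qed.

Let eta_ee : 2 * (`|eta| * ee) <= eta ^+ 2 + ee ^+ 2.
Proof.
rewrite -subr_ge0 -(real_normK (num_real eta)).
by rewrite (_ : _ - _ = (`|eta| - ee) ^+ 2) ?sqr_ge0//; ring.
Qed.

Let Y := g ^+ 2 * (eta ^+ 2 + ee ^+ 2).

Let Y0 : 0 <= Y.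
Proof. by rewrite mulr_ge0 ?addr_ge0 ?sqr_ge0. Qed.

Let eta_ee_Y : g ^+ 2 * (`|eta| * ee) <= Y / 2.
Proof.
rewrite /Y -mulrA ler_wpM2l ?sqr_ge0// ler_pdivlMr// mulrC; exact: eta_ee.
Qed.

Let eta2_Y : g ^+ 2 * eta ^+ 2 <= Y.
Proof. by rewrite ler_wpM2l ?sqr_ge0// lerDl sqr_ge0. Qed.

Let ee2_Y : g ^+ 2 * ee ^+ 2 <= Y.
Proof. by rewrite ler_wpM2l ?sqr_ge0// lerDr sqr_ge0. Qed.

Let error_le : `|error| <= 3 * N_ * (g * hh * eta ^+ 2) + N_ * Y.
Proof.
have A1 : `|\sum_k p k * (\sum_i \sum_j da k i j * h i j)| <= N_ * (g * hh).
  by apply: norm_sum_le => k; rewrite normrM ler_pM.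
have A2 : `|g * (\sum_j ba j * s j)| <= N_ * (g * hh).
  rewrite normrM (gtr0_norm g0) mulrCA ler_wpM2l ?(ltW g0)//.
  by rewrite (le_trans (norm_dot_le _ ba_le))// ler_wpM2l.
have A3 : `|bp * (\sum_k h k k)| <= N_ * (g * hh) by rewrite normrM mulrA ler_pM.
have A4 : `|bp * (\sum_k p k * e k)| <= N_ * g ^+ 2 * ee.
  rewrite normrM expr2 mulrA -[leRHS]mulrA ler_pM//.
  by rewrite (norm_dot_le _ p_le).
rewrite /error (le_trans (ler_normD _ _))// lerD//.
  rewrite normrM (ger0_norm (sqr_ge0 eta)) mulrC.
  rewrite (_ : 3 * _ * _ = (N_ * (g * hh) + N_ * (g * hh) + N_ * (g * hh)) * eta ^+ 2); last by ring.
  rewrite ler_wpM2r ?sqr_ge0// (le_trans (ler_normD _ _))// lerD//.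
  by rewrite (le_trans (ler_normD _ _))// lerD// normrN.
rewrite -2!mulrA 2!normrM (ger0_norm (ler0n _ 2)).
apply: (@le_trans _ _ (2 * (`|eta| * (N_ * g ^+ 2 * ee)))).
  by rewrite ler_wpM2l// ler_wpM2l.
rewrite (_ : 2 * _ = N_ * (2 * (g ^+ 2 * (`|eta| * ee)))); last by ring.
by rewrite ler_wpM2l// mulrC -ler_pdivlMr.
Qed.

Definition defect_const := 4 * N_ + 1 + M + N_ * (N_ + 1) ^+ 2 / (4 * lam).

Let defect_const_ge1 : 1 <= defect_const.
Proof.
have : 0 <= N_ * (N_ + 1) ^+ 2 / (4 * lam).
  by apply: divr_ge0; apply: mulr_ge0 => //; [exact: sqr_ge0|exact: ltW].
by rewrite /defect_const; move: (_ / _) => z; move: N0 M0; lra.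
Qed.

(** The terms F1 * g^2 of [linearized_energy] and [log_bound] cancel, and
[complete_square_le] eliminates [P]. *)
Lemma defect_ineq : eta ^+ 2 * defect <= div_energy + div_drift - div_log +
  defect_const * (g * hh * eta ^+ 2 + Y) + d2 * (`|F1| * eta ^+ 2).
Proof.
have lE := linearized_energy.
have lB := log_bound.
have cs := complete_square_le sa lam0 ell S P (fun j => ba j - b j) (g * eta).
have SS : bform a S S = eta ^+ 2 * bform a s s + 2 * eta * g * bform a e s +
    g ^+ 2 * bform a e e.
  by rewrite /S bform_combination// (bform_sym e s sa); ring.
have ae : bform a e e <= M * ee ^+ 2.
  by rewrite (le_trans (ler_norm _))// (le_trans (norm_bform_le _ _ aM))// expr2 mulrA.
have be_le j : `|ba j - b j| <= N_ + 1.
  by rewrite (le_trans (ler_normB _ _))// lerD.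
have l1S : l1 S <= `|eta| * hh + g * ee.
  apply: (@le_trans _ _ (\sum_j (`|eta| * `|s j| + g * `|e j|))).
    apply: ler_sum => j _.
    by rewrite (le_trans (ler_normD _ _))// !normrM (gtr0_norm g0).
  by rewrite big_split /= -!mulr_sumr lerD2r ler_wpM2l.
have bS : g * eta * (\sum_j (ba j - b j) * S j) <=
    (N_ + 1) * (g * hh * eta ^+ 2 + g ^+ 2 * (`|eta| * ee)).
  rewrite (le_trans (ler_norm _))// !normrM (gtr0_norm g0).
  apply: (@le_trans _ _ (g * `|eta| * ((N_ + 1) * (`|eta| * hh + g * ee)))).
    rewrite ler_wpM2l ?mulr_ge0 ?(ltW g0)// (le_trans (norm_dot_le _ be_le))//.
    by rewrite ler_wpM2l ?addr_ge0.
  rewrite -(real_normK (num_real eta)) le_eqVlt; apply/orP; left; apply/eqP.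
  by ring.
have bb : (g * eta) ^+ 2 * (\sum_j (ba j - b j) ^+ 2) / (4 * lam) <=
    N_ * (N_ + 1) ^+ 2 / (4 * lam) * (g ^+ 2 * eta ^+ 2).
  rewrite [leRHS]mulrAC ler_wpM2r ?invr_ge0 ?mulr_ge0 ?(ltW lam0)//.
  rewrite exprMn mulrC; apply: ler_wpM2r; first by apply: mulr_ge0; exact: sqr_ge0.
  apply: (le_trans (ler_norm _)); apply: norm_sum_le => j.
  by rewrite normrX ler_pXn2r ?nnegrE ?addr_ge0.
have ff : - (d2 * (`|F1| * eta ^+ 2)) <= eta ^+ 2 * (F1 * d2).
  rewrite (_ : eta ^+ 2 * (F1 * d2) = (d2 * eta ^+ 2) * F1); last by ring.
  rewrite (_ : - _ = (d2 * eta ^+ 2) * (- `|F1|)); last by ring.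
  apply: ler_wpM2l; first by apply: mulr_ge0 => //; exact: sqr_ge0.
  by rewrite lerNl -normrN ler_norm.
have gae : g ^+ 2 * bform a e e <= M * Y.
  rewrite (le_trans (ler_wpM2l (sqr_ge0 g) ae))// mulrCA ler_wpM2l//.
have Kp : 0 <= N_ * (N_ + 1) ^+ 2 / (4 * lam).
  by apply: divr_ge0; apply: mulr_ge0 => //; [exact: sqr_ge0|exact: ltW].
have bb2 := ler_wpM2l Kp eta2_Y.
have er : - error <= 3 * N_ * (g * hh * eta ^+ 2) + N_ * Y.
  by apply: le_trans error_le; rewrite -normrN ler_norm.
have bS2 : (N_ + 1) * (g ^+ 2 * (`|eta| * ee)) <= (N_ + 1) * (Y / 2).
  by rewrite ler_wpM2l ?addr_ge0.
have X0 : 0 <= g * hh * eta ^+ 2.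
  by apply: mulr_ge0; [apply: mulr_ge0 => //; exact: ltW|exact: sqr_ge0].
have NY : 0 <= N_ * Y by rewrite mulr_ge0.
have NX : 0 <= N_ * (g * hh * eta ^+ 2) by rewrite mulr_ge0.
have MX : 0 <= M * (g * hh * eta ^+ 2) by rewrite mulr_ge0.
have KX := mulr_ge0 Kp X0.
have dE : eta ^+ 2 * defect = eta ^+ 2 * (\sum_l bform a (h l) (h l)) - eta ^+ 2 * bform a s s.
  by rewrite /defect mulrBr.
rewrite dE /defect_const.
move: er bS bS2 bb bb2 gae ff cs lB lE MX KX NX NY X0 Y0; rewrite SS.
move: (g * hh * eta ^+ 2) (N_ * (N_ + 1) ^+ 2 / (4 * lam)) Y => X K Yv.
move: (g ^+ 2 * (`|eta| * ee)) => Z.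
move: (_ / (4 * lam)) => Q.
move: (g * eta * _) (g * eta * _) => q1 q2.
move: (2 * bform a S P) (bform a P P) => q3 q4.
move: (d2 * (`|F1| * _)) => q5.
move: (eta ^+ 2 * (\sum_l _)) (eta ^+ 2 * bform a s s) => q6 q7.
move: (2 * eta * g * _) (g ^+ 2 * bform a e e) error => q8 q9 q10.
move: div_log div_energy div_drift => q11 q12 q13.
rewrite mulrBr [g ^+ 2 * eta ^+ 2]mulrC.
move: (g ^+ 2 * eta ^+ 2) => q14.
lra.
Qed.

(** [flux_const] compares the sum of the entries of the Hessian with
[N + `|tr|], [entry_const] collects the coefficients of [g * N * eta ^+ 2]
and of [Y] once the trace is eliminated, and [energy_const] is what remains
after half of the left-hand side is absorbed. *)
Definition flux_const := N_ ^+ 2 * hessian_const (n := n) lam M.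
Definition entry_const :=
  flux_const * (1 + (N_ ^+ 2 + M * N_) / 2 + N_ ^+ 2 * M / 2 + 2 * N_).
Definition energy_const :=
  1 + entry_const ^+ 2 * defect_const / lam + 2 * entry_const.

Let flux_const_ge0 : 0 <= flux_const.
Proof.
apply: mulr_ge0; first exact: sqr_ge0.
rewrite /hessian_const; apply: addr_ge0; first exact: addr_ge0.
have ? : 0 <= n%:R :> R by exact: ler0n.
apply: mulr_ge0; first by apply: divr_ge0 => //; exact: ltW.
apply: addr_ge0 => //; apply: mulr_ge0; first by rewrite !mulr_ge0.
exact: addr_ge0.
Qed.

Let entry_const_ge0 : 0 <= entry_const.
Proof.
apply: mulr_ge0 => //; have ? : 0 <= N_ ^+ 2 by exact: sqr_ge0.
have ? : 0 <= M * N_ by exact: mulr_ge0.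
have ? : 0 <= N_ ^+ 2 * M by exact: mulr_ge0.
by move: N0; lra.
Qed.

Lemma energy_const_ge0 : 0 <= energy_const.
Proof.
rewrite /energy_const; apply: addr_ge0; last exact: mulr_ge0.
apply: addr_ge0 => //; apply: divr_ge0; last exact: ltW.
by apply: mulr_ge0; [exact: sqr_ge0|exact: le_trans defect_const_ge1].
Qed.

(** With [N] the square root of defect / lam, the entries of the Hessian are at most
a constant times [N + `|tr|]. The trace is eliminated by means of
[div_gradient], the term in [N] by Young's inequality and [defect_ineq], whose
right-hand side contains [g * hh * eta ^+ 2] with a factor that Young's
inequality makes equal to 1/2. *)
Theorem pointwise_energy : g * hh * eta ^+ 2 <=
  energy_const * (g ^+ 2 * (eta ^+ 2 + ee ^+ 2)) + d2 * (`|F1| * eta ^+ 2) +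
  defect_const^-1 * (div_energy + div_drift - div_log) - flux_const * div_gradient.
Proof.
have D0 : 0 <= defect := hessian_defect_ge0 sa lam0 ell h nu_sqr.
pose N := Num.sqrt (defect / lam).
have NE : N ^+ 2 = defect / lam by rewrite sqr_sqrtr// divr_ge0// ltW.
have NN0 : 0 <= N by exact: sqrtr_ge0.
have DN : hessian_defect a h nu <= lam * N ^+ 2.
  by rewrite NE mulrC divfK ?gt_eqF.
have H1 := trace_sub_bform_le sa lam0 ell aM nu_sqr NN0 DN.
have H2 := hessian_entry_le sa lam0 ell aM sh nu_sqr NN0 DN.
rewrite -/tr in H1 H2.
have e2 : 0 <= eta ^+ 2 by exact: sqr_ge0.
have g2 : 0 <= g ^+ 2 by exact: sqr_ge0.
have hhle : hh <= flux_const * (N + `|tr|).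
  rewrite /hh /l1mx (le_trans (ler_sum _ (fun i _ => ler_sum _ (fun j _ => H2 i j))))//.
  rewrite sumr_const card_ord sumr_const card_ord /flux_const -/N_.
  rewrite le_eqVlt; apply/orP; left; apply/eqP.
  rewrite -[LHS]mulr_natl -/N_ -[X in _ * X]mulr_natl -/N_; ring.
(* the source term is nonnegative, so that the trace is almost nonpositive *)
have trle : `|tr| <= - tr + 2 * (N_ * g).
  move: source_ge0 bp_le; rewrite ler_norml => H /andP[B1 B2].
  by rewrite ler_norml; apply/andP; split; [|case: (lerP 0 tr) => ?]; lra.
have fsn : bform a s p = g * bform a nu s.
  rewrite (bform_sym s p sa) -[RHS]addr0 -[in RHS](mul0r (bform a nu s)) -bformDl.
  by congr bform; apply/funext => i; rewrite mul0r addr0 pE.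
have fep : `|bform a e p| <= M * N_ * (g * ee).
  rewrite (le_trans (norm_bform_le _ _ aM))//.
  rewrite (_ : M * N_ * _ = M * ee * (N_ * g)); last by ring.
  by rewrite ler_wpM2l// mulr_ge0.
have bap : `|\sum_j ba j * p j| <= N_ ^+ 2 * g.
  rewrite (le_trans (norm_dot_le _ ba_le))// expr2 -mulrA ler_wpM2l//.
have N20 : 0 <= N_ ^+ 2 by exact: sqr_ge0.
have MN0 : 0 <= M * N_ by exact: mulr_ge0.
pose X := g * hh * eta ^+ 2; pose Z := g * N * eta ^+ 2; pose V := g * `|tr| * eta ^+ 2.
have X0 : 0 <= X by apply: mulr_ge0 => //; apply: mulr_ge0 => //; exact: ltW.
have ge2 : 0 <= g * eta ^+ 2 by apply: mulr_ge0 => //; exact: ltW.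
have XZV : X <= flux_const * (Z + V).
  rewrite (_ : X = g * eta ^+ 2 * hh); last by rewrite /X; ring.
  rewrite (_ : flux_const * _ = g * eta ^+ 2 * (flux_const * (N + `|tr|))); last first.
    by rewrite /Z /V; ring.
  exact: ler_wpM2l.
(* [div_gradient] contains both [g * tr] and [bform a s p = g * bform a nu s],
   and the latter is [g * tr] up to a multiple of [g * N] *)
have ZV : V <= - div_gradient / 2 +
    ((N_ ^+ 2 + M * N_) / 2 + 2 * N_) * Y + N_ ^+ 2 * M / 2 * Z.
  have T1 : g * eta ^+ 2 * (bform a nu s - tr) <= N_ ^+ 2 * M * Z.
    rewrite (_ : N_ ^+ 2 * M * Z = g * eta ^+ 2 * (N_ * (N_ * (M * N)))); last first.
      by rewrite /Z; ring.
    by apply: ler_wpM2l => //; apply: le_trans H1; rewrite -normrN opprB ler_norm.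
  have T2 : g * eta ^+ 2 * (\sum_j ba j * p j) <= N_ ^+ 2 * Y.
    apply: (@le_trans _ _ (N_ ^+ 2 * (g ^+ 2 * eta ^+ 2))); last exact: ler_wpM2l.
    rewrite (_ : N_ ^+ 2 * _ = g * eta ^+ 2 * (N_ ^+ 2 * g)); last by ring.
    by apply: ler_wpM2l => //; rewrite (le_trans (ler_norm _)).
  have T3 : 2 * eta * (g * bform a e p) <= M * N_ * Y.
    apply: (@le_trans _ _ (M * N_ * (2 * (g ^+ 2 * (`|eta| * ee))))); last first.
      by apply: ler_wpM2l => //; rewrite mulrC -ler_pdivlMr.
    rewrite (le_trans (ler_norm _))// !normrM (gtr0_norm g0) (ger0_norm (ler0n _ 2)).
    apply: (@le_trans _ _ (2 * `|eta| * (g * (M * N_ * (g * ee))))).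
      by apply: ler_wpM2l; [exact: mulr_ge0|apply: ler_wpM2l => //; exact: ltW].
    by rewrite le_eqVlt; apply/orP; left; apply/eqP; ring.
  have T4 : V <= g * eta ^+ 2 * - tr + 2 * N_ * Y.
    apply: (@le_trans _ _ (g * eta ^+ 2 * (- tr + 2 * (N_ * g)))).
      rewrite (_ : V = g * eta ^+ 2 * `|tr|); last by rewrite /V; ring.
      exact: ler_wpM2l.
    rewrite mulrDr lerD2l (_ : g * _ * _ = 2 * N_ * (g ^+ 2 * eta ^+ 2)); last by ring.
    by apply: ler_wpM2l => //; exact: mulr_ge0.
  have dgE : div_gradient = g * eta ^+ 2 * bform a nu s + g * eta ^+ 2 * tr +
     g * eta ^+ 2 * (\sum_j ba j * p j) + 2 * eta * (g * bform a e p).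
    by rewrite /div_gradient /flux_div fsn -/tr; ring.
  rewrite dgE; move: T1 T2 T3 T4; rewrite mulrBr mulrN.
  move: (g * eta ^+ 2 * _) (g * eta ^+ 2 * _) (g * eta ^+ 2 * _) (2 * eta * _) => q1 q2 q3 q4.
  clear XZV; move: Y Z V => y z v; lra.
have dc0 : 0 < defect_const by exact: lt_le_trans defect_const_ge1.
(* Young's inequality, with weights for which [defect_ineq] returns exactly
   half of [X] *)
have EZ : entry_const * Z <= (2 * defect_const)^-1 * (eta ^+ 2 * defect) +
     entry_const ^+ 2 * defect_const / lam / 2 * Y.
  apply: (@le_trans _ _ ((2 * defect_const)^-1 * (eta ^+ 2 * defect) +
     entry_const ^+ 2 * defect_const / lam / 2 * (g ^+ 2 * eta ^+ 2))); last first.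
    rewrite lerD2l; apply: ler_wpM2l => //; apply: divr_ge0 => //.
    apply: divr_ge0; last exact: ltW.
    by apply: mulr_ge0; [exact: sqr_ge0|exact: ltW].
  have -> : defect = lam * N ^+ 2 by rewrite NE mulrC divfK ?gt_eqF.
  rewrite -subr_ge0 (_ : _ - _ = (2 * defect_const * lam)^-1 *
     (lam * (N * eta) - defect_const * (entry_const * (g * eta))) ^+ 2); last first.
    by rewrite /Z; field; rewrite !gt_eqF.
  apply: mulr_ge0; last exact: sqr_ge0.
  by rewrite invr_ge0; apply: mulr_ge0; [apply: mulr_ge0|]; rewrite ?(ltW dc0) ?(ltW lam0).
have EV : X <= entry_const * Z + entry_const * Y - flux_const / 2 * div_gradient.
  apply: (le_trans XZV).
  apply: (@le_trans _ _ (flux_const * (Z + (- div_gradient / 2 +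
    ((N_ ^+ 2 + M * N_) / 2 + 2 * N_) * Y + N_ ^+ 2 * M / 2 * Z)))).
    by apply: ler_wpM2l => //; rewrite lerD2l.
  have Z0 : 0 <= Z by apply: mulr_ge0 => //; apply: mulr_ge0 => //; exact: ltW.
  rewrite -subr_ge0 (_ : _ - _ = flux_const *
    ((1 + N_ ^+ 2 * M / 2) * Y + ((N_ ^+ 2 + M * N_) / 2 + 2 * N_) * Z)); last first.
    by rewrite /entry_const; field.
  have ? : 0 <= N_ ^+ 2 * M by exact: mulr_ge0.
  apply: mulr_ge0 => //; apply: addr_ge0; apply: mulr_ge0 => //.
    by apply: addr_ge0 => //; exact: divr_ge0.
  by apply: addr_ge0; [apply: divr_ge0 => //; exact: addr_ge0|exact: mulr_ge0].
have c0 : 0 <= (2 * defect_const)^-1.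
  by rewrite invr_ge0; apply: mulr_ge0 => //; exact: ltW.
have := ler_wpM2l c0 defect_ineq; rewrite -/X.
set W := div_energy + div_drift - div_log.
rewrite (_ : (2 * _)^-1 * (W + _ + _) = defect_const^-1 * W / 2 + (X + Y) / 2 +
   defect_const^-1 * (d2 * (`|F1| * eta ^+ 2)) / 2); last by field; rewrite gt_eqF.
have F0 : 0 <= d2 * (`|F1| * eta ^+ 2) by rewrite mulr_ge0// mulr_ge0.
have FF : defect_const^-1 * (d2 * (`|F1| * eta ^+ 2)) <= d2 * (`|F1| * eta ^+ 2).
  by rewrite ler_piMl// invf_le1.
have -> : energy_const * (g ^+ 2 * (eta ^+ 2 + ee ^+ 2)) =
    Y + entry_const ^+ 2 * defect_const / lam * Y + 2 * (entry_const * Y).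
  by rewrite /energy_const -/Y; ring.
move: EZ EV FF.
rewrite (_ : flux_const / 2 * div_gradient = flux_const * div_gradient / 2); last by field.
rewrite (_ : entry_const ^+ 2 * defect_const / lam / 2 * Y =
  entry_const ^+ 2 * defect_const / lam * Y / 2); last by field; rewrite gt_eqF.
move: (entry_const ^+ 2 * _ / _ * _) (_ * defect) (defect_const^-1 * W)
  (defect_const^-1 * _) (flux_const * _) (entry_const * Z) (entry_const * Y)
  => q1 q2 q3 q4 q5 q6 q7.
move: (d2 * _) F0 => q8 F0.
lra.
Qed.

End pointwise.

(** * C^1 functions and the divergence theorem on a ball *)

Section C1_functions.
Context {R : realType} {n : nat}.
Implicit Types (x : 'rV[R]_n) (f g : 'rV[R]_n -> R) (df dg : 'I_n -> 'rV[R]_n -> R).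

(** The derivatives are data rather than [pderiv] of the function: the formulas for
sums and products then come with the rules below, and nothing has to be
computed again. *)
Definition C1on f df : Prop :=
  [/\ forall i x, Ball 1 x -> is_derive x (ei i) f (df i x),
      {in Ball 1, continuous f} & forall i, {in Ball 1, continuous (df i)}].

Lemma C1_cst (c : R) : C1on (fun=> c) (fun _ _ => 0).
Proof.
by split=> [i x _|x _|i x _]; [exact: is_derive_fcst|exact: cts_cst|exact: cts_cst].
Qed.

Lemma C1_add f g df dg : C1on f df -> C1on g dg ->
  C1on (fun x => f x + g x) (fun i x => df i x + dg i x).
Proof.
move=> [f1 f2 f3] [g1 g2 g3]; split=> [i x x1|x x1|i x x1].
- by apply: is_derive_fadd; [exact: f1|exact: g1].
- by apply: ctsD; [exact: f2|exact: g2].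
- by apply: ctsD; [exact: f3|exact: g3].
Qed.

Lemma C1_mul f g df dg : C1on f df -> C1on g dg ->
  C1on (fun x => f x * g x) (fun i x => df i x * g x + f x * dg i x).
Proof.
move=> [f1 f2 f3] [g1 g2 g3]; split=> [i x x1|x x1|i x x1].
- by apply: is_derive_fmul; [exact: f1|exact: g1].
- by apply: ctsM; [exact: f2|exact: g2].
- apply: ctsD; apply: ctsM; [exact: f3|exact: g2|exact: f2|exact: g3].
Qed.

Lemma C1_sum (I : Type) (s : seq I) (f : I -> 'rV[R]_n -> R)
    (df : I -> 'I_n -> 'rV[R]_n -> R) : (forall k, C1on (f k) (df k)) ->
  C1on (fun x => \sum_(k <- s) f k x) (fun i x => \sum_(k <- s) df k i x).
Proof.
move=> fk; split=> [i x x1|x x1|i x x1].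
- by apply: is_derive_fsum => k; have [+ _ _] := fk k; exact.
- by apply: continuous_at_sum => k; have [_ + _] := fk k; exact.
- by apply: continuous_at_sum => k; have [_ _ +] := fk k; exact.
Qed.

Lemma C1_inv f df : (forall x, Ball 1 x -> f x != 0) -> C1on f df ->
  C1on (fun x => (f x)^-1) (fun i x => - df i x / f x ^+ 2).
Proof.
move=> fn0 [f1 f2 f3]; split=> [i x x1|x x1|i x x1].
- by apply: is_derive_finv; [exact: fn0|exact: f1].
- by apply: ctsV; [apply/fn0/set_mem|exact: f2].
- apply: ctsM; first exact/ctsN/f3.
  by apply: ctsV; [rewrite expf_neq0// fn0//; exact: set_mem|exact/cts_sqr/f2].
Qed.

Lemma C1_comp f df (h h' : R -> R) :
  (forall x, Ball 1 x -> is_derive (f x) 1 h (h' (f x))) ->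
  (forall x, Ball 1 x -> {for f x, continuous h'}) -> C1on f df ->
  C1on (fun x => h (f x)) (fun i x => h' (f x) * df i x).
Proof.
move=> dh ch [f1 f2 f3]; split=> [i x x1|x x1|i x x1].
- by apply: is_derive_comp1; [exact: dh|exact: f1].
- apply: cts_comp; last exact: f2.
  have [+ _] := dh x (set_mem x1).
  by move=> /derivable1_diffP; exact: differentiable_continuous.
- apply: ctsM; last exact: f3.
  by apply: cts_comp; [exact/ch/set_mem|exact: f2].
Qed.

End C1_functions.

Section divergence_theorem.
Context {R : realType} {n : nat}.
Implicit Types (x : 'rV[R]_n) (r : R).
Notation mu := (lebesgue_rV n).

Lemma outside_Ball_near0 (f : 'rV[R]_n -> R) r x : r < enorm x ->
  (forall y, ~ Ball r y -> f y = 0) -> \forall y \near x, f y = 0.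
Proof.
move=> rx f0; have : \forall y \near x, r < enorm y.
  apply: (open_nbhs_nbhs (A := [set y | r < enorm y])); split => //.
  apply: ((continuousP _).1 (@enorm_continuous R n) [set t | r < t]).
  exact: open_gt.
apply: filterS => y ry; apply: f0; rewrite /Ball /=; apply/negP.
by rewrite -leNgt ltW.
Qed.

(** Outside the unit ball the function vanishes near every point. *)
Lemma continuous_extend0 (f : 'rV[R]_n -> R) r : r < 1 ->
  {in Ball 1, continuous f} -> (forall y, ~ Ball r y -> f y = 0) -> continuous f.
Proof.
move=> r1 cf f0 x; have [x1|x1] := ltP (enorm x) 1; first by apply: cf; rewrite inE.
have near0 := outside_Ball_near0 (lt_le_trans r1 x1) f0.
rewrite /continuous_at (nbhs_singleton near0).
exact: (@cvg_near_cst _ _ _ _ (nbhs x) _ near0).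
Qed.

Section cutoff_fields.
Variables (X : 'I_n -> 'rV[R]_n -> R) (dX : 'I_n -> 'I_n -> 'rV[R]_n -> R).
Variables (eta : 'rV[R]_n -> R) (deta : 'I_n -> 'rV[R]_n -> R) (r : R).
Hypothesis r1 : r < 1.
Hypothesis XC : forall i, C1on (X i) (dX i).
Hypothesis etaC : C1on eta deta.

Let G i x := eta x ^+ 2 * dX i i x + 2 * eta x * (X i x * deta i x).

Let cG i : {in Ball 1, continuous (G i)}.
Proof.
move=> x x1; have [_ cX cdX] := XC i; have [_ ce cde] := etaC.
apply: ctsD; first by apply: ctsM; [exact/cts_sqr/ce|exact: cdX].
apply: ctsM; first by apply: ctsM; [exact: cts_cst|exact: ce].
by apply: ctsM; [exact: cX|exact: cde].
Qed.

Lemma divergence_integrable :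
  mu.-integrable (Ball r) (EFin \o (fun x => \sum_i G i x)).
Proof.
apply: (Ball_integrable r1) => x x1; apply: continuous_at_sum => i; exact: cG.
Qed.

(** The field with the factor [eta ^+ 2] vanishes outside the ball of radius [r] and
is C^1 on the whole space, to which [integral_derivative_eq0] applies. *)
Lemma divergence_cutoff : (forall x, ~ Ball r x -> eta x = 0) ->
  (\int[mu]_(x in Ball r) (\sum_i G i x)%:E = 0)%E.
Proof.
move=> eta0.
have G0 i x : ~ Ball r x -> G i x = 0.
  by move=> /eta0 e0; rewrite /G e0 expr0n !(mul0r, mulr0) addr0.
have zero i : (\int[mu]_(x in Ball r) (G i x)%:E = 0)%E.
  rewrite integral_mkcond; under eq_integral.
    move=> x _; rewrite (_ : _ x = (G i x)%:E); last first.
      by rewrite patchE; case: ifPn => // /negP xr; rewrite G0// => /mem_set.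
    over.
  pose V x := X i x * (eta x * eta x).
  have V0 x : ~ Ball r x -> V x = 0 by move=> /eta0 e0; rewrite /V e0 !mulr0.
  have [VD cV _] := C1_mul (XC i) (C1_mul etaC etaC).
  apply: (integral_derivative_eq0 (v := ei i) (F := V) (r := r)) => //.
  - exact: continuous_extend0 r1 cV V0.
  - exact: continuous_extend0 r1 (@cG i) (G0 i).
  - move=> x; have [x1|x1] := ltP (enorm x) 1.
      apply: is_derive_eq; first exact: VD.
      by rewrite /G; ring.
    have near0 := outside_Ball_near0 (lt_le_trans r1 x1) V0.
    rewrite G0; last by apply/negP; rewrite -leNgt (le_trans (ltW r1)).
    apply: (near_eq_is_derive _ (is_derive_fcst x (ei i) 0)).
    by apply: filterS near0 => y ->.
  - exact: G0.
under eq_integral do rewrite -sumEFin.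
rewrite integral_sum//=.
- by rewrite big1// => i _; exact: zero.
- exact: measurable_Ball.
- by move=> i; exact: Ball_integrable r1 (@cG i).
Qed.

End cutoff_fields.

End divergence_theorem.

(** * Symmetry of second derivatives *)

Section schwarz.
Context {R : realType} {n : nat}.
Implicit Types (x : 'rV[R]_n) (i j : 'I_n).

Lemma axis_MVT (f df : 'rV[R]_n -> R) i x (h : R) : 0 < h ->
  (forall t : R, 0 <= t <= h -> is_derive (x + t *: ei i) (ei i) f (df (x + t *: ei i))) ->
  exists2 c : R, 0 <= c <= h & f (x + h *: ei i) - f x = h * df (x + c *: ei i).
Proof.
move=> h0 fD.
have D (t : R) : 0 <= t <= h ->
    is_derive t 1 (fun t => f (x + t *: ei i)) (df (x + t *: ei i)).
  by move=> th; exact/is_derive_line/fD.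
have [t||c] := @MVT R (fun t => f (x + t *: ei i)) (fun t => df (x + t *: ei i)) 0 h h0.
- by rewrite in_itv /= => /andP[t0 th]; apply: D; rewrite !ltW.
- apply: continuous_in_subspaceT => t; rewrite inE /= in_itv /= => /D [+ _].
  by move=> /derivable1_diffP; exact: differentiable_continuous.
rewrite in_itv /= => /andP[c0 ch]; rewrite scale0r addr0 subr0 => E.
by exists c; [rewrite !ltW|rewrite E mulrC].
Qed.

Lemma axis_near x i j (c d h : R) : 0 <= c <= h -> 0 <= d <= h ->
  `|x - (x + c *: ei i + d *: ei j)| <= 2 * h.
Proof.
move=> /andP[c0 ch] /andP[d0 dh].
have e1 k : `|ei k : 'rV[R]_n| <= 1.
  rewrite [`|_|]/Num.Def.normr/= mx_normrE bigmax_le// => [[u v] _ /=].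
  by rewrite mxE; case: (_ && _); rewrite ?normr1 ?normr0.
rewrite -addrA opprD addrA subrr add0r normrN (le_trans (ler_normD _ _))//.
rewrite !normrZ (ger0_norm c0) (ger0_norm d0) mulr_natl mulr2n lerD//.
  by rewrite -[leRHS]mulr1 ler_pM.
by rewrite -[leRHS]mulr1 ler_pM.
Qed.

(** Two applications of the mean value theorem write the second difference of
    [f] over a small square as a value of either mixed derivative. *)
Lemma second_difference f (fi fji : 'rV[R]_n -> R) i j x (h : R) :
  0 < h -> enorm x + 2 * h < 1 ->
  (forall y, Ball 1 y -> is_derive y (ei i) f (fi y)) ->
  (forall y, Ball 1 y -> is_derive y (ei j) fi (fji y)) ->
  exists2 y, `|x - y| <= 2 * h & f (x + h *: ei i + h *: ei j) - f (x + h *: ei i) -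
    (f (x + h *: ei j) - f x) = h ^+ 2 * fji y.
Proof.
move=> h0 xh fD fiD.
have inB (k l : 'I_n) (c d : R) : 0 <= c <= h -> 0 <= d <= h ->
    Ball 1 (x + c *: ei k + d *: ei l).
  move=> /andP[c0 ch] /andP[d0 dh]; rewrite /Ball /=.
  apply: (le_lt_trans (enorm_axis_le _ _ _)); rewrite (ger0_norm d0).
  apply: (le_lt_trans (lerD (enorm_axis_le _ _ _) (lexx d))); rewrite (ger0_norm c0).
  apply: le_lt_trans xh; move: (enorm x) => e; lra.
have hh : 0 <= h <= h by rewrite lexx ltW.
have inB0 (k : 'I_n) (c : R) : 0 <= c <= h -> Ball 1 (x + c *: ei k).
  move=> ch; have := inB k k c 0 ch; rewrite scale0r addr0; apply.
  by rewrite lexx ltW.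
have [t th|c ch E] := @axis_MVT (fun y => f (y + h *: ei j) - f y)
  (fun y => fi (y + h *: ei j) - fi y) i x h h0.
  apply: is_derive_fsub; last exact/fD/inB0.
  have := fD _ (inB i j t h th hh).
  move=> [dF <-].
  have sh : (fun k : R => k^-1 *: (((fun y => f (y + h *: ei j)) \o shift (x + t *: ei i)) (k *: ei i) -
        f (x + t *: ei i + h *: ei j))) =
      (fun k : R => k^-1 *: ((f \o shift (x + t *: ei i + h *: ei j)) (k *: ei i) -
        f (x + t *: ei i + h *: ei j))).
    by apply/funext => k /=; rewrite !addrA.
  by apply: DeriveDef; [rewrite /derivable sh|rewrite /derive sh].
have [t th|d dh E2] := @axis_MVT fi fji j (x + c *: ei i) h h0.
  exact/fiD/inB.
exists (x + c *: ei i + d *: ei j); first exact: axis_near.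
by rewrite E E2 expr2 mulrA.
Qed.

(** The second difference is symmetric in [i] and [j], so that both mixed derivatives
take a common value at points arbitrarily close to [x]. *)
Lemma mixed_derivatives_eq f (fi fj fij fji : 'rV[R]_n -> R) i j x : Ball 1 x ->
  (forall y, Ball 1 y -> is_derive y (ei i) f (fi y)) ->
  (forall y, Ball 1 y -> is_derive y (ei j) f (fj y)) ->
  (forall y, Ball 1 y -> is_derive y (ei j) fi (fji y)) ->
  (forall y, Ball 1 y -> is_derive y (ei i) fj (fij y)) ->
  {for x, continuous fij} -> {for x, continuous fji} -> fij x = fji x.
Proof.
move=> x1 di dj dji dij cij cji.
apply/eqP; rewrite -subr_eq0 -normr_le0; apply/ler_addgt0Pl => e e0; rewrite addr0.
have e2 : 0 < e / 2 by rewrite divr_gt0.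
have /cvgrPdist_le/(_ _ e2)/nbhs_ballP[r1 /= r10 H1] := cij.
have /cvgrPdist_le/(_ _ e2)/nbhs_ballP[r2 /= r20 H2] := cji.
pose h := Num.min (Num.min (r1 / 4) (r2 / 4)) ((1 - enorm x) / 4).
have h0 : 0 < h.
  rewrite !lt_min !divr_gt0//; last by rewrite subr_gt0.
have [ha hb] : h <= r1 / 4 /\ h <= r2 / 4.
  by split; rewrite !ge_min lexx ?orbT.
have hc : h <= (1 - enorm x) / 4 by rewrite !ge_min lexx ?orbT.
clearbody h; have xh : enorm x + 2 * h < 1.
  by move: hc h0 x1; rewrite /Ball /=; move: (enorm x) => ?; lra.
have [y yx Ey] := second_difference h0 xh di dji.
have [z zx Ez] := second_difference h0 xh dj dij.
have E : fij z = fji y.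
  apply: (mulfI (_ : h ^+ 2 != 0)); first by rewrite expf_neq0 ?gt_eqF.
  by rewrite -Ey -Ez [x + _ + _]addrAC; ring.
rewrite (_ : fij x - fji x = (fij x - fij z) - (fji x - fji y)); last by rewrite E; ring.
rewrite (le_trans (ler_normB _ _))//.
rewrite [e in _ <= e](_ : e = e / 2 + e / 2); last by field.
rewrite lerD//.
- apply: H1; rewrite -ball_normE /=; apply: (le_lt_trans zx).
  lra.
- apply: H2; rewrite -ball_normE /=; apply: (le_lt_trans yx).
  lra.
Qed.

End schwarz.

(** * A C^1 cutoff function *)

Section cutoff.
Context {R : realType} {n : nat}.
Implicit Types (x : 'rV[R]_n) (r t : R).

(** The square makes the positive part of class C^1. *)
Definition pos_sqr t : R := Num.max t 0 ^+ 2.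

Lemma continuous_pos t : continuous_at t (fun t : R => Num.max t 0).
Proof. by apply: continuous_max; [exact: cvg_id|exact: cvg_cst]. Qed.

Lemma is_derive_pos_sqr t : is_derive t 1 pos_sqr (2 * Num.max t 0).
Proof.
have bound (h : R) : `|pos_sqr (h + t) - pos_sqr t - 2 * Num.max t 0 * h| <= h ^+ 2.
  rewrite /pos_sqr ler_norml; apply/andP.
  by case: (lerP 0 t) => t0; case: (lerP 0 (h + t)) => ht0;
    rewrite ?(max_l t0) ?(max_l ht0) ?(max_r (ltW t0)) ?(max_r (ltW ht0)); split; nra.
have lim_q : (fun h : R => h^-1 *: (pos_sqr (h *: 1 + t) - pos_sqr t)) @ 0^' -->
    2 * Num.max t 0.
  apply/cvgrPdist_le => e e0; near=> h.
  have h0 : h != 0 by near: h; exact: nbhs_dnbhs_neq.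
  rewrite [h%:A]mulr1 distrC.
  rewrite (_ : _ - _ = h^-1 * (pos_sqr (h + t) - pos_sqr t - 2 * Num.max t 0 * h)); last first.
    by rewrite /GRing.scale /=; field.
  rewrite normrM normfV ler_pdivrMl ?normr_gt0//.
  apply: (le_trans (bound h)); rewrite -(real_normK (num_real h)) expr2 ler_wpM2l//.
  by near: h; exact: dnbhs0_le.
by apply: DeriveDef; [apply/cvg_ex; exists (2 * Num.max t 0)|exact/cvg_lim].
Unshelve. all: by end_near. Qed.

Lemma is_derive_coord (i : 'I_n) x v : is_derive x v (fun y => y ord0 i) (v ord0 i).
Proof.
have lim_q : (fun h : R => h^-1 *: ((h *: v + x) ord0 i - x ord0 i)) @ 0^' --> v ord0 i.
  apply: cvg_near_cst; near=> h.
  have h0 : h != 0 by near: h; exact: nbhs_dnbhs_neq.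
  by rewrite !mxE addrK /GRing.scale /= mulKf.
by apply: DeriveDef; [apply/cvg_ex; exists (v ord0 i)|exact/cvg_lim].
Unshelve. all: by end_near. Qed.

Lemma C1_coord (j : 'I_n) :
  C1on (fun x : 'rV[R]_n => x ord0 j) (fun i _ => (i == j)%:R).
Proof.
split=> [i x _|x _|i x _].
- by apply: is_derive_eq; [exact: is_derive_coord|rewrite mxE eqxx eq_sym].
- exact: coord_continuous.
- exact: cts_cst.
Qed.

Definition cutoff r x : R := pos_sqr (r ^+ 2 - \sum_j x ord0 j * x ord0 j).
Definition dcutoff r (i : 'I_n) x : R :=
  2 * Num.max (r ^+ 2 - \sum_j x ord0 j * x ord0 j) 0 * (- (2 * x ord0 i)).

Lemma sum_coord_sqr x : \sum_j x ord0 j * x ord0 j = enorm x ^+ 2.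
Proof. by rewrite sqr_enorm; apply: eq_bigr => j _; rewrite expr2. Qed.

Lemma C1_cutoff r : C1on (cutoff r) (dcutoff r).
Proof.
have [a1 a2 a3] := @C1_add R n _ _ _ _ (C1_cst (r ^+ 2))
  (C1_mul (C1_cst (-1)) (C1_sum (index_enum 'I_n) (fun j => C1_mul (C1_coord j) (C1_coord j)))).
have inner : C1on (fun x : 'rV[R]_n => r ^+ 2 - \sum_j x ord0 j * x ord0 j)
    (fun i x => - (2 * x ord0 i)).
  have E : (fun x : 'rV[R]_n => r ^+ 2 - \sum_j x ord0 j * x ord0 j) =
      (fun x => r ^+ 2 + -1 * \sum_j x ord0 j * x ord0 j).
    by apply/funext => x; rewrite mulN1r.
  rewrite E; split=> [i x x1|x x1|i x x1].
  - apply: is_derive_eq; first exact: a1.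
    rewrite /= mul0r !add0r mulN1r (bigD1 i)//= eqxx mul1r mulr1 big1 ?addr0.
      by rewrite mulr_natl mulr2n.
    by move=> j ji; rewrite eq_sym (negbTE ji) mul0r mulr0 addr0.
  - exact: a2.
  - by apply/ctsN/ctsM; [exact: cts_cst|exact: coord_continuous].
apply: (C1_comp (h := pos_sqr) (h' := fun t => 2 * Num.max t 0)) inner.
- by move=> x _; exact: is_derive_pos_sqr.
- by move=> x _; apply: ctsM; [exact: cts_cst|exact: continuous_pos].
Qed.

Lemma cutoff_out r x : 0 <= r -> ~ Ball r x -> cutoff r x = 0.
Proof.
move=> r0 /negP; rewrite -leNgt => rx.
rewrite /cutoff sum_coord_sqr /pos_sqr max_r ?expr0n// subr_le0.
by rewrite ler_pXn2r ?nnegrE ?enorm_ge0.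
Qed.

Lemma cutoff_le1 r x : 0 <= r <= 1 -> 0 <= cutoff r x <= 1.
Proof.
move=> /andP[r0 r1]; rewrite /cutoff /pos_sqr sqr_ge0 /= sum_coord_sqr.
rewrite expr_le1// ?le_max ?lexx ?orbT// ge_max ler01 andbT.
rewrite lerBlDr (le_trans (_ : _ <= 1)) ?lerDl ?sqr_ge0//.
by rewrite expr_le1.
Qed.

Lemma dcutoff_le r i x : 0 <= r <= 1 -> Ball r x -> `|dcutoff r i x| <= 4.
Proof.
move=> /andP[r0 r1] xr; rewrite /dcutoff !normrM normrN !normrM.
have m : `|Num.max (r ^+ 2 - \sum_j x ord0 j * x ord0 j) 0| <= 1.
  rewrite ger0_norm ?le_max ?lexx ?orbT// ge_max ler01 andbT sum_coord_sqr.
  rewrite lerBlDr (le_trans (_ : _ <= 1)) ?lerDl ?sqr_ge0//.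
  by rewrite expr_le1.
have c : `|x ord0 i| <= 1.
  by rewrite (le_trans (coord_le_enorm _ _))// (le_trans (ltW xr)).
rewrite !(ger0_norm (ler0n R 2)).
move: m c; have := normr_ge0 (x ord0 i).
have := normr_ge0 (Num.max (r ^+ 2 - \sum_j x ord0 j * x ord0 j) 0).
move: `|Num.max _ _| `|x _ _| => p q; nra.
Qed.

(** As [r ^+ 2 - s ^+ 2 = (r - s) * (r + s)], the condition [1 <= s + r] gives a
bound by a power of [r - s] alone. *)
Lemma cutoff_ge r s x : 0 <= s -> s < r -> 1 <= s + r -> Ball s x ->
  (r - s) ^+ 2 <= cutoff r x.
Proof.
move=> s0 sr sr1 xs; have x0 := enorm_ge0 x.
rewrite /cutoff /pos_sqr sum_coord_sqr max_l; last first.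
  rewrite subr_ge0 ler_pXn2r ?nnegrE//; last by rewrite (le_trans s0)// ltW.
  by rewrite ltW// (lt_trans xs).
rewrite (@ler_pXn2r _ 2) ?nnegrE //; last 2 first.
- by rewrite subr_ge0 ltW.
- rewrite subr_ge0 ler_pXn2r ?nnegrE//; last by rewrite (le_trans s0)// ltW.
  by rewrite ltW// (lt_trans xs).
move: xs x0; rewrite /Ball /=; move: (enorm x) => e xs x0; nra.
Qed.

End cutoff.

(** * Divergence of a flux *)

Section flux.
Context {R : realType} {n : nat}.
Implicit Types (x : 'rV[R]_n).

Lemma C1_flux (m : 'rV[R]_n -> R) dm (a : 'I_n -> 'I_n -> 'rV[R]_n -> R) da
    (w : 'I_n -> 'rV[R]_n -> R) dw (i : 'I_n) :
  C1on m dm -> (forall i j, C1on (a i j) (fun k => da k i j)) ->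
  (forall j, C1on (w j) (fun k => dw k j)) ->
  C1on (fun x => m x * \sum_j a i j x * w j x)
    (fun k x => dm k x * (\sum_j a i j x * w j x) +
      m x * (\sum_j (da k i j x * w j x + a i j x * dw k j x))).
Proof.
move=> mC aC wC; apply: (C1_mul mC).
exact: (C1_sum _ (fun j => C1_mul (aC i j) (wC j))).
Qed.

(** The left-hand side is what the product rule yields for the flux, with the
derivatives as they are given by [C1_flux]. *)
Lemma flux_divE (a : 'I_n -> 'I_n -> R) (da : 'I_n -> 'I_n -> 'I_n -> R) (m : R)
    (dm w e : 'I_n -> R) (dw : 'I_n -> 'I_n -> R) (eta : R) :
  \sum_i (eta ^+ 2 * (dm i * (\sum_j a i j * w j) +
       m * (\sum_j (da i i j * w j + a i j * dw i j))) +
     2 * eta * (m * (\sum_j a i j * w j) * e i)) =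
  flux_div a da eta e m dm w (\sum_i \sum_j a i j * dw i j).
Proof.
have bE (v : 'I_n -> R) : bform a v w = \sum_i v i * \sum_j a i j * w j.
  apply: eq_bigr => i _; rewrite mulr_sumr; apply: eq_bigr => j _; ring.
have baE : \sum_j (\sum_i da i i j) * w j = \sum_i \sum_j da i i j * w j.
  by rewrite exchange_big; apply: eq_bigr => j _; rewrite mulr_suml.
rewrite /flux_div !bE baE big_split /= -!mulr_sumr big_split /= -!mulr_sumr.
rewrite -big_split /=; congr (_ * (_ + _ * _) + _).
  by apply: eq_bigr => i _; rewrite big_split.
congr (_ * _); rewrite mulr_sumr; apply: eq_bigr => i _; ring.
Qed.

(** The trace of [A *m D w] for the field w = sum over l of u_l grad u_l. *)
Lemma trace_gradient_square (a h : 'I_n -> 'I_n -> R) (p : 'I_n -> R)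
    (t : 'I_n -> 'I_n -> 'I_n -> R) :
  \sum_i \sum_j a i j * (\sum_l (h l i * h l j + p l * t l i j)) =
  \sum_l bform a (h l) (h l) + \sum_l p l * \sum_i \sum_j a i j * t l i j.
Proof.
transitivity (\sum_i \sum_j \sum_l (a i j * h l i * h l j + p l * (a i j * t l i j))).
  apply: eq_bigr => i _; apply: eq_bigr => j _; rewrite mulr_sumr.
  by apply: eq_bigr => l _; ring.
under eq_bigr do rewrite exchange_big /=.
rewrite exchange_big /= -big_split; apply: eq_bigr => l _ /=.
rewrite mulr_sumr -big_split /=; apply: eq_bigr => i _.
by rewrite mulr_sumr -big_split.
Qed.

Lemma C1_combination (f1 f2 f3 f4 : 'rV[R]_n -> R) d1 d2 d3 d4 (c d : R) :
  C1on f1 d1 -> C1on f2 d2 -> C1on f3 d3 -> C1on f4 d4 ->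
  C1on (fun x => c * (f1 x + f2 x - f3 x) - d * f4 x)
    (fun i x => c * (d1 i x + d2 i x - d3 i x) - d * d4 i x).
Proof.
move=> [a1 a2 a3] [b1 b2 b3] [c1 c2 c3] [e1 e2 e3]; split=> [i x x1|x x1|i x x1].
- have H := is_derive_fsub
    (is_derive_fmul (is_derive_fcst x (ei i) c)
      (is_derive_fsub (is_derive_fadd (a1 i x x1) (b1 i x x1)) (c1 i x x1)))
    (is_derive_fmul (is_derive_fcst x (ei i) d) (e1 i x x1)).
  by apply: is_derive_eq; ring.
- apply: ctsB; apply: ctsM; [exact: cts_cst| |exact: cts_cst|exact: e2].
  by apply: ctsB; [apply: ctsD; [exact: a2|exact: b2]|exact: c2].
- apply: ctsB; apply: ctsM; [exact: cts_cst| |exact: cts_cst|exact: e3].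
  by apply: ctsB; [apply: ctsD; [exact: a3|exact: b3]|exact: c3].
Qed.

End flux.

(** * Smooth functions and coefficients *)

Section smooth.
Context {R : realType} {n : nat}.
Implicit Types (x : 'rV[R]_n) (w : 'rV[R]_n -> R) (s : seq 'I_n).

Lemma Ck_C1 k w s : Ck k (Ball 1) w -> (size s < k)%N ->
  C1on (pderivs s w) (fun i => pderivs (i :: s) w).
Proof.
move=> [dw cw] sk.
have cts t : (size t <= k)%N -> {in Ball 1, continuous (pderivs t w)}.
  by move=> tk; rewrite -continuous_open_subspace; [exact: cw|exact: open_Ball].
split=> [i x x1||i]; [|exact/cts/ltnW|exact: cts].
by apply: DeriveDef => //; exact: dw.
Qed.

Lemma smooth_C1 w s : smooth_cBall w -> C1on (pderivs s w) (fun i => pderivs (i :: s) w).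
Proof. by move=> [wC _ _]; apply: (Ck_C1 (wC (size s).+1)). Qed.

Lemma smooth_mixed w s i j x : smooth_cBall w -> Ball 1 x ->
  pderivs [:: i, j & s] w x = pderivs [:: j, i & s] w x.
Proof.
move=> wC x1; have C t := smooth_C1 t wC.
have [d0 _ _] := C s; have [di _ ci] := C (i :: s); have [dj _ cj] := C (j :: s).
apply: (@mixed_derivatives_eq _ _ (pderivs s w) (pderivs (i :: s) w) (pderivs (j :: s) w)
  _ _ i j x x1 (d0 i) (d0 j) (di j) (dj i)).
- by apply: cj; rewrite inE.
- by apply: ci; rewrite inE.
Qed.

Lemma cextE (g : 'rV[R]_n -> R) x : Ball 1 x -> {for x, continuous g} ->
  cext g x = g x.
Proof.
move=> x1 cg; rewrite /cext.
have -> : within (Ball 1) (nbhs x) = nbhs x.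
  apply/seteqP; split=> P; rewrite /within /=; last by apply: filterS.
  by apply: filterS2 (Ball_nbhs x1) => y ? /(_ _); exact.
exact: cvg_lim.
Qed.

End smooth.

Section coefficients.
Context {R : realType} {n : nat}.
Variables (A : 'rV[R]_n -> 'M[R]_n) (b : 'rV[R]_n -> 'rV[R]_n) (lam Lam : R).
Hypothesis symA : forall x, cBall 1 x -> (A x)^T = A x.
Hypothesis ellA : elliptic lam Lam A.

Lemma A_sym x i j : Ball 1 x -> A x i j = A x j i.
Proof. by move=> x1; have /symA E : cBall 1 x := ltW x1; rewrite -{1}E mxE. Qed.

(** Homogeneity extends the bounds from unit vectors to all vectors. *)
Lemma bform_bounds x (v : 'I_n -> R) : Ball 1 x ->
  lam * (\sum_i v i ^+ 2) <= bform (fun i j => A x i j) v v <= Lam * (\sum_i v i ^+ 2).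
Proof.
move=> x1; have [l0 el] := ellA.
pose p : 'rV[R]_n := \row_i v i.
have nE : \sum_i v i ^+ 2 = enorm p ^+ 2.
  by rewrite sqr_enorm; apply: eq_bigr => i _; rewrite mxE.
have [p0|p0] := eqVneq (enorm p) 0.
  have v0 i : v i = 0.
    by have := coord_le_enorm p i; rewrite p0 normr_le0 mxE => /eqP.
  rewrite nE p0 expr0n !mulr0 /bform big1 ?lexx// => i _.
  by rewrite big1// => j _; rewrite !v0 !mulr0.
have p_gt0 : 0 < enorm p by rewrite lt_neqAle eq_sym p0 enorm_ge0.
have e1 : enorm ((enorm p)^-1 *: p) = 1.
  rewrite {1}/enorm (_ : \sum_i _ = 1) ?sqrtr1//.
  rewrite (eq_bigr (fun i => (enorm p)^-1 ^+ 2 * v i ^+ 2)); last first.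
    by move=> i _; rewrite !mxE exprMn.
  by rewrite -mulr_sumr nE -exprMn mulVf// expr1n.
have := el x _ x1 e1.
have -> : \sum_i \sum_j A x i j * ((enorm p)^-1 *: p) ord0 i * ((enorm p)^-1 *: p) ord0 j =
    bform (fun i j => A x i j) v v / enorm p ^+ 2.
  rewrite /bform mulr_suml; apply: eq_bigr => i _; rewrite mulr_suml; apply: eq_bigr => j _.
  by rewrite !mxE; field.
by rewrite ler_pdivlMr ?exprn_gt0// ler_pdivrMr ?exprn_gt0// nE.
Qed.

(** Polarization: the quadratic form is tested on the basis vectors and on the sums
and differences of two of them. *)
Lemma A_entry_le x i j : Ball 1 x -> `|A x i j| <= `|Lam|.
Proof.
move=> x1; have [l0 _] := ellA.
pose d (k : 'I_n) (l : 'I_n) : R := (l == k)%:R.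
have sd k : \sum_l d k l ^+ 2 = 1.
  rewrite (bigD1 k)//= big1 ?addr0; first by rewrite /d eqxx expr1n.
  by move=> l lk; rewrite /d (negbTE lk) expr0n.
have fd k l : bform (fun i j => A x i j) (d k) (d l) = A x k l.
  rewrite /bform (bigD1 k)//= [X in _ + X]big1 ?addr0; last first.
    by move=> a ak; rewrite big1// => c _; rewrite /d (negbTE ak) mulr0 mul0r.
  rewrite (bigD1 l)//= big1 ?addr0; first by rewrite /d !eqxx !mulr1.
  by move=> c cl; rewrite /d (negbTE cl) mulr0.
have sa a c : A x a c = A x c a by exact: A_sym.
have ineq (c : R) : c ^+ 2 = 1 ->
    A x i i + 2 * c * A x i j + A x j j <= Lam * 2 + 2 * c * Lam * (\sum_l d i l * d j l).
  move=> c2; have /andP[_] := bform_bounds (fun l => 1 * d i l + c * d j l) x1.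
  rewrite (bform_combination (a := fun i j => A x i j) _ _ _ _ sa) !fd c2 expr1n !mul1r.
  move=> H; apply: (le_trans H); rewrite le_eqVlt; apply/orP; left; apply/eqP.
  rewrite (eq_bigr (fun l => d i l ^+ 2 + (2 * c * (d i l * d j l) + c ^+ 2 * d j l ^+ 2))).
    by rewrite !big_split /= -!mulr_sumr !sd c2; ring.
  by move=> l _; ring.
have Aii k : 0 < A x k k <= Lam.
  have := bform_bounds (d k) x1; rewrite sd fd !mulr1 => /andP[lo ->].
  by rewrite (lt_le_trans l0 lo).
have [/eqP ij|ij] := boolP (i == j).
  have /andP[h1 h2] := Aii j.
  by rewrite ij (ger0_norm (ltW h1)) (le_trans h2)// ler_norm.
have dd : \sum_l d i l * d j l = 0.
  rewrite big1// => l _; rewrite /d; case: eqVneq => [->|]; last by rewrite mul0r.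
  by rewrite (negbTE ij) mulr0.
have := ineq 1 (expr1n _ _); have := ineq (-1) (etrans (sqrrN 1) (expr1n _ 2)).
rewrite dd !mulr0 !addr0; have /andP[+ _] := Aii i; have /andP[+ _] := Aii j.
move: (A x i i) (A x j j) (A x i j) => p q r q0 p0 H1 H2.
rewrite ler_norml; apply/andP; split; last first.
  by apply: le_trans (ler_norm _); lra.
by rewrite lerNl; apply: le_trans (ler_norm _); lra.
Qed.

Hypothesis hA : forall i j, smooth_cBall (fun x => A x i j).
Hypothesis small : (C0norm (norm_DA A) + C0norm (fun x => enorm (b x)) <= 1)%E.

Let C0norm_ge (g : 'rV[R]_n -> R) x : Ball 1 x -> (`|g x|%:E <= C0norm g)%E.
Proof. by move=> x1; apply: ereal_sup_ubound; exists x => //; exact: ltW. Qed.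

Lemma b_le1 x i : Ball 1 x -> `|b x ord0 i| <= 1.
Proof.
move=> x1; rewrite -lee_fin (le_trans _ small)//.
rewrite -[leLHS]add0e leeD//; first by rewrite (le_trans _ (C0norm_ge _ x1)).
rewrite (le_trans _ (C0norm_ge _ x1))// lee_fin.
by rewrite (le_trans (coord_le_enorm _ _))// ler_norm.
Qed.

Lemma dA_le1 x k i j : Ball 1 x -> `|pderiv k (fun y => A y i j) x| <= 1.
Proof.
move=> x1; rewrite -lee_fin (le_trans _ small)//.
rewrite -[leLHS]adde0 leeD//; last by rewrite (le_trans _ (C0norm_ge _ x1)).
rewrite (le_trans _ (C0norm_ge _ x1))// lee_fin.
rewrite [leRHS]ger0_norm ?sqrtr_ge0// /norm_DA.
have E : pderiv k (fun y => A y i j) x = cext (pderiv k (fun y => A y i j)) x.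
  rewrite cextE//; have [_ _ c] := smooth_C1 [::] (hA i j).
  by apply: (c k); rewrite inE.
rewrite {}E -sqrtr_sqr ler_wsqrtr//.
rewrite (bigD1 i)//= ler_wpDr ?sumr_ge0//.
  by move=> a _; apply: sumr_ge0 => c _; apply: sumr_ge0 => e _; exact: sqr_ge0.
rewrite (bigD1 j)//= ler_wpDr ?sumr_ge0//.
  by move=> a _; apply: sumr_ge0 => c _; exact: sqr_ge0.
by rewrite (bigD1 k)//= lerDl sumr_ge0// => a _; exact: sqr_ge0.
Qed.

End coefficients.

(** * The energy estimate *)

Section energy_estimate.
Context {R : realType} {n : nat}.
Implicit Types (x : 'rV[R]_n) (i j k l : 'I_n).
Notation mu := (lebesgue_rV n).

Variables (a : 'I_n -> 'I_n -> 'rV[R]_n -> R) (da : 'I_n -> 'I_n -> 'I_n -> 'rV[R]_n -> R).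
Variables (bc : 'I_n -> 'rV[R]_n -> R) (db : 'I_n -> 'I_n -> 'rV[R]_n -> R).
Variables (u : 'rV[R]_n -> R) (p : 'I_n -> 'rV[R]_n -> R).
Variables (h : 'I_n -> 'I_n -> 'rV[R]_n -> R) (t : 'I_n -> 'I_n -> 'I_n -> 'rV[R]_n -> R).
Variables (phi : 'rV[R]_n -> R) (dphi : 'I_n -> 'rV[R]_n -> R).
Variable ddphi : 'I_n -> 'I_n -> 'rV[R]_n -> R.
Variables (f f' : R -> R) (lam M : R).

Hypothesis aC : forall i j, C1on (a i j) (fun k => da k i j).
Hypothesis bC : forall i, C1on (bc i) (fun k => db k i).
Hypothesis uC : C1on u p.
Hypothesis pC : forall i, C1on (p i) (fun k => h k i).
Hypothesis hC : forall i j, C1on (h i j) (fun k => t k i j).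
Hypothesis phC : C1on phi dphi.
Hypothesis dphC : forall j, C1on (dphi j) (fun i => ddphi i j).
Hypothesis h_sym : forall i j x, Ball 1 x -> h i j x = h j i x.
Hypothesis t_sym : forall i j l x, Ball 1 x -> t i j l x = t j i l x.
Hypothesis f_derive : forall s : R, is_derive s 1 f (f' s).
Hypothesis f'_continuous : continuous f'.
Hypothesis f_ge0 : forall s, 0 <= f s.

Hypothesis lam0 : 0 < lam.
Hypothesis M0 : 0 <= M.
Hypothesis a_sym : forall i j x, Ball 1 x -> a i j x = a j i x.
Hypothesis a_elliptic : forall x (v : 'I_n -> R), Ball 1 x ->
  lam * (\sum_i v i ^+ 2) <= bform (fun i j => a i j x) v v.
Hypothesis a_le : forall i j x, Ball 1 x -> `|a i j x| <= M.
Hypothesis da_le1 : forall k i j x, Ball 1 x -> `|da k i j x| <= 1.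
Hypothesis b_le1 : forall i x, Ball 1 x -> `|bc i x| <= 1.

Hypothesis equation : forall x, Ball 1 x ->
  - (\sum_i \sum_j a i j x * h i j x + \sum_i bc i x * p i x) = f (u x).
Hypothesis phi_super : forall x, Ball 1 x -> f' (u x) * phi x <=
  - (\sum_i \sum_j a i j x * ddphi i j x + \sum_i bc i x * dphi i x).
Hypothesis phi_gt0 : forall x, Ball 1 x -> 0 < phi x.

Let at_ k x := \sum_i \sum_j a i j x * t k i j x.

(** The derivative of the equation in the direction [k]. *)
Lemma linearized_equation x k : Ball 1 x ->
  f' (u x) * p k x =
  - (\sum_i \sum_j da k i j x * h i j x + at_ k x) -
  \sum_i (db k i x * p i x + bc i x * h k i x).
Proof.
move=> x1.
have [LD _ _] := C1_add
  (C1_sum (index_enum 'I_n) (fun i => C1_sum (index_enum 'I_n) (fun j => C1_mul (aC i j) (hC i j))))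
  (C1_sum (index_enum 'I_n) (fun i => C1_mul (bC i) (pC i))).
have [uD _ _] := uC.
have fuD := is_derive_comp1 (f_derive (u x)) (uD k x x1).
have near_eq : \forall y \near x,
      - (\sum_i \sum_j a i j y * h i j y + \sum_i bc i y * p i y) = f (u y).
  by apply: filterS (Ball_nbhs x1) => y y1; exact: equation.
have LopD := near_eq_is_derive near_eq (is_derive_fopp (LD k x x1)).
have [_ <-] := fuD; have [_ ->] := LopD.
rewrite opprD; congr (- _ - _); rewrite -big_split; apply: eq_bigr => i _ /=.
by rewrite -big_split.
Qed.

(** The factor [1 + (4 * n%:R) ^+ 2] bounds [eta ^+ 2 + l1 (grad eta) ^+ 2] for
the cutoff, whose partial derivatives are at most 4. *)
Definition absorption_const := energy_const (n := n) lam M * (1 + (4 * n%:R) ^+ 2).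

Lemma absorption_const_ge0 : 0 <= absorption_const.
Proof.
apply: mulr_ge0; first exact: energy_const_ge0.
by apply: addr_ge0 => //; exact: sqr_ge0.
Qed.
Section regularized.
Variable d2 : R.
Hypothesis d2_gt0 : 0 < d2.

(* [g] replaces the norm of the gradient, which need not be differentiable where
   the gradient vanishes; its derivatives are the [s x i] *)
Let q x := \sum_l p l x * p l x + d2.
Let dq i x := \sum_l (h i l x * p l x + p l x * h i l x) + 0.
Let g x := Num.sqrt (q x).

Let qC : C1on q dq.
Proof.
exact: (C1_add (C1_sum (index_enum 'I_n) (fun l => C1_mul (pC l) (pC l))) (C1_cst d2)).
Qed.

Let q_gt0 x : 0 < q x.
Proof. by rewrite ltr_wpDl// sumr_ge0// => l _; rewrite -expr2 sqr_ge0. Qed.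

Let g_gt0 x : 0 < g x.
Proof. by rewrite sqrtr_gt0. Qed.

Let g2E x : g x ^+ 2 = q x.
Proof. by rewrite sqr_sqrtr// ltW. Qed.

Let gC : C1on g (fun i x => (2 * Num.sqrt (q x))^-1 * dq i x).
Proof.
apply: (C1_comp (h := Num.sqrt) (h' := fun t => (2 * Num.sqrt t)^-1)) qC.
- by move=> x _; exact: is_derive1_sqrt.
- move=> x _; apply: ctsV; first by rewrite mulf_neq0// gt_eqF// g_gt0.
  by apply: ctsM; [exact: cts_cst|exact: sqrt_continuous].
Qed.

Let s x j := \sum_l p l x / g x * h l j x.

Let dqE i x : Ball 1 x -> dq i x = 2 * (g x * s x i).
Proof.
move=> x1; rewrite /dq addr0 /s !mulr_sumr; apply: eq_bigr => l _.
by rewrite (h_sym i l x1); field; rewrite gt_eqF// g_gt0.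
Qed.

Let dgE i x : Ball 1 x -> (2 * Num.sqrt (q x))^-1 * dq i x = s x i.
Proof. by move=> x1; rewrite dqE// -/(g x); field; rewrite gt_eqF// g_gt0. Qed.

Let w2 j x := \sum_l p l x * h l j x.
Let dw2 k j x := \sum_l (h k l x * h l j x + p l x * t k l j x).

Let w2C j : C1on (w2 j) (fun k => dw2 k j).
Proof. exact: (C1_sum (index_enum 'I_n) (fun l => C1_mul (pC l) (hC l j))). Qed.

Let w2E j x : w2 j x = g x * s x j.
Proof.
rewrite /s mulr_sumr; apply: eq_bigr => l _.
by field; rewrite gt_eqF// g_gt0.
Qed.

(* The four fields whose divergences, after multiplication by [eta ^+ 2], are
   [div_log], [div_energy], [div_drift] and [div_gradient] *)
Let m1 x := q x * (phi x)^-1.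
Let dm1 k x := dq k x * (phi x)^-1 + q x * (- dphi k x / phi x ^+ 2).
Let dg k x := (2 * Num.sqrt (q x))^-1 * dq k x.

Let m1C : C1on m1 dm1.
Proof. by apply: (C1_mul qC); apply: C1_inv phC => x x1; rewrite gt_eqF// phi_gt0. Qed.

Let X1 i x := m1 x * \sum_j a i j x * dphi j x.
Let dX1 i k x := dm1 k x * (\sum_j a i j x * dphi j x) +
  m1 x * (\sum_j (da k i j x * dphi j x + a i j x * ddphi k j x)).
Let X2 i x := 1 * \sum_j a i j x * w2 j x.
Let dX2 i k x := 0 * (\sum_j a i j x * w2 j x) +
  1 * (\sum_j (da k i j x * w2 j x + a i j x * dw2 k j x)).
Let X3 i x := p i x * \sum_j bc j x * p j x.
Let dX3 i k x := h k i x * (\sum_j bc j x * p j x) +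
  p i x * (\sum_j (db k j x * p j x + bc j x * h k j x)).
Let X4 i x := g x * \sum_j a i j x * p j x.
Let dX4 i k x := dg k x * (\sum_j a i j x * p j x) +
  g x * (\sum_j (da k i j x * p j x + a i j x * h k j x)).

Let X1C i : C1on (X1 i) (dX1 i). Proof. exact: C1_flux m1C aC dphC. Qed.
Let X2C i : C1on (X2 i) (dX2 i). Proof. exact: C1_flux (C1_cst 1) aC w2C. Qed.
Let X3C i : C1on (X3 i) (dX3 i).
Proof.
exact: C1_mul (pC i) (C1_sum (index_enum 'I_n) (fun j => C1_mul (bC j) (pC j))).
Qed.
Let X4C i : C1on (X4 i) (dX4 i). Proof. exact: C1_flux gC aC pC. Qed.

Let c1 := (defect_const (n := n) lam M)^-1.
Let c2 := flux_const (n := n) lam M.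

Let X i x := c1 * (X2 i x + X3 i x - X1 i x) - c2 * X4 i x.
Let dX i k x := c1 * (dX2 i k x + dX3 i k x - dX1 i k x) - c2 * dX4 i k x.

Let XC i : C1on (X i) (dX i). Proof. exact: C1_combination. Qed.

Let av x i j := a i j x.
Let dav x k i j := da k i j x.
Let bv x i := bc i x.
Let dbv x k i := db k i x.
Let pv x i := p i x.
Let hv x i j := h i j x.
Let atv x k := at_ k x.
Let dpv x i := dphi i x.
Let aphi x := \sum_i \sum_j a i j x * ddphi i j x.

Let flux_energyE x eta (e : 'I_n -> R) : Ball 1 x ->
  \sum_i (eta ^+ 2 * dX2 i i x + 2 * eta * (X2 i x * e i)) =
  div_energy (av x) (dav x) (pv x) (hv x) (atv x) (g x) eta e.
Proof.
move=> x1; rewrite /dX2 /X2.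
rewrite (flux_divE (av x) (dav x) 1 (fun=> 0) (w2^~ x) e (fun k j => dw2 k j x) eta).
rewrite /div_energy; congr flux_div.
  by apply/funext => j; exact: w2E.
rewrite -(trace_gradient_square (av x) (hv x) (pv x) (fun l i j => t l i j x)).
apply: eq_bigr => i _; apply: eq_bigr => j _; congr (_ * _); apply: eq_bigr => l _.
by rewrite (h_sym i l x1) (t_sym i l j x1).
Qed.

Let flux_driftE x eta (e : 'I_n -> R) :
  \sum_i (eta ^+ 2 * dX3 i i x + 2 * eta * (X3 i x * e i)) =
  div_drift (bv x) (dbv x) (pv x) (hv x) eta e.
Proof. by []. Qed.

Let flux_logE x eta (e : 'I_n -> R) : Ball 1 x ->
  \sum_i (eta ^+ 2 * dX1 i i x + 2 * eta * (X1 i x * e i)) =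
  div_log (av x) (dav x) (pv x) (hv x) (g x) (phi x) (dpv x) (aphi x) eta e.
Proof.
move=> x1; rewrite /dX1 /X1.
rewrite (flux_divE (av x) (dav x) (m1 x) (dm1^~ x) (dpv x) e
  (fun i j => ddphi i j x) eta).
rewrite /div_log; congr flux_div; first by rewrite /m1 g2E.
apply/funext => i; rewrite /dm1 dqE// g2E (_ : \sum_l _ = s x i)// /dpv.
by field; rewrite gt_eqF// phi_gt0.
Qed.

Let flux_gradientE x eta (e : 'I_n -> R) : Ball 1 x ->
  \sum_i (eta ^+ 2 * dX4 i i x + 2 * eta * (X4 i x * e i)) =
  div_gradient (av x) (dav x) (pv x) (hv x) (g x) eta e.
Proof.
move=> x1; rewrite /dX4 /X4.
rewrite (flux_divE (av x) (dav x) (g x) (dg^~ x) (pv x) e (hv x) eta).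
rewrite /div_gradient; congr flux_div.
by apply/funext => i; exact: dgE.
Qed.

Let hh x := l1mx (hv x).

Lemma pointwise_energy_at x eta (e : 'I_n -> R) : Ball 1 x ->
  g x * hh x * eta ^+ 2 <=
  energy_const (n := n) lam M * (g x ^+ 2 * (eta ^+ 2 + l1 e ^+ 2)) +
  d2 * (`|f' (u x)| * eta ^+ 2) +
  \sum_i (eta ^+ 2 * dX i i x + 2 * eta * (X i x * e i)).
Proof.
move=> x1; have -> : \sum_i (eta ^+ 2 * dX i i x + 2 * eta * (X i x * e i)) =
    c1 * (div_energy (av x) (dav x) (pv x) (hv x) (atv x) (g x) eta e +
      div_drift (bv x) (dbv x) (pv x) (hv x) eta e -
      div_log (av x) (dav x) (pv x) (hv x) (g x) (phi x) (dpv x) (aphi x) eta e) -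
    c2 * div_gradient (av x) (dav x) (pv x) (hv x) (g x) eta e.
  rewrite -flux_energyE// -flux_driftE -flux_logE// -flux_gradientE//.
  rewrite -big_split -sumrB !mulr_sumr -sumrB /=; apply: eq_bigr => i _.
  by rewrite /dX /X; ring.
rewrite addrA; apply: pointwise_energy => //.
- by move=> i j; exact: a_sym.
- by move=> v; exact: a_elliptic.
- by move=> i j; exact: a_le.
- by move=> k i j; exact: da_le1.
- by move=> i; exact: b_le1.
- by move=> i j; exact: h_sym.
- exact: ltW.
- exact: phi_gt0.
- by have := f_ge0 (u x); rewrite -(equation x1) opprD.
- by move=> k; exact: linearized_equation.
- exact: phi_super.
Qed.

Let p_le_g i x : `|p i x| <= g x.
Proof.
rewrite -(ler_pXn2r (n := 2)) ?nnegrE ?sqrtr_ge0// real_normK ?num_real// g2E /q.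
rewrite (bigD1 i)//= -expr2 -addrA lerDl addr_ge0 ?(ltW d2_gt0)//.
by rewrite sumr_ge0// => l _; rewrite -expr2 sqr_ge0.
Qed.

Let diag_le x : \sum_i `|p i x * h i i x| <= g x * hh x.
Proof.
rewrite /hh /l1mx mulr_sumr; apply: ler_sum => i _.
by rewrite normrM; apply: ler_pM => //; exact: (le_l1 (hv x i) i).
Qed.

Let cont_hess : {in Ball 1, continuous hh}.
Proof.
move=> x x1; apply: continuous_at_sum => i; apply: continuous_at_sum => j.
by apply: cts_norm; have [_ + _] := hC i j; exact.
Qed.

Let cont_rhs : {in Ball 1, continuous (fun x => absorption_const * q x + d2 * `|f' (u x)|)}.
Proof.
move=> x x1; have [_ cq _] := qC; have [_ cu _] := uC; apply: ctsD.
  by apply: ctsM; [exact: cts_cst|exact: cq].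
apply: ctsM; first exact: cts_cst.
by apply: cts_norm; apply: cts_comp; [exact: f'_continuous|exact: cu].
Qed.

(** The integral of [pointwise_energy_at] for the cutoff of the ball of radius [s0]:
the divergence integrates to 0, and the cutoff is at least [(s0 - r) ^+ 2] on the
ball of radius [r]. *)
Lemma regularized_energy_estimate (r s0 : R) : 0 <= r -> r < s0 -> s0 < 1 -> 1 <= r + s0 ->
  (((s0 - r) ^+ 4)%:E * \int[mu]_(x in Ball r) (\sum_i `|p i x * h i i x|)%:E <=
  \int[mu]_(x in Ball s0) (absorption_const * q x + d2 * `|f' (u x)|)%:E)%E.
Proof.
move=> r0 rs s1 rs1; have s_ge0 : 0 <= s0 by rewrite (le_trans r0)// ltW.
have s01 : 0 <= s0 <= 1 by rewrite s_ge0 ltW.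
have sub x : Ball r x -> @Ball R n s0 x by apply: Ball_sub; exact: ltW.
have sub1 x : Ball s0 x -> @Ball R n 1 x by apply: Ball_sub; exact: ltW.
have [_ cg _] := gC; have [_ cb _] := @C1_cutoff R n s0.
pose G x := \sum_i (cutoff s0 x ^+ 2 * dX i i x + 2 * cutoff s0 x * (X i x * dcutoff s0 i x)).
have iG : mu.-integrable (Ball s0) (EFin \o G) by exact: divergence_integrable s1 XC (C1_cutoff s0).
have G0 : (\int[mu]_(x in Ball s0) (G x)%:E = 0)%E.
  by apply: (divergence_cutoff s1 XC (C1_cutoff s0)) => x; exact: cutoff_out.
pose L x := g x * hh x * cutoff s0 x ^+ 2.
have cL : {in Ball 1, continuous L}.
  move=> x x1; apply: ctsM; last exact/cts_sqr/cb.
  by apply: ctsM; [exact: cg|exact: cont_hess].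
have L0 x : 0 <= L x.
  by apply: mulr_ge0; [apply: mulr_ge0; [exact: sqrtr_ge0|exact: l1mx_ge0]|exact: sqr_ge0].
apply: (@le_trans _ _ (\int[mu]_(x in Ball s0) (L x)%:E)%E).
  apply: (@le_trans _ _ (\int[mu]_(x in Ball r) (L x)%:E)%E); last first.
    apply: ge0_subset_integral; [exact: measurable_Ball|exact: measurable_Ball| | |exact: sub].
      by apply: EFin_measurable_Ball => x /set_mem /sub1 x1; apply: cL; rewrite inE.
    by move=> x _; rewrite lee_fin.
  have cd : {in Ball r, continuous (fun x => \sum_i `|p i x * h i i x|)}.
    move=> x /set_mem /sub /sub1 /mem_set x1; apply: continuous_at_sum => i.
    apply: cts_norm; apply: ctsM; first by have [_ + _] := pC i; exact.
    by have [_ + _] := hC i i; exact.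
  rewrite -ge0_integralZl//; last 4 first.
  - exact: measurable_Ball.
  - exact: EFin_measurable_Ball.
  - by move=> x _; rewrite lee_fin sumr_ge0.
  - by rewrite lee_fin exprn_ge0// subr_ge0 ltW.
  apply: ge0_le_integral.
  - exact: measurable_Ball.
  - move=> x _; rewrite -EFinM lee_fin mulr_ge0 ?sumr_ge0//.
    by rewrite exprn_ge0// subr_ge0 ltW.
  - by apply: measurable_funeM; exact: EFin_measurable_Ball.
  - by apply: EFin_measurable_Ball => x /set_mem /sub /sub1 x1; apply: cL; rewrite inE.
  move=> x xr; rewrite -EFinM lee_fin /L mulrC.
  apply: ler_pM; [by rewrite sumr_ge0|by rewrite exprn_ge0// subr_ge0 ltW|exact: diag_le|].
  have cb0 : 0 <= cutoff s0 x by have /andP[] := cutoff_le1 x s01.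
  rewrite (exprM _ 2 2) (@ler_pXn2r _ 2) ?nnegrE ?sqr_ge0//.
  exact: cutoff_ge.
apply: (@le_trans _ _ (\int[mu]_(x in Ball s0) ((absorption_const * q x + d2 * `|f' (u x)|)%:E + (G x)%:E))%E).
  apply: le_integral; first exact: measurable_Ball.
  - exact: Ball_integrable s1 cL.
  - by apply: integrableD => //; [exact: measurable_Ball|exact: Ball_integrable s1 cont_rhs].
  move=> x /set_mem xs; rewrite -EFinD lee_fin.
  have x1 := sub1 _ xs; have /andP[b0 b1] := cutoff_le1 x s01.
  apply: (le_trans (pointwise_energy_at (cutoff s0 x) (fun i => dcutoff s0 i x) x1)).
  rewrite lerD2r lerD//.
    rewrite /absorption_const -mulrA; apply: ler_wpM2l; first exact: energy_const_ge0.
    rewrite g2E mulrC; apply: ler_wpM2r; first exact: ltW.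
    apply: lerD; first by rewrite expr_le1.
    rewrite ler_pXn2r ?nnegrE ?l1_ge0// ?mulr_ge0//.
    rewrite mulrC; apply: (@le_trans _ _ (\sum_(i < n) 4)); last first.
      by rewrite sumr_const card_ord [leRHS]mulr_natl.
    by apply: ler_sum => i _; exact: dcutoff_le.
  rewrite ler_wpM2l ?(ltW d2_gt0)// ler_piMr// expr_le1//.
rewrite integralD//=; [by rewrite G0 adde0|exact: measurable_Ball|].
exact: Ball_integrable s1 cont_rhs.
Qed.

End regularized.

(** The limit of [regularized_energy_estimate] as the parameter tends to 0. *)
Lemma energy_estimate (r s : R) : 0 <= r -> r < s -> s < 1 -> 1 <= r + s ->
  (((s - r) ^+ 4)%:E * \int[mu]_(x in Ball r) (\sum_i `|p i x * h i i x|)%:E <=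
  absorption_const%:E * \int[mu]_(x in Ball s) (\sum_i p i x ^+ 2)%:E)%E.
Proof.
move=> r0 rs s1 rs1.
have sub1 x : Ball s x -> @Ball R n 1 x by apply: Ball_sub; exact: ltW.
have [_ cu _] := uC.
have cp : {in Ball 1, continuous (fun x => \sum_i p i x ^+ 2)}.
  move=> x x1; apply: continuous_at_sum => i; apply: cts_sqr.
  by have [_ + _] := pC i; exact.
have cf : {in Ball 1, continuous (fun x => absorption_const + `|f' (u x)|)}.
  move=> x x1; apply: ctsD; first exact: cts_cst.
  by apply: cts_norm; apply: cts_comp; [exact: f'_continuous|exact: cu].
have ip := Ball_integrable s1 cp; have if_ := Ball_integrable s1 cf.
pose T := (\int[mu]_(x in Ball s) (absorption_const + `|f' (u x)|)%:E)%E.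
have Tfin : T \is a fin_num by apply: integrable_fin_num => //; exact: measurable_Ball.
have T0 : (0 <= T)%E.
  by apply: integral_ge0 => x _; rewrite lee_fin addr_ge0// absorption_const_ge0.
apply/lee_addgt0Pr => e e0.
(* the parameter of the regularization is chosen so that its contribution is at
   most [e] *)
have d0 : 0 < e / (fine T + 1) by rewrite divr_gt0// ltr_wpDl// fine_ge0.
apply: (le_trans (regularized_energy_estimate d0 r0 rs s1 rs1)).
set d := e / _.
rewrite (_ : (\int[mu]_(x in _) _)%E = (absorption_const%:E *
    \int[mu]_(x in Ball s) (\sum_i p i x ^+ 2)%:E + d%:E * T)%E); last first.
  rewrite -(integralZl (measurable_Ball s) ip) -(integralZl (measurable_Ball s) if_).
  rewrite -integralD//; last 3 first.
  - exact: measurable_Ball.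
  - exact: (integrableZl (measurable_Ball s) _ ip).
  - exact: (integrableZl (measurable_Ball s) _ if_).
  apply: eq_integral => x _; rewrite -!EFinM -EFinD; congr (_%:E).
  rewrite (eq_bigr (fun l => p l x ^+ 2)); last by move=> l _; rewrite expr2.
  by rewrite mulrDr -addrA; congr (_ + _); rewrite mulrDr [d * absorption_const]mulrC.
rewrite leeD2l// -(fineK Tfin) -EFinM lee_fin /d mulrAC ler_pdivrMr; last first.
  by rewrite ltr_wpDl// fine_ge0.
by rewrite ler_wpM2l ?(ltW e0)// lerDl.
Qed.

End energy_estimate.

(** * Absorption of the gradient term *)

Section absorption.
Context {R : realType}.

(** Iterate along the radii [3 / 4 - 2 ^- k / 4]. The remainder of step [k] grows like
[2 ^ (k * m)], but it is multiplied by the [k]-th power of the contraction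
factor, which is [2 ^- (k * (m + 1))], so that the series of the remainders
converges; the bound [E1] makes the first term tend to 0. *)
Lemma absorb_half_power (E : R -> R) (m : nat) (B E1 : R) : 0 <= B ->
  (forall r : R, 2^-1 <= r < 3 / 4 -> 0 <= E r <= E1) ->
  (forall r s : R, 2^-1 <= r -> r < s -> s < 3 / 4 ->
     E r <= 2^-1 ^+ m.+1 * E s + B / (s - r) ^+ m) ->
  E 2^-1 <= 2 * B * 8 ^+ m.
Proof.
move=> B0 Eb Ei.
pose h (k : nat) : R := 2^-1 ^+ k.
have h0 k : 0 < h k by rewrite exprn_gt0// invr_gt0.
have hS k : h k.+1 = h k / 2 by rewrite /h exprSr.
pose s (k : nat) : R := 3 / 4 - h k / 4.
have h1 k : h k <= 1 by rewrite /h exprn_ile1// ?invr_ge0// invf_le1// ler1n.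
have sI k : 2^-1 <= s k < 3 / 4.
  by rewrite /s; apply/andP; split; move: (h0 k) (h1 k); lra.
have step k : E 2^-1 <= h k ^+ m.+1 * E (s k) + 2 * B * 8 ^+ m * (1 - h k).
  elim: k => [|k IH].
    by rewrite /s /h expr0 expr1n mul1r subrr mulr0 addr0 (_ : 3 / 4 - 1 / 4 = 2^-1) //; lra.
  apply: (le_trans IH).
  have ss : s k < s k.+1 by rewrite /s hS; move: (h0 k); lra.
  have /andP[sk _] := sI k; have /andP[_ sk1] := sI k.+1.
  have H := Ei _ _ sk ss sk1.
  have dE : s k.+1 - s k = h k / 8 by rewrite /s hS; field.
  rewrite dE in H.
  have hm : 0 <= h k ^+ m.+1 by rewrite exprn_ge0// ltW.
  apply: (le_trans (lerD (ler_wpM2l hm H) (lexx _))).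
  rewrite mulrDr mulrA -exprMn -addrA -/(h 1%N).
  rewrite (_ : h k * 2^-1 = h k.+1); last by rewrite hS.
  rewrite lerD2l.
  rewrite (_ : h k ^+ m.+1 * (B / (h k / 8) ^+ m) = B * 8 ^+ m * h k); last first.
    rewrite exprSr expr_div_n; field.
    by rewrite !expf_neq0// gt_eqF.
  rewrite hS le_eqVlt; apply/orP; left; apply/eqP; by field.
have E10 : 0 <= E1 by have /andP[a b] := Eb _ (sI 0%N); apply: le_trans a b.
apply/ler_addgt0Pl => e e0.
have [k hk] : exists k, h k * E1 <= e.
  have [k hk] : exists k, E1 / e < k%:R.
    by exists (Num.bound (E1 / e)); apply: archi_boundP; rewrite divr_ge0// ltW.
  exists k; rewrite /h exprVn ler_pdivrMl ?exprn_gt0//.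
  rewrite ltr_pdivrMr// in hk; apply: (le_trans (ltW hk)).
  by rewrite ler_wpM2r ?(ltW e0)// -natrX ler_nat ltnW// ltn_expl.
apply: (le_trans (step k)); rewrite lerD//; last first.
  rewrite -[leRHS]mulr1 ler_wpM2l ?mulr_ge0 ?exprn_ge0//.
  by rewrite lerBlDr lerDl ltW.
apply: le_trans hk; have /andP[a b] := Eb _ (sI k).
apply: ler_pM => //; first by rewrite exprn_ge0// ltW.
by rewrite exprS ler_piMr ?(ltW (h0 k))// exprn_ile1// ltW.
Qed.

End absorption.

Lemma scale_algebra (R : realFieldType) (n : nat) (g k d N l : R) :
  g != 0 -> k != 0 -> d != 0 -> N != 0 ->
  216 * N / (k ^+ 2 * (g * k / (24 * N)) ^+ n) * l / d ^+ (4 * n.+2)%N =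
  108 * N / (k * d ^+ 4) ^+ 2 * (2 * l / (g * (k * d ^+ 4) / (24 * N)) ^+ n).
Proof.
move=> g0 k0 d0 N0; rewrite (_ : (4 * n.+2)%N = (4 * 2 + 4 * n)%N); last by lia.
rewrite exprD !exprM.
have -> : g * (k * d ^+ 4) / (24 * N) = g * k / (24 * N) * d ^+ 4 by field.
rewrite (exprMn n _ (d ^+ 4)).
have q0 : (g * k / (24 * N)) ^+ n != 0.
  by rewrite expf_neq0// !mulf_neq0// invr_neq0// mulf_neq0.
have q1 : (d ^+ 4) ^+ n != 0 by rewrite !expf_neq0.
move: (_ ^+ n) ((d ^+ 4) ^+ n) q0 q1 => x y x0 y0.
by field; rewrite x0 y0 d0 k0.
Qed.

Section gradient_estimate.
Context {R : realType} {n : nat}.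
Implicit Types (x : 'rV[R]_n) (i : 'I_n) (r s d : R) (F : 'rV[R]_n -> R).
Notation mu := (lebesgue_rV n).
Hypothesis n_gt0 : (0 < n)%N.
Variables (u : 'rV[R]_n -> R) (p : 'I_n -> 'rV[R]_n -> R).
Variables (h : 'I_n -> 'I_n -> 'rV[R]_n -> R) (K : R).
Hypothesis uC : C1on u p.
Hypothesis pC : forall i, C1on (p i) (fun k => h k i).
Hypothesis K0 : 0 <= K.
Hypothesis energy : forall r s, 0 <= r -> r < s -> s < 1 -> 1 <= r + s ->
  (((s - r) ^+ 4)%:E * \int[mu]_(x in Ball r) (\sum_i `|p i x * h i i x|)%:E <=
  K%:E * \int[mu]_(x in Ball s) (\sum_i p i x ^+ 2)%:E)%E.

Let L := (\int[mu]_(x in Ball 1) `|u x|%:E)%E.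
Hypothesis Lfin : L \is a fin_num.

Let Ef x := \sum_i p i x ^+ 2.
Let Uf x := u x ^+ 2.
Let Kf x := \sum_i `|p i x * h i i x|.
Let J (F : 'rV[R]_n -> R) r := fine (\int[mu]_(x in Ball r) (F x)%:E)%E.

Let cu : {in Ball 1, continuous u}. Proof. by case: uC. Qed.
Let cp i : {in Ball 1, continuous (p i)}. Proof. by case: (pC i). Qed.
Let ch i : {in Ball 1, continuous (h i i)}.
Proof. by case: (pC i) => _ _ +; exact. Qed.

Let cE : {in Ball 1, continuous Ef}.
Proof. by move=> x x1; apply: continuous_at_sum => i; apply: cts_sqr; exact: cp. Qed.
Let cU : {in Ball 1, continuous Uf}.
Proof. by move=> x x1; apply: cts_sqr; exact: cu. Qed.
Let cK : {in Ball 1, continuous Kf}.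
Proof.
move=> x x1; apply: continuous_at_sum => i; apply: cts_norm.
by apply: ctsM; [exact: cp|exact: ch].
Qed.

Let Ef0 x : 0 <= Ef x. Proof. by apply: sumr_ge0 => i _; exact: sqr_ge0. Qed.
Let Kf0 x : 0 <= Kf x. Proof. exact: sumr_ge0. Qed.

Let JE F r : {in Ball 1, continuous F} -> r < 1 ->
  (\int[mu]_(x in Ball r) (F x)%:E)%E = (J F r)%:E.
Proof.
move=> cF r1; rewrite /J fineK//; apply: integrable_fin_num; first exact: measurable_Ball.
exact: Ball_integrable r1 cF.
Qed.

Let J_ge0 F r : (forall x, 0 <= F x) -> 0 <= J F r.
Proof. by move=> F0; apply: fine_ge0; apply: integral_ge0 => x _; rewrite lee_fin. Qed.

Let J_mono F r s : (forall x, 0 <= F x) -> {in Ball 1, continuous F} -> r <= s -> s < 1 ->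
  J F r <= J F s.
Proof.
move=> F0 cF rs s1; rewrite -lee_fin -!JE//; last exact: le_lt_trans s1.
apply: ge0_subset_integral; [exact: measurable_Ball|exact: measurable_Ball| | |exact: Ball_sub].
  apply: EFin_measurable_Ball => x /set_mem /(Ball_sub (ltW s1)) x1.
  by apply: cF; rewrite inE.
by move=> x _; rewrite lee_fin.
Qed.

Let sub_continuous F r : r <= 1 -> {in Ball 1, continuous F} -> {in Ball r, continuous F}.
Proof. by move=> r1 cF x /set_mem /(Ball_sub r1) x1; apply: cF; rewrite inE. Qed.

Let sum_JE r : r < 1 ->
  (\sum_(i < n) \int[mu]_(x in Ball r) (p i x ^+ 2)%:E)%E = (J Ef r)%:E.
Proof.
move=> r1; rewrite -JE// -ge0_integral_sum//; last 3 first.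
- exact: measurable_Ball.
- move=> i; apply: EFin_measurable_Ball; apply: sub_continuous (ltW r1) _ => x x1.
  exact/cts_sqr/cp.
- by move=> i x _; rewrite lee_fin sqr_ge0.
by apply: eq_integral => x _; rewrite sumEFin.
Qed.

(** The sum over the axes of [integral_sqr_partial_le]. *)
Lemma gradient_interpolation r d : 0 < d -> r + d < 1 ->
  J Ef r <= 108 * n%:R / d ^+ 2 * J Uf (r + d) + 2 * d * J Kf (r + d).
Proof.
move=> d0 rd; have r1 : r < 1 by apply: le_lt_trans rd; rewrite lerDl ltW.
rewrite -lee_fin -sum_JE//.
have -> : (108 * n%:R / d ^+ 2 * J Uf (r + d) + 2 * d * J Kf (r + d))%:E =
   (\sum_(i < n) (d%:E * \int[mu]_(x in Ball (r + d))
      (108 / d ^+ 3 * u x ^+ 2 + 2 * `|p i x * h i i x|)%:E))%E.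
  have cG i : {in Ball 1, continuous (fun x => 108 / d ^+ 3 * u x ^+ 2 + 2 * `|p i x * h i i x|)}.
    move=> x x1; apply: ctsD; first by apply: ctsM; [exact: cts_cst|exact: cU].
    by apply: ctsM; [exact: cts_cst|apply: cts_norm; apply: ctsM; [exact: cp|exact: ch]].
  have G0 i x : 0 <= 108 / d ^+ 3 * u x ^+ 2 + 2 * `|p i x * h i i x|.
    apply: addr_ge0; last exact: mulr_ge0.
    apply: mulr_ge0; last exact: sqr_ge0.
    by apply: divr_ge0; [exact: ler0n|rewrite exprn_ge0// ltW].
  rewrite -ge0_sume_distrr; last first.
    by move=> i _; apply: integral_ge0 => x _; rewrite lee_fin G0.
  rewrite -ge0_integral_sum//; last 3 first.
  - exact: measurable_Ball.
  - by move=> i; apply: EFin_measurable_Ball; exact: sub_continuous (ltW rd) (@cG i).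
  - by move=> i x _; rewrite lee_fin G0.
  under eq_integral => x _.
    rewrite sumEFin big_split /= sumr_const card_ord -mulr_sumr.
    over.
  rewrite (_ : (\int[mu]_(x in _) _)%E = (\int[mu]_(x in Ball (r + d))
     ((n%:R * (108 / d ^+ 3))%:E * (Uf x)%:E + 2%:E * (Kf x)%:E))%E); last first.
    apply: eq_integral => x _; rewrite -!EFinM -EFinD; congr (_%:E).
    by rewrite -(mulr_natl (108 / d ^+ 3 * u x ^+ 2)) mulrA.
  have iU := Ball_integrable rd cU; have iK := Ball_integrable rd cK.
  rewrite integralD//; last 3 first.
  - exact: measurable_Ball.
  - exact: (integrableZl (measurable_Ball _) _ iU).
  - exact: (integrableZl (measurable_Ball _) _ iK).
  rewrite (integralZl (measurable_Ball _) iU) (integralZl (measurable_Ball _) iK).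
  rewrite (JE cU rd) (JE cK rd) -(EFinM (n%:R * _)) -(EFinM 2) -EFinD -EFinM; congr (_%:E).
  by field; rewrite gt_eqF.
have [dU _ _] := uC.
apply: lee_sum => i _; have [dP _ _] := pC i.
exact: (integral_sqr_partial_le d0 (ltW rd) cu (@cp i) (@ch i) (@dU i) (@dP i)).
Qed.

Lemma mean_interpolation r d : 0 < d -> r + n%:R * d < 1 ->
  J Uf r <= 2 * fine L ^+ 2 / d ^+ n + n%:R * d ^+ 2 * J Ef (r + n%:R * d).
Proof.
move=> d0 rd.
have r1 : r < 1 by apply: le_lt_trans rd; rewrite lerDl mulr_ge0// ltW.
have [dU _ _] := uC.
have := integral_sqr_le_mean cu cp dU d0 (ltW rd).
rewrite sum_JE// (JE cU r1) -/L -(fineK Lfin) -!EFinM -EFinD lee_fin => H.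
rewrite -(ler_pM2l (exprn_gt0 n d0)); apply: (le_trans H).
rewrite le_eqVlt; apply/orP; left; apply/eqP; field.
by rewrite expf_neq0// gt_eqF.
Qed.

Lemma hessian_absorption r s : 0 <= r -> r < s -> s < 1 -> 1 <= r + s ->
  (s - r) ^+ 4 * J Kf r <= K * J Ef s.
Proof.
move=> r0 rs s1 rs1; have := energy r0 rs s1 rs1.
by rewrite (JE cK (lt_trans rs s1)) (JE cE s1) -!EFinM lee_fin.
Qed.

(** The steps below are proportional to d^4 for d = s - r; the term in L^2 is divided
by the square of one step and by the [n]-th power of another, hence by the power
[4 * (n + 2)] of d. *)
Definition absorption_power := (4 * n.+2)%N.
Let m := absorption_power.
(** The factor that [absorb_half_power] requires for the exponent
[absorption_power]. *)
Definition contraction_factor : R := 2^-1 ^+ m.+1.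
Let gam := contraction_factor.
Definition step_const : R := gam / (64 * (K + 1)).
Let kap := step_const.
Definition mean_const : R := 216 * n%:R / (kap ^+ 2 * (gam * kap / (24 * n%:R)) ^+ n).

Let nR0 : 0 < n%:R :> R. Proof. by rewrite ltr0n. Qed.
Let gam0 : 0 < gam. Proof. by rewrite exprn_gt0// invr_gt0. Qed.
Let gam1 : gam <= 1.
Proof. by rewrite exprn_ile1// ?invr_ge0// invf_le1// ler1n. Qed.
Let kap0 : 0 < kap.
Proof. by apply: divr_gt0 => //; apply: mulr_gt0 => //; apply: ltr_wpDl. Qed.
Let kap1 : kap <= 64^-1.
Proof.
rewrite /kap /step_const ler_pdivrMr; last by apply: mulr_gt0 => //; apply: ltr_wpDl.
by rewrite mulrA mulVf// mul1r (le_trans gam1)// lerDr.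
Qed.

Lemma mean_const_ge0 : 0 <= mean_const.
Proof.
apply: divr_ge0; first by apply: mulr_ge0 => //; exact: ler0n.
apply: mulr_ge0; first exact: sqr_ge0.
apply: exprn_ge0; apply: divr_ge0; apply: mulr_ge0; do ?exact: ltW; exact: ler0n.
Qed.

Let mean_constE (d : R) : d != 0 -> mean_const * fine L ^+ 2 / d ^+ m =
  108 * n%:R / (kap * d ^+ 4) ^+ 2 *
    (2 * fine L ^+ 2 / (gam * (kap * d ^+ 4) / (24 * n%:R)) ^+ n).
Proof. by move=> d0; apply: scale_algebra => //; rewrite gt_eqF. Qed.

(** In [gradient_interpolation] take the step [del], with the factor [step_const]
small enough that [hessian_absorption] turns the term in [Kf] into at most
[gam / 2 * J Ef s]; in [mean_interpolation] take the step [e], small enough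
compared with [del] that the gradient term is again at most [gam / 2 * J Ef s]. *)
Lemma gradient_contraction r s : 2^-1 <= r -> r < s -> s < 3 / 4 ->
  J Ef r <= gam * J Ef s + mean_const * fine L ^+ 2 / (s - r) ^+ m.
Proof.
move=> r2 rs s34; set d := s - r.
have d0 : 0 < d by rewrite subr_gt0.
have d14 : d <= 1 / 4 by rewrite /d; lra.
have s1 : s < 1 by lra.
have Es0 := J_ge0 s Ef0.
pose del := kap * d ^+ 4.
have d40 : 0 < d ^+ 4 by rewrite exprn_gt0.
have del0 : 0 < del by rewrite mulr_gt0.
have d4d : d ^+ 4 <= d.
  by rewrite -[leRHS]mulr1 exprS ler_pM2l// exprn_ile1// ?(ltW d0)//; lra.
have deld : del <= d / 64.
  rewrite /del mulrC (le_trans (ler_wpM2r (ltW kap0) d4d))//.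
  by rewrite ler_wpM2l// ltW.
have rdel : r + del < 1 by rewrite /d in deld d0; lra.
have I1 := gradient_interpolation del0 rdel.
pose e := gam * del / (24 * n%:R).
have e0 : 0 < e by apply: divr_gt0; apply: mulr_gt0.
have ne : n%:R * e = gam * del / 24 by rewrite /e; field; rewrite gt_eqF.
have nele : n%:R * e <= d / 3.
  have : gam * del <= 1 * (d / 64) by apply: ler_pM => //; exact: ltW.
  by rewrite ne; move: (gam * del) => z; lra.
have res : r + del + n%:R * e <= s by rewrite /d in nele deld d0; lra.
have I2 := mean_interpolation e0 (le_lt_trans res s1).
(* at least half of the distance [d] is left, whence the factor 16 = 2 ^ 4 *)
have I3 : d ^+ 4 * J Kf (r + del) <= 16 * (K * J Ef s).
  have rs' : r + del < s by rewrite /d in deld d0; lra.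
  have := hessian_absorption _ rs' s1.
  move=> /(_ ltac:(lra) ltac:(lra)) H.
  have : (d / 2) ^+ 4 <= (s - (r + del)) ^+ 4.
    by rewrite ler_pXn2r ?nnegrE//; rewrite /d in deld d0 *; lra.
  move=> /(ler_wpM2r (J_ge0 (r + del) Kf0)) H'.
  have := le_trans H' H; rewrite expr_div_n.
  rewrite (_ : d ^+ 4 / 2 ^+ 4 * J Kf (r + del) = d ^+ 4 * J Kf (r + del) / 16); last by field.
  by rewrite ler_pdivrMr// [_ * 16]mulrC.
have mono := J_mono Ef0 cE res s1.
have b1 : 2 * del * J Kf (r + del) <= gam / 2 * J Ef s.
  rewrite (_ : 2 * del * _ = 2 * kap * (d ^+ 4 * J Kf (r + del))); last by rewrite /del; ring.
  have k2 : 0 <= 2 * kap by rewrite mulr_ge0// ltW.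
  apply: (le_trans (ler_wpM2l k2 I3)).
  rewrite (_ : 2 * kap * _ = gam / 2 * (K / (K + 1) * J Ef s)); last first.
    by rewrite /kap /step_const; field; rewrite gt_eqF// ltr_wpDl.
  apply: ler_wpM2l; first by rewrite divr_ge0// ltW.
  by rewrite ler_piMl// ler_pdivrMr ?ltr_wpDl// mul1r lerDl.
have b2 : 108 * n%:R / del ^+ 2 * (n%:R * e ^+ 2 * J Ef (r + del + n%:R * e)) <=
    gam / 2 * J Ef s.
  rewrite (_ : 108 * n%:R / del ^+ 2 * _ =
     gam * (gam * (3 / 16)) * J Ef (r + del + n%:R * e)); last first.
    by rewrite /e; field; rewrite (gt_eqF nR0) (gt_eqF del0).
  apply: ler_pM => //.
  - apply: mulr_ge0; [exact: ltW|apply: mulr_ge0; [exact: ltW|lra]].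
  - exact: J_ge0.
  - by apply: ler_wpM2l; [exact: ltW|move: gam1; lra].
have c0 : 0 <= 108 * n%:R / del ^+ 2.
  by apply: divr_ge0; [apply: mulr_ge0; rewrite ?ler0n|exact: sqr_ge0].
have I4 := ler_wpM2l c0 I2.
rewrite mulrDr in I4.
apply: (le_trans I1).
rewrite (_ : mean_const * fine L ^+ 2 / d ^+ m =
  108 * n%:R / del ^+ 2 * (2 * fine L ^+ 2 / e ^+ n)); last first.
  by rewrite (@mean_constE d) // gt_eqF.
move: I4 b1 b2; move: (_ / _ * J Uf _) (2 * del * _) (_ / _ * (2 * _ / _)) (_ / _ * (_ * _ * J Ef _)).
move: (J Ef s) => a b c f1 f2 H1 H2 H3; lra.
Qed.

Theorem gradient_L2_le : J Ef 2^-1 <= 2 * (mean_const * fine L ^+ 2) * 8 ^+ m.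
Proof.
apply: (@absorb_half_power R (J Ef) m _ (J Ef (3 / 4))).
- by apply: mulr_ge0; [exact: mean_const_ge0|exact: sqr_ge0].
- move=> r /andP[r0 r34]; rewrite J_ge0//= J_mono//; first exact: ltW.
  by rewrite ltr_pdivrMr// mul1r ltr_nat.
- exact: gradient_contraction.
Qed.

End gradient_estimate.

(** * The gradient bound for stable solutions *)

Section Lp_norm.
Context {R : realType} {n : nat}.
Implicit Types (g : 'rV[R]_n -> R) (r : R).
Notation mu := (lebesgue_rV n).

Lemma Lp_norm1E r g : Lp_norm 1 (Ball r) g = (\int[mu]_(x in Ball r) `|g x|%:E)%E.
Proof.
rewrite /Lp_norm Lnorm1 [RHS]integral_mkcond; apply: eq_integral => x _.
by rewrite !patchE; case: ifP => // _; exact: abse0.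
Qed.

Lemma Lp_norm2_le r g (c : R) : 0 <= c ->
  (\int[mu]_(x in Ball r) (g x ^+ 2)%:E <= (c ^+ 2)%:E)%E ->
  (Lp_norm 2%:E (Ball r) g <= c%:E)%E.
Proof.
move=> c0 H; rewrite /Lp_norm unlock /Lnorm.
have -> : (\int[mu]_x `|((EFin \o g) \_ (Ball r)) x| `^ 2 =
    \int[mu]_(x in Ball r) (g x ^+ 2)%:E)%E.
  rewrite [RHS]integral_mkcond; apply: eq_integral => x _.
  rewrite !patchE; case: ifP => _ /=; last by rewrite normr0 powR0.
  by rewrite powR_mulrn// real_normK ?num_real.
rewrite poweR12_sqrt; last by apply: integral_ge0 => x _; rewrite lee_fin sqr_ge0.
rewrite (_ : c%:E = sqrte (c ^+ 2)%:E); last by rewrite /sqrte sqrtr_sqr ger0_norm.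
by rewrite lee_sqrt// lee_fin sqr_ge0.
Qed.

End Lp_norm.

Section smooth_data.
Context {R : realType} {n : nat}.
Notation mu := (lebesgue_rV n).
Variables (A : 'rV[R]_n -> 'M[R]_n) (b : 'rV[R]_n -> 'rV[R]_n).
Variables (u : 'rV[R]_n -> R) (f : R -> R) (lam Lam : R).
Hypothesis hA : forall i j, smooth_cBall (fun x => A x i j).
Hypothesis hb : forall i, smooth_cBall (fun x => b x ord0 i).
Hypothesis symA : forall x, cBall 1 x -> (A x)^T = A x.
Hypothesis ellA : elliptic lam Lam A.
Hypothesis hu : smooth_cBall u.
Hypothesis hf : C1_real f.
Hypothesis f_ge0 : forall t, 0 <= f t.
Hypothesis solu : solution A b f u.
Hypothesis stabu : stable A b f u.
Hypothesis small : (C0norm (norm_DA A) + C0norm (fun x => enorm (b x)) <= 1)%E.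

(** The instance of [energy_estimate] for the iterated partial derivatives of the
data, symmetric in the indices by [smooth_mixed]. *)
Lemma stable_energy_estimate r s : 0 <= r -> r < s -> s < 1 -> 1 <= r + s ->
  (((s - r) ^+ 4)%:E * \int[mu]_(x in Ball r)
     (\sum_i `|pderivs [:: i] u x * pderivs [:: i; i] u x|)%:E <=
  (absorption_const (n := n) lam `|Lam|)%:E *
     \int[mu]_(x in Ball s) (\sum_i pderivs [:: i] u x ^+ 2)%:E)%E.
Proof.
have [phi [[phiC2 _] super phi0 _]] := stabu.
have [lam0 _] := ellA.
have [df cf] := hf.
apply: (@energy_estimate R n
  (fun i j x => A x i j) (fun k i j => pderivs [:: k] (fun x => A x i j))
  (fun i x => b x ord0 i) (fun k i => pderivs [:: k] (fun x => b x ord0 i))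
  u (fun i => pderivs [:: i] u) (fun i j => pderivs [:: i; j] u)
  (fun k i j => pderivs [:: k; i; j] u) phi (fun i => pderivs [:: i] phi)
  (fun i j => pderivs [:: i; j] phi) f (derive1 f) lam `|Lam|).
- by move=> i j; exact: (smooth_C1 [::] (hA i j)).
- by move=> i; exact: (smooth_C1 [::] (hb i)).
- exact: (smooth_C1 [::] hu).
- by move=> i; exact: (smooth_C1 [:: i] hu).
- by move=> i j; exact: (smooth_C1 [:: i; j] hu).
- by apply: (@Ck_C1 R n 2 phi [::] phiC2).
- by move=> j; apply: (@Ck_C1 R n 2 phi [:: j] phiC2).
- by move=> i j x x1; exact: (@smooth_mixed R n u [::] i j x hu x1).
- by move=> i j l x x1; exact: (@smooth_mixed R n u [:: l] i j x hu x1).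
- by move=> s0; rewrite derive1E; exact: DeriveDef.
- exact: cf.
- exact: f_ge0.
- exact: lam0.
- exact: normr_ge0.
- by move=> i j x x1; exact: (A_sym symA).
- by move=> x v x1; have /andP[] := bform_bounds ellA v x1.
- by move=> i j x x1; exact: (A_entry_le symA ellA).
- by move=> k i j x x1; exact: (dA_le1 hA small k i j x1).
- by move=> i x x1; exact: (b_le1 small i x1).
- by move=> x x1; exact: (solu x1).
- by move=> x x1; exact: (super x x1).
- exact: phi0.
Qed.

End smooth_data.

Theorem proposition1p3 (R : realType) (n : nat) (n_gt0 : (0 < n)%N)
    (lam Lam : R) (lam_gt0 : 0 < lam) :
  exists eps0 C : R, [/\ 0 < eps0, 0 < C &
    forall (A : 'rV[R]_n -> 'M[R]_n) (b : 'rV[R]_n -> 'rV[R]_n)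
      (u : 'rV[R]_n -> R) (f : R -> R) (eps : R),
    (forall i j, smooth_cBall (fun x => A x i j)) ->
    (forall i, smooth_cBall (fun x => b x ord0 i)) ->
    (forall x, cBall 1 x -> (A x)^T = A x) ->
    elliptic lam Lam A ->
    smooth_cBall u ->
    C1_real f ->
    (forall t, 0 <= f t) ->
    solution A b f u ->
    stable A b f u ->
    0 < eps ->
    (C0norm (norm_DA A) + C0norm (fun x => enorm (b x)) <= eps%:E)%E ->
    eps <= eps0 ->
    (Lp_norm 2%:E (Ball 2^-1) (fun x => enorm (grad u x)) <=
       C%:E * Lp_norm 1 (Ball 1) u)%E].
Proof.
pose K := absorption_const (n := n) lam `|Lam|.
have K0 : 0 <= K by apply: absorption_const_ge0.
pose c := 2 * mean_const (n := n) K * 8 ^+ @absorption_power n.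
have c0 : 0 <= c.
  apply: mulr_ge0; last exact: exprn_ge0.
  by apply: mulr_ge0 => //; exact: mean_const_ge0.
have c1 : 0 < Num.sqrt c + 1 by rewrite ltr_wpDl// sqrtr_ge0.
exists 1, (Num.sqrt c + 1); split=> // A b u f eps hA hb symA ellA hu hf f0 solu stabu _ small eps1.
have {}small := le_trans small (_ : (eps%:E <= 1%:E)%E); rewrite lee_fin in small.
have E := stable_energy_estimate hA hb symA ellA hu hf f0 solu stabu (small eps1).
rewrite Lp_norm1E; set L := (X in (_ <= _ * X)%E).
have L0 : (0 <= L)%E by apply: integral_ge0 => x _; rewrite lee_fin.
(* the bound is trivial when the L^1 norm is infinite *)
have [Lfin|] := boolP (L \is a fin_num); last first.
  rewrite ge0_fin_numE// -leNgt leye_eq => /eqP ->.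
  by rewrite gt0_muley ?leey// lte_fin.
have uC := smooth_C1 [::] hu.
have pC i := smooth_C1 [:: i] hu.
have H := gradient_L2_le n_gt0 uC pC K0 E Lfin.
rewrite -(fineK Lfin) -EFinM; apply: Lp_norm2_le.
  by apply: mulr_ge0; [exact: ltW|exact: fine_ge0].
have [_ _ cp] := uC.
have cE : {in Ball 1, continuous (fun x : 'rV[R]_n => \sum_i pderivs [:: i] u x ^+ 2)}.
  by move=> x x1; apply: continuous_at_sum => i; apply: cts_sqr; exact: cp.
have half1 : 2^-1 < 1 :> R by rewrite invf_lt1// ltr1n.
have iE := Ball_integrable half1 cE.
rewrite (eq_integral (fun x => (\sum_i pderivs [:: i] u x ^+ 2)%:E)); last first.
  by move=> x _; rewrite sqr_enorm; congr (_%:E); apply: eq_bigr => i _; rewrite mxE.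
rewrite -(fineK (integrable_fin_num (measurable_Ball _) iE)) lee_fin.
apply: (le_trans H).
have -> : 2 * (mean_const (n := n) K * fine L ^+ 2) * 8 ^+ @absorption_power n =
    (Num.sqrt c * fine L) ^+ 2.
  by rewrite exprMn sqr_sqrtr// /c; ring.
rewrite ler_pXn2r ?nnegrE ?mulr_ge0 ?sqrtr_ge0 ?fine_ge0// ?(ltW c1)//.
by apply: ler_wpM2r; [exact: fine_ge0|rewrite lerDl].
Qed.
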